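(* Let $f$ be a $C^1$ symplectic twist diffeomorphism of $\mathbb A=\mathbb T\times\mathbb R$ and let $u:\mathbb T\times\mathbb R\to\mathbb R$ be a continuous map such that $u(0,c)=0$ for all $c$ and each $u_c=u(\cdot,c)$ is a weak K.A.M. solution for the cohomology class $c$. The following are equivalent: (1) $f$ is Lipschitz integrable; (2) the map $u$ is $C^1$ with - $\frac{\partial u}{\partial\theta}$ locally Lipschitz continuous; - $\frac{\partial u}{\partial c}$ uniformly Lipschitz continuous in the variable $\theta$ on any compact set of $c$'s; - for every compact subset $\mathcal K\subset\mathbb A$, there exists a constant $k>-1$ such that $\frac{\partial^2u}{\partial\theta\partial c}>k$ Lebesgue almost everywhere in $\mathcal K$. In this case, there exists an exact symplectic homeomorphism $\Phi:\mathbb T\times\mathbb R\to\mathbb T\times\mathbb R$ that is $C^1$ in the $\theta$ variable and maps the invariant foliation onto the standard one, such that $$\forall(x,c)\in\mathbb T\times\mathbb R,\quad\Phi\circ f\circ\Phi^{-1}(x,c)=(x+\rho(c),c),$$ where $\rho:\mathbb R\to\mathbb R$ is an increasing homeomorphism.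
   Context: $\mathbb T=\mathbb R/\mathbb Z$, $\mathbb A=\mathbb T\times\mathbb R$ with coordinates $(\theta,r)$. Symplectic twist map (or diffeomorphism): a $C^1$ diffeomorphism $f:\mathbb A\to\mathbb A$ that is isotopic to the identity; exact symplectic, i.e. if $f(\theta,r)=(\Theta,R)$ then the 1-form $R\,d\Theta-r\,d\theta$ is exact; and has the twist property: for any lift $F=(F_1,F_2):\mathbb R^2\to\mathbb R^2$ of $f$ and any $\tilde\theta\in\mathbb R$, the map $r\mapsto F_1(\tilde\theta,r)$ is an increasing $C^1$ diffeomorphism from $\mathbb R$ onto $\mathbb R$. Generating function: fix a lift $F$ of $f$. A $C^2$ function $S:\mathbb R^2\to\mathbb R$ is a generating function of $F$ if $S(\theta+1,\Theta+1)=S(\theta,\Theta)$; $S(\theta,\Theta)/|\Theta-\theta|\to+\infty$ as $|\Theta-\theta|\to\infty$; for all $\theta_0,\Theta_0$ the maps $\theta\mapsto\frac{\partial S}{\partial\Theta}(\theta,\Theta_0)$ and $\Theta\mapsto\frac{\partial S}{\partial\theta}(\theta_0,\Theta)$ are decreasing diffeomorphisms of $\mathbb R$; and $F(\theta,r)=(\Theta,R)\Leftrightarrow r=-\frac{\partial S}{\partial\theta}(\theta,\Theta)$ and $R=\frac{\partial S}{\partial\Theta}(\theta,\Theta)$. Fix such an $S$. Weak K.A.M. solutions: for $c\in\mathbb R$ there is a unique $\alpha(c)\in\mathbb R$ for which there exists $u\in C^0(\mathbb T,\mathbb R)$ whose lift $\tilde u:\mathbb R\to\mathbb R$ satisfies,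 for all $\theta\in\mathbb R$, $\tilde u(\theta)=\inf_{\theta'\in\mathbb R}\big(\tilde u(\theta')+S(\theta',\theta)+c(\theta'-\theta)+\alpha(c)\big)$. Any such $u$ is a weak K.A.M. solution for the cohomology class $c$. $f$ is Lipschitz integrable if it has an invariant Lipschitz foliation into graphs: there is a family $(\eta_a)_{a\in\mathbb R}$ in $C^0(\mathbb T,\mathbb R)$ such that $(\theta,a)\mapsto(\theta,\eta_a(\theta))$ is a homeomorphism of $\mathbb A$ that is locally biLipschitz and the graph of each $\eta_a$ is invariant by $f$. The standard foliation is the foliation of $\mathbb A$ into the circles $\mathbb T\times\{c\}$, $c\in\mathbb R$. A diffeomorphism $g:\mathbb A\to\mathbb A$ is exact symplectic if it is homotopic to the identity and the 1-form $g^*(r\,d\theta)-r\,d\theta$ is exact. An exact symplectic homeomorphism is a homeomorphism that is locally a $C^0$ uniform limit of exact symplectic diffeomorphisms. *)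

(* Defs.v *)
From HB Require Import structures.
From mathcomp Require Import all_boot all_order all_algebra.
From mathcomp Require Import generic_quotient ring_quotient.
From mathcomp Require Import all_classical all_reals all_analysis.
From mathcomp Require Import ring lra.

Set Implicit Arguments.
Unset Strict Implicit.
Unset Printing Implicit Defensive.

Import Order.TTheory GRing.Theory Num.Theory.
Import numFieldTopology.Exports numFieldNormedType.Exports.

Local Open Scope classical_set_scope.
Local Open Scope ring_scope.

(** * The circle T = R/Z and the annulus A = T x R *)

Definition int_subgroup (R : realType) : zmodClosed R :=
  GRing.ZmodClosed.clone R (@archimedean.Num.int_num_subdef R) _.

Definition circle (R : realType) : Type := Quotient.quot (int_subgroup R).

HB.instance Definition _ (R : realType) := GRing.Zmodule.on (circle R).

Definition circle_pi (R : realType) (x : R) : circle R :=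
  (\pi_(Quotient.quot (int_subgroup R)) x)%qT.

(* Distance from x to the nearest integer. *)
Definition int_dist (R : realType) (x : R) : R :=
  `|x - (Num.floor (x + 2^-1))%:~R|.

(* Flat distance on R/Z; see circle_distE for its value on classes. *)
Definition circle_dist (R : realType) (a b : circle R) : R :=
  int_dist (repr a - repr b).

Section CircleMetric.
Variable R : realType.
Implicit Types (x y : R) (a b c : circle R).

Lemma circle_piP x y :
  reflect (circle_pi x = circle_pi y) (x - y \is a Num.int).
Proof.
have -> : (x - y \is a Num.int) = (x - y \in int_subgroup R) by [].
by rewrite Quotient.idealrBE; exact: eqP.
Qed.

Lemma circle_reprK a : circle_pi (repr a) = a.
Proof. exact: reprK. Qed.

Lemma circle_piD x y : circle_pi (x + y) = circle_pi x + circle_pi y.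
Proof. exact: Quotient.pi_add. Qed.

Lemma int_dist_le x (k : int) : int_dist x <= `|x - k%:~R|.
Proof.
rewrite /int_dist; set m := Num.floor _.
have /andP[m1 m2] : m%:~R <= x + 2^-1 < (m + 1)%:~R by exact: floor_itv.
rewrite intrD in m2.
have [km|km|->//] := ltgtP k m.
- have : (k + 1)%:~R <= m%:~R :> R by rewrite ler_int lezD1.
  rewrite intrD => h; rewrite [leRHS]ger0_norm; last by lra.
  by rewrite ler_norml; apply/andP; split; lra.
- have : (m + 1)%:~R <= k%:~R :> R by rewrite ler_int lezD1.
  rewrite intrD => h; rewrite [leRHS]ler0_norm; last by lra.
  by rewrite ler_norml; apply/andP; split; lra.
Qed.

Lemma int_distDint x (k : int) : int_dist (x + k%:~R) = int_dist x.
Proof.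
rewrite /int_dist (addrAC x k%:~R 2^-1) (floorDrz _ (intr_int _ _)) intrD intrKfloor.
by apply: (congr1 Num.norm); ring.
Qed.

Lemma int_distN x : int_dist (- x) = int_dist x.
Proof.
apply/le_anti/andP; split.
  apply: le_trans (int_dist_le _ (- Num.floor (x + 2^-1))) _.
  by rewrite intrN -opprD normrN.
apply: le_trans (int_dist_le _ (- Num.floor (- x + 2^-1))) _.
by rewrite intrN opprK -normrN opprD.
Qed.

Lemma circle_distE x y : circle_dist (circle_pi x) (circle_pi y) = int_dist (x - y).
Proof.
have e (z : R) : exists k : int, repr (circle_pi z) = z + k%:~R.
  have /circle_piP/intrP[k kE] := circle_reprK (circle_pi z).
  by exists k; rewrite -kE; ring.
rewrite /circle_dist; have [k ->] := e x; have [l ->] := e y.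
rewrite (_ : _ - _ = x - y + (k - l)%:~R) ?int_distDint//.
by rewrite intrB; ring.
Qed.

Let circle_distxx a : circle_dist a a = 0.
Proof.
apply/le_anti; rewrite /circle_dist normr_ge0 andbT subrr.
by rewrite (le_trans (int_dist_le _ 0))// subrr normr0.
Qed.

Let circle_dist_eq0 a b : circle_dist a b = 0 -> a = b.
Proof.
move=> /normr0_eq0/subr0_eq ab; rewrite -(circle_reprK a) -(circle_reprK b).
by apply/circle_piP; rewrite ab intr_int.
Qed.

Let circle_distC a b : circle_dist a b = circle_dist b a.
Proof. by rewrite /circle_dist -int_distN opprB. Qed.

Let circle_dist_triangle b a c :
  circle_dist a c <= circle_dist a b + circle_dist b c.
Proof.
rewrite /circle_dist; set x := repr a; set y := repr b; set z := repr c.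
rewrite (le_trans (int_dist_le _ (Num.floor (x - y + 2^-1) +
  Num.floor (y - z + 2^-1))))// intrD.
apply: le_trans (ler_normD _ _); rewrite le_eqVlt; apply/orP; left; apply/eqP.
by apply: (congr1 Num.norm); ring.
Qed.

HB.instance Definition _ := isMetric.Build R (circle R)
  circle_distxx circle_dist_eq0 circle_distC circle_dist_triangle.

End CircleMetric.

Notation annulus R := (circle R * R)%type.

Definition annulus_pi (R : realType) (p : R * R) : annulus R :=
  (circle_pi p.1, p.2).

Definition annulus_dist (R : realType) (p q : annulus R) : R :=
  Num.max (circle_dist p.1 q.1) `|p.2 - q.2|.

(** * Homeomorphisms and C^1 maps *)

Definition inverse_homeos (X Y : topologicalType) (g : X -> Y) (h : Y -> X) :=
  [/\ continuous g, continuous h, cancel g h & cancel h g].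

Definition homeomorphism (X Y : topologicalType) (g : X -> Y) :=
  exists h, inverse_homeos g h.

(* Used in finite dimension only, where continuity of every directional
   derivative amounts to continuity of the differential. *)
Definition C1 (R : realType) (V W : normedModType R) (F : V -> W) :=
  (forall x, differentiable F x) /\
  (forall v, continuous (fun x => 'D_v F x)).

Definition C2 (R : realType) (V W : normedModType R) (F : V -> W) :=
  C1 F /\ (forall v, C1 (fun x => 'D_v F x)).

Definition C1_diffeo (R : realType) (V W : normedModType R) (F : V -> W) :=
  exists G : W -> V, [/\ C1 F, C1 G, cancel F G & cancel G F].

Definition increasing_diffeo (R : realType) (g : R -> R) :=
  C1_diffeo g /\ {homo g : x y / x < y}.

Definition decreasing_diffeo (R : realType) (g : R -> R) :=
  C1_diffeo g /\ {homo g : x y /~ x < y}.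

(* Partial derivatives of a function on R^2. *)
Definition partial1 (R : realType) (S : R * R -> R) (p : R * R) : R :=
  'D_((1, 0) : R * R) S p.

Definition partial2 (R : realType) (S : R * R -> R) (p : R * R) : R :=
  'D_((0, 1) : R * R) S p.

(** * Symplectic twist maps of the annulus *)

Section TwistMaps.
Variable R : realType.
Implicit Types (f g : annulus R -> annulus R) (F : R * R -> R * R).

Definition is_lift F f :=
  continuous F /\ forall p, annulus_pi (F p) = f (annulus_pi p).

(* annulus_pi is a local diffeomorphism, so regularity is read on a lift. *)
Definition annulus_C1 f := exists F, is_lift F f /\ C1 F.

Definition annulus_C1_diffeo f :=
  exists g, [/\ annulus_C1 f, annulus_C1 g, cancel f g & cancel g f].

Definition homotopy_to_id (H : R -> annulus R -> annulus R) f :=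
  [/\ {within `[0, 1] `*` setT,
        continuous (fun z : R * annulus R => H z.1 z.2)},
      H 0 =1 id & H 1 =1 f].

Definition homotopic_to_id f := exists H, homotopy_to_id H f.

Definition isotopic_to_id f :=
  exists2 H, homotopy_to_id H f & forall t, 0 <= t <= 1 -> homeomorphism (H t).

(* With f(theta, r) = (Theta, R), the 1-form R dTheta - r dtheta is the
   differential dh of a C^1 function h on the annulus. Both sides are evaluated
   in the universal cover, at the point p and on the tangent vector v. *)
Definition exact_one_form f :=
  exists (F : R * R -> R * R) (h : annulus R -> R),
    [/\ is_lift F f, C1 F, C1 (h \o @annulus_pi R) &
      forall p v : R * R, 'D_v (h \o @annulus_pi R) p =
        (F p).2 * 'D_v (fun q => (F q).1) p - p.2 * v.1].

Definition twist_property f :=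
  forall F, is_lift F f ->
  forall theta, increasing_diffeo (fun r => (F (theta, r)).1).

Definition symplectic_twist_map f :=
  [/\ annulus_C1_diffeo f, isotopic_to_id f, exact_one_form f &
      twist_property f].

Definition exact_symplectic_diffeo g :=
  [/\ annulus_C1_diffeo g, homotopic_to_id g & exact_one_form g].

Definition exact_symplectic_homeo g :=
  homeomorphism g /\
  exists2 gn : nat -> annulus R -> annulus R,
    forall n, exact_symplectic_diffeo (gn n) &
    forall K : set (annulus R), compact K -> {uniform K, gn @ \oo --> g}.

(** * Generating functions and weak K.A.M. solutions *)

Definition generating_function F (S : R * R -> R) :=
  [/\ C2 S,
      forall theta Theta, S (theta + 1, Theta + 1) = S (theta, Theta),
      forall M, exists N, forall theta Theta, N < `|Theta - theta| ->
        M < S (theta, Theta) / `|Theta - theta|,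
      (forall Theta0,
         decreasing_diffeo (fun theta => partial2 S (theta, Theta0))) /\
      (forall theta0,
         decreasing_diffeo (fun Theta => partial1 S (theta0, Theta))) &
      forall theta r Theta r', F (theta, r) = (Theta, r') <->
        r = - partial1 S (theta, Theta) /\ r' = partial2 S (theta, Theta)].

(* The number alpha is determined by S and c. The infimum is taken in the
   extended reals, so that the equation includes its finiteness. *)
Definition weak_KAM_solution (S : R * R -> R) (c : R) (u : circle R -> R) :=
  continuous u /\
  exists alpha : R, forall theta : R,
    (u (circle_pi theta))%:E =
    ereal_inf [set (u (circle_pi theta') + S (theta', theta)
                    + c * (theta' - theta) + alpha)%:E | theta' in [set: R]].

(** * Lipschitz integrability *)

Definition leaf (eta : circle R -> R) : set (annulus R) :=
  [set p | p.2 = eta p.1].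

Definition horizontal_circle (c : R) : set (annulus R) := [set p | p.2 = c].

Definition locally_biLipschitz g :=
  forall p : annulus R, exists L : R, exists2 V : set (annulus R), nbhs p V &
    forall x y, V x -> V y ->
      annulus_dist (g x) (g y) <= L * annulus_dist x y /\
      annulus_dist x y <= L * annulus_dist (g x) (g y).

Definition lipschitz_foliation f (eta : R -> circle R -> R) :=
  let chart (p : annulus R) : annulus R := (p.1, eta p.2 p.1) in
  [/\ forall a, continuous (eta a), homeomorphism chart,
      locally_biLipschitz chart &
      forall a, f @` leaf (eta a) = leaf (eta a)].

Definition lipschitz_integrable f := exists eta, lipschitz_foliation f eta.

(** * Regularity of the family of weak K.A.M. solutions *)

Definition locally_lipschitz (V W : normedModType R) (G : V -> W) :=
  forall p : V, exists L : R, exists2 U : set V, nbhs p U & L.-lipschitz_U G.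

(* partial2 U is Lipschitz in theta, hence its theta-derivative exists almost
   everywhere; a Lebesgue null set of the annulus is one whose preimage in R^2
   is null. *)
Definition regular_family (u : annulus R -> R) :=
  let U := u \o @annulus_pi R in
  [/\ C1 U,
      locally_lipschitz (partial1 U),
      forall C : set R, compact C -> exists L : R, forall c, C c ->
        L.-lipschitz (fun theta : R => partial2 U (theta, c)) &
      forall K : set (annulus R), compact K -> exists2 k : R, -1 < k &
        {ae (lebesgue_measure \x lebesgue_measure)%E, forall p : R * R,
          K (annulus_pi p) ->
          derivable (partial2 U) p ((1, 0) : R * R) /\
          k < partial1 (partial2 U) p}].

(* A map from the circle to the annulus is C^1 when it has a C^1 lift. *)
Definition circle_C1 (g : circle R -> annulus R) :=
  exists2 G : R -> R * R, C1 G &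
    forall theta, annulus_pi (G theta) = g (circle_pi theta).

End TwistMaps.

(* Main.v *)
Require Import Defs.
From HB Require Import structures.
From mathcomp Require Import all_boot all_order all_algebra.
From mathcomp Require Import all_classical all_reals all_analysis.
From mathcomp Require Import ring lra.

Set Implicit Arguments.
Unset Strict Implicit.
Unset Printing Implicit Defensive.

Import Order.TTheory GRing.Theory Num.Theory.
Import numFieldTopology.Exports numFieldNormedType.Exports.

Local Open Scope classical_set_scope.
Local Open Scope ring_scope.

(** Why the theorem holds.

    Work in the universal cover.  A leaf of an invariant Lipschitz foliation
    lifts to a periodic function eta c, indexed by its mean c, with primitive
    prim c vanishing at 0, and f acts on it through a lift dyn c of a circle
    homeomorphism.  The function
      excess c x y = prim c x + S (x, y) - prim c y + alph c
    is nonnegative and vanishes exactly when y = dyn c x.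

    (1) => (2).  The leaf of mean c carries the weak K.A.M. solution
    prim c x - c x, and it is the only one ([weak_KAM_unique]): the difference
    X between a solution and the leaf grows along a chain by at most the total
    excess of the chain; following instead of dyn c the dynamics of a leaf of
    mean c' slightly above c, the excess telescopes to O(c' - c) whatever the
    length of the chain, and c' can be tuned so that the chain joins any two
    points modulo 1.  Hence u (x, c) = prim c x - c x and its derivative in x is
    eta c x - c.  The derivative in c is the hard point.  Positivity of the
    excess says that the quotients v = (prim c' - prim c) / (c' - c) satisfy
      v (dyn c x) <= v x + s <= v (dyn c' x),
    so that all their limits are bi-Lipschitz conjugacies from dyn c to a
    rotation.  To see that there is only one limit hh c, that it is C^1 in x and
    continuous in c:
    - dyn c is differentiable with a jointly continuous derivative
      ([slope_cont2]), because limits of difference quotients along an orbit are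
      bounded positive solutions of a Jacobi equation, and a Wronskian shows that
      such a solution is unique;
    - when rot c is irrational the conjugacy is unique since orbits are dense;
      its upper and lower slopes are multiplied by the same cocycle, so their
      ratio is invariant and semicontinuous, hence constant ([conj_C1_irr]);
    - when rot c is rational all orbits of the leaf are periodic, and a second
      order expansion of the excess summed over a period fixes the density of
      every limit up to a constant ([rat_limit], [rat_unique]);
    - continuity in c is proved in [hh_cont2].
    In particular the x-derivative of the c-derivative of u, which is dens c x - 1,
    exists everywhere and stays above -1 on compact sets.

    (2) => (1).  By Fubini and a covering argument ([null_deriv_incr]) the almost
    everywhere bound integrates to eta c' x - eta c x >= m (c' - c) with m > 0, for
    eta c x = c + du/dx.  Minimisers in the definition of u exist by coercivity of S,
    and their first order conditions make the graph of eta c invariant.  The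
    graphs sweep the annulus because the twist would otherwise bound the means c.

    Straightening.  (x, eta c x) |-> (hh c x, c) conjugates f to
    (x, c) |-> (x + rot c, c).  If A averages the c-primitive of prim over
    [c - e, c + e], the map (x, dA/dx) |-> (dA/dc, c) is a diffeomorphism, it
    is exact symplectic since c d(A_c) - A_x dx = d(c A_c - A), and it tends to the
    straightening map as e tends to 0 ([straighten_exact_homeo]). *)

(** * Limits along ultrafilters and calculus on the line *)

Section UltraLimits.
Context {R : realType}.

(** Compactness of segments. Limits of bounded families are taken along
    ultrafilters throughout, which avoids extracting subsequences. *)
Lemma bounded_ultra_cvg (T : Type) (U : set_system T) (f : T -> R) (M : R) :
  UltraFilter U -> (\forall t \near U, `|f t| <= M) -> exists l : R, f @ U --> l.
Proof.
move=> UU fM.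
have := @segment_compact R (- M) M; rewrite compact_ultra => cp.
have UF : UltraFilter (f @ U).
  split; first exact: fmap_proper_filter.
  move=> G GF fUG; apply/seteqP; split=> // A GA.
  have [//|UnA] := in_ultra_setVsetC (f @^-1` A) UU.
  have /fUG : (f @ U) (~` A) by [].
  by move=> GnA; exfalso; apply: (@filter_not_empty _ G _); rewrite -(setICr A); exact: filterI.
have [|l [_ ul]] := cp _ UF.
  by apply: filterS fM => t; rewrite /= in_itv/= ler_norml.
by exists l.
Qed.

(** If f left some neighbourhood of l frequently, an ultrafilter finer than
    F would contain that bad set. Hence it suffices to identify the limits
    along finer ultrafilters. *)
Lemma cvg_ultraP (T : Type) (F : set_system T) {FF : Filter F} (f : T -> R) (l : R) :
  (forall U, UltraFilter U -> F `<=` U -> f @ U --> l) -> f @ F --> l.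
Proof.
move=> H; apply/cvgrPdist_lt => e e0; apply: contrapT => nF.
pose A := [set t | `|l - f t| < e].
pose G := filter_from F (fun B => B `&` ~` A).
have PG : ProperFilter G.
  apply: filter_from_proper.
    apply: filter_from_filter; first by exists setT; exact: filterT.
    move=> B C FB FC; exists (B `&` C); first exact: filterI.
    by move=> t [[Bt Ct] nA]; split.
  move=> B FB; apply: contrapT => BA; apply: nF.
  apply: filterS FB => t Bt; apply: contrapT => nAt; apply: BA.
  by exists t.
have [U [UU GU]] := ultraFilterLemma PG.
have FU : F `<=` U by move=> B FB; apply: GU; exists B => // t [].
have /cvgrPdist_lt/(_ _ e0) UA := H U UU FU.
have UnA : U (~` A) by apply: GU; exists setT; [exact: filterT|move=> t []].
by apply: (@filter_not_empty _ U _); rewrite -(setICr A); exact: filterI.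
Qed.

Lemma ultra_near_or (T : Type) (U : set_system T) (P : T -> Prop) :
  UltraFilter U -> (\forall t \near U, P t) \/ (\forall t \near U, ~ P t).
Proof. by move=> UU; exact: (in_ultra_setVsetC [set t | P t] UU). Qed.

Lemma cvg_between (T : Type) (F : set_system T) {FF : Filter F} (x y z : T -> R) (a : R) :
   x @ F --> a -> y @ F --> a ->
  (forall t, Num.min (x t) (y t) <= z t <= Num.max (x t) (y t)) -> z @ F --> a.
Proof.
move=> /cvgrPdist_lt xa /cvgrPdist_lt ya H.
apply/cvgrPdist_lt => e e0; near=> t.
have /ltr_normlP [x1 x2] : `|a - x t| < e by near: t; exact: xa.
have /ltr_normlP [y1 y2] : `|a - y t| < e by near: t; exact: ya.
have /andP[z1 z2] := H t.
have [xy|xy] := leP (x t) (y t); move: z1 z2.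
  by rewrite (min_idPl xy) (max_idPr xy) => *; rewrite ltr_norml; lra.
by rewrite (min_idPr (ltW xy)) (max_idPl (ltW xy)) => *; rewrite ltr_norml; lra.
Unshelve. all: by end_near. Qed.

Lemma cvg_eq_near (T : Type) (F : set_system T) {FF : Filter F} (f g : T -> R) (a : R) :
   (\forall t \near F, f t = g t) -> f @ F --> a -> g @ F --> a.
Proof.
move=> fg fa; apply: cvg_trans fa; apply: near_eq_cvg.
by apply: filterS fg.
Qed.

Lemma cvg_uniq (T : Type) (F : set_system T) {FF : ProperFilter F} (f : T -> R) (a b : R) :
   f @ F --> a -> f @ F --> b -> a = b.
Proof. by move=> fa fb; apply: (cvg_unique _ fa fb). Qed.

Lemma cvg_le (T : Type) (F : set_system T) {FF : ProperFilter F} (f g : T -> R) (a b : R) :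
   f @ F --> a -> g @ F --> b -> (\forall t \near F, f t <= g t) -> a <= b.
Proof. move=> /cvgrPdist_lt fa /cvgrPdist_lt gb fg; rewrite leNgt; apply/negP => ba.
have e0 : 0 < (a - b) / 2 by rewrite divr_gt0// subr_gt0.
have [t [[]]] := filter_ex (filterI (filterI (fa _ e0) (gb _ e0)) fg).
by move=> /ltr_normlP[_ h1] /ltr_normlP[h2 _]; lra. Qed.

Lemma cvg_le_cst (T : Type) (F : set_system T) {FF : ProperFilter F} (f : T -> R) (a b : R) :
   f @ F --> a -> (\forall t \near F, f t <= b) -> a <= b.
Proof. by move=> fa; apply: cvg_le fa (cvg_cst b). Qed.

Lemma cvg_ge_cst (T : Type) (F : set_system T) {FF : ProperFilter F} (f : T -> R) (a b : R) :
   f @ F --> a -> (\forall t \near F, b <= f t) -> b <= a.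
Proof. by move=> fa; apply: cvg_le (cvg_cst b) fa. Qed.

Lemma cvg_abs0 (T : Type) (F : set_system T) {FF : Filter F} (f g : T -> R) (a : R) :
   (\forall t \near F, `|f t - a| <= g t) -> g @ F --> 0 -> f @ F --> a.
Proof.
move=> fg /cvgrPdist_lt g0; apply/cvgrPdist_lt => e e0; near=> t.
have H : `|f t - a| <= g t by near: t.
have : `|0 - g t| < e by near: t; exact: g0.
rewrite sub0r normrN => /(le_lt_trans (ler_norm _)).
by rewrite distrC; exact: le_lt_trans.
Unshelve. all: by end_near. Qed.

Section Limits.
Context {T : Type} {F : set_system T} {FF : Filter F}.
Implicit Types (f g : T -> R) (a b : R).

Lemma limD f g a b : f @ F --> a -> g @ F --> b -> (fun t => f t + g t) @ F --> a + b.
Proof. exact: cvgD. Qed.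

Lemma limB f g a b : f @ F --> a -> g @ F --> b -> (fun t => f t - g t) @ F --> a - b.
Proof. exact: cvgB. Qed.

Lemma limM f g a b : f @ F --> a -> g @ F --> b -> (fun t => f t * g t) @ F --> a * b.
Proof. exact: cvgM. Qed.

Lemma limN f a : f @ F --> a -> (fun t => - f t) @ F --> - a.
Proof. exact: cvgN. Qed.

Lemma limV f a : a != 0 -> f @ F --> a -> (fun t => (f t)^-1) @ F --> a^-1.
Proof. exact: cvgV. Qed.

Lemma lim_div f g a b : b != 0 -> f @ F --> a -> g @ F --> b ->
  (fun t => f t / g t) @ F --> a / b.
Proof. by move=> b0 fa gb; apply: limM => //; exact: limV. Qed.

Lemma limn f a : f @ F --> a -> (fun t => `|f t|) @ F --> `|a|.
Proof. exact: cvg_norm. Qed.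

Lemma limX f a (n : nat) : f @ F --> a -> (fun t => f t ^+ n) @ F --> a ^+ n.
Proof.
move=> fa; elim: n => [|n IH]; first exact: cvg_cst.
by rewrite exprS; under eq_fun do rewrite exprS; exact: limM.
Qed.

Lemma lim_sum (I : Type) (r : seq I) (f : I -> T -> R) (a : I -> R) :
  (forall i, f i @ F --> a i) ->
  (fun t => \sum_(i <- r) f i t) @ F --> \sum_(i <- r) a i.
Proof.
move=> fa; elim: r => [|i r IH].
  by rewrite big_nil; under eq_fun do rewrite big_nil; exact: cvg_cst.
by rewrite big_cons; under eq_fun do rewrite big_cons; exact: limD.
Qed.

Lemma lim_continuous f (h : R -> R) a : f @ F --> a -> {for a, continuous h} ->
  (fun t => h (f t)) @ F --> h a.
Proof. by move=> fa ha; exact: (cvg_comp f h fa ha). Qed.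

End Limits.

End UltraLimits.

Section Calculus.
Context {R : realType}.
Implicit Types (f df : R -> R) (x y z : R).

Lemma MVT_any f df x y : (forall z, is_derive z 1 f (df z)) ->
  exists2 z, Num.min x y <= z <= Num.max x y & f y - f x = df z * (y - x).
Proof.
move=> fdf.
have cf z : {for z, continuous f} by apply/differentiable_continuous/derivable1_diffP.
have [xy|yx] := leP x y.
  have [|z zxy E] := @MVT_segment _ f df x y xy (fun z _ => fdf z).
    exact: continuous_subspaceT.
  by exists z => //; move: zxy; rewrite in_itv.
have [|z zxy E] := @MVT_segment _ f df y x (ltW yx) (fun z _ => fdf z).
  exact: continuous_subspaceT.
exists z; first by move: zxy; rewrite in_itv.
by rewrite -opprB E -mulrN opprB.
Qed.

Lemma MVT_lt f df x y : x < y -> (forall z, is_derive z 1 f (df z)) ->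
  exists2 z, x < z < y & f y - f x = df z * (y - x).
Proof.
move=> xy fdf; have [|z zxy E] := @MVT _ f df x y xy (fun z _ => fdf z).
  apply: continuous_subspaceT => z.
  by apply/differentiable_continuous/derivable1_diffP.
by exists z => //; move: zxy; rewrite in_itv.
Qed.

Lemma derive_ge0_nondecr f df : (forall z, is_derive z 1 f (df z)) ->
  (forall z, 0 <= df z) -> {homo f : x y / x <= y}.
Proof.
move=> fdf df0 x y xy; have [z _ E] := MVT_any x y fdf.
by rewrite -subr_ge0 E mulr_ge0// subr_ge0.
Qed.

Lemma derive_gt0_incr f df : (forall z, is_derive z 1 f (df z)) ->
  (forall z, 0 < df z) -> {homo f : x y / x < y}.
Proof.
move=> fdf df0 x y xy; have [z _ E] := MVT_any x y fdf.
by rewrite -subr_gt0 E mulr_gt0// subr_gt0.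
Qed.

Lemma is_derive_cont f (d x : R) : is_derive x 1 f d -> {for x, continuous f}.
Proof. by move=> fd; apply/differentiable_continuous/derivable1_diffP. Qed.

(** Derivatives as limits of plain quotients, the form in which all limits
    are computed below. *)
Lemma is_deriveP f (d x : R) : is_derive x 1 f d <->
  (f (x + h) - f x) / h @[h --> 0^'] --> d.
Proof.
have E : (fun h => h^-1 *: (f (h *: 1 + x) - f x)) = (fun h => (f (x + h) - f x) / h).
  by apply/funext => h; rewrite [LHS]mulrC [h *: 1]mulr1 [x + h]addrC.
split.
  move=> [ex <-]; rewrite /derive /=.
  by move: ex; rewrite /derivable E.
move=> H; apply: DeriveDef; rewrite /derivable ?/derive E.
  by apply/cvg_ex; exists d.
exact: cvg_lim H.
Qed.

Lemma mvt_filter (T : Type) (F : set_system T) {FF : Filter F} f df (x y : T -> R) (a : R) :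
   (forall z, is_derive z 1 f (df z)) -> {for a, continuous df} ->
  x @ F --> a -> y @ F --> a ->
  exists2 b : T -> R, b @ F --> df a &
    forall t, f (y t) - f (x t) = b t * (y t - x t).
Proof.
move=> fdf cdf xa ya.
have /choice[z Hz] t : exists z, Num.min (x t) (y t) <= z <= Num.max (x t) (y t)
    /\ f (y t) - f (x t) = df z * (y t - x t).
  by have [z ? ?] := MVT_any (x t) (y t) fdf; exists z.
exists (df \o z); last by move=> t; have [] := Hz t.
have za : z @ F --> a by apply: (cvg_between xa ya) => t; have [] := Hz t.
exact: (cvg_comp z df za cdf).
Qed.

(** The mean value theorem as a statement about limits: the intermediate
    derivative converges by joint continuity of df. *)
Lemma mvt_filter2 (T : Type) (F : set_system T) {FF : Filter F} (f df : R -> R -> R)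
    (u x y : T -> R) (c a : R) :
   (forall c z, is_derive z 1 (f c) (df c z)) ->
  {for (c, a), continuous (fun p : R * R => df p.1 p.2)} ->
  u @ F --> c -> x @ F --> a -> y @ F --> a ->
  exists2 b : T -> R, b @ F --> df c a &
    forall t, f (u t) (y t) - f (u t) (x t) = b t * (y t - x t).
Proof.
move=> fdf cdf uc xa ya.
have /choice[z Hz] t : exists z, Num.min (x t) (y t) <= z <= Num.max (x t) (y t)
    /\ f (u t) (y t) - f (u t) (x t) = df (u t) z * (y t - x t).
  by have [z ? ?] := MVT_any (x t) (y t) (fdf (u t)); exists z.
exists (fun t => df (u t) (z t)); last by move=> t; have [] := Hz t.
have za : z @ F --> a by apply: (cvg_between xa ya) => t; have [] := Hz t.
exact: (cvg_comp (fun t => (u t, z t)) (fun p : R * R => df p.1 p.2) (cvg_pair uc za) cdf).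
Qed.

Lemma antiderivative f : continuous f ->
  exists2 W : R -> R, W 0 = 0 & forall x, is_derive x 1 W (f x).
Proof.
move=> cf.
(* Glue the primitives based at -n, normalised at 0. *)
have intf (a b : R) : lebesgue_measure.-integrable `[a, b] (EFin \o f).
  apply: continuous_compact_integrable; first exact: segment_compact.
  exact: continuous_subspaceT.
have /choice[I dI] (a : R) : exists I : R -> R, forall x, a < x -> is_derive x 1 I (f x).
  exists (fun x => \int[lebesgue_measure]_(t in `[a, x]) (f t)) => x ax.
  have xx1 : x < x + 1 by lra.
  have [d1 d2] := @continuous_FTC1 R f (BLeft a) x (x + 1) xx1 (intf _ _) ax (cf x).
  apply: DeriveDef; first exact: d1.
  by rewrite -derive1E; exact: d2.
pose W (x : R) := I (- `|x| - 1) x - I (- `|x| - 1) 0.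
have W_I (a x : R) : a < x -> a < 0 -> W x = I a x - I a 0.
  move=> ax a0; rewrite /W; set b := - _ - 1.
  have bx : b < x by rewrite /b; have := ler_norm (- x); rewrite normrN; lra.
  have b0 : b < 0 by rewrite /b; have := normr_ge0 x; lra.
  pose m := Num.max a b.
  have mx : m < x by rewrite gt_max ax bx.
  have m0 : m < 0 by rewrite gt_max a0 b0.
  have ma : a <= m by rewrite le_max lexx.
  have mb : b <= m by rewrite le_max lexx orbT.
  have D z : z \in `]m, (`|x| + 1)[ -> is_derive z 1 (I a - I b) 0.
    rewrite in_itv/= => /andP[mz _]; rewrite -(subrr (f z)).
    by apply: is_deriveB; apply: dI; lra.
  have xb : x < `|x| + 1 by have := ler_norm x; lra.
  have nb : 0 < `|x| + 1 by have := normr_ge0 x; lra.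
  have {}D z : z \in `]m, (`|x| + 1)[ -> is_derive z 1 (fun y => I a y - I b y) 0 by exact: D.
  set k := fun y => I a y - I b y in D *.
  have kk u v : m < u -> u <= v -> v < `|x| + 1 -> k u = k v.
    move=> mu uv vx.
    have D' z : z \in `]u, v[ -> is_derive z 1 k ((fun=> 0) z).
      by rewrite in_itv/= => /andP[z1 z2]; apply: D; rewrite in_itv/=; lra.
    have [|z _] := MVT_segment uv D'.
    - apply: continuous_in_subspaceT => z; rewrite inE/= in_itv/= => /andP[z1 z2].
      by apply: (@is_derive_cont _ 0); apply: D; rewrite in_itv/=; lra.
    - by rewrite mul0r => /eqP; rewrite subr_eq0 => /eqP.
  have : k x = k 0 by have [x0|x0] := leP x 0; [apply: kk|apply/esym/kk => //; apply: ltW].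
  by rewrite /k /= => E; lra.
exists W; first by rewrite /W subrr.
move=> x; pose a := - `|x| - 1.
have ax : a < x by rewrite /a; have := ler_norm (- x); rewrite normrN; lra.
have a0 : a < 0 by rewrite /a; have := normr_ge0 x; lra.
apply: (@near_eq_is_derive _ _ _ (fun z => I a z - I a 0)).
  by near=> z; apply/esym/W_I => //; near: z; exact: lt_nbhsr.
have : is_derive x 1 (fun z => I a z - I a 0) (f x - 0) by apply: is_deriveB; exact: dI.
by rewrite subr0.
Unshelve. all: by end_near. Qed.

Lemma eq_antiderivative f g df : (forall x, is_derive x 1 f (df x)) ->
  (forall x, is_derive x 1 g (df x)) -> forall x y, f x - f y = g x - g y.
Proof.
move=> fd gd x y.
have D z : is_derive z 1 (f - g) 0 by rewrite -(subrr (df z)); exact: is_deriveB.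
by have [z _] := MVT_any y x D; rewrite mul0r !fctE => E; lra.
Qed.

End Calculus.

(** * Functions of two variables with continuous partial derivatives *)

Section Plane.
Context {R : realType}.
Implicit Types (f d : R -> R -> R).

Definition cont2 f := continuous (fun p : R * R => f p.1 p.2).

(** The class C^1 on the plane, with its partial derivatives as data;
    equivalent to the differential formulation by [has_partials_C1] and
    [C1_has_partials]. *)
Definition has_partials f (d1 d2 : R -> R -> R) :=
  [/\ forall x y : R, is_derive x 1 (f^~ y) (d1 x y),
      forall x y : R, is_derive y 1 (f x) (d2 x y), cont2 d1 & cont2 d2].

Lemma cont2_swap f : cont2 f -> cont2 (fun x y => f y x).
Proof.
move=> cf [x y].
exact: (cvg_comp (fun p : R * R => (p.2, p.1)) (fun p : R * R => f p.1 p.2)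
  (cvg_pair cvg_snd cvg_fst) (cf (y, x))).
Qed.

Lemma cont2_cvg (T : Type) (F : set_system T) {FF : Filter F} f (x y : T -> R) (a b : R) :
   cont2 f -> x @ F --> a -> y @ F --> b ->
  (fun t => f (x t) (y t)) @ F --> f a b.
Proof.
move=> cf xa yb.
exact: (cvg_comp (fun t => (x t, y t)) (fun p : R * R => f p.1 p.2) (cvg_pair xa yb) (cf (a, b))).
Qed.

Lemma cont2_comp f (g h : R -> R -> R) : cont2 f -> cont2 g -> cont2 h ->
  cont2 (fun x y => f (g x y) (h x y)).
Proof. by move=> cf cg ch p; apply: cont2_cvg => //; [exact: cg|exact: ch]. Qed.

Lemma cont2_fst : cont2 (fun x _ => x).
Proof. by move=> p; exact: cvg_fst. Qed.

Lemma cont2_snd : cont2 (fun _ y => y).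
Proof. by move=> p; exact: cvg_snd. Qed.

Lemma cont2_1 f x : cont2 f -> continuous (f x).
Proof. by move=> cf y; apply: cont2_cvg => //; exact: cvg_cst. Qed.

Lemma cont2_2 f y : cont2 f -> continuous (f^~ y).
Proof. by move=> cf x; apply: (@cont2_cvg _ _ _ f) => //; exact: cvg_cst. Qed.

Lemma has_partials_swap f d1 d2 :
  has_partials f d1 d2 -> has_partials (fun x y => f y x) (fun x y => d2 y x) (fun x y => d1 y x).
Proof. by case=> h1 h2 c1 c2; split=> //; exact: cont2_swap. Qed.

(** Move one coordinate at a time: an increment of f is a combination of the
    increments of x and y whose coefficients tend to the partial
    derivatives. *)
Lemma partials_slope (T : Type) (F : set_system T) {FF : Filter F} f d1 d2 (x x' y y' : T -> R) (a b : R) :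
   has_partials f d1 d2 ->
  x @ F --> a -> x' @ F --> a -> y @ F --> b -> y' @ F --> b ->
  exists al be : T -> R, [/\ al @ F --> d1 a b, be @ F --> d2 a b &
    forall t, f (x' t) (y' t) - f (x t) (y t) =
      al t * (x' t - x t) + be t * (y' t - y t)].
Proof.
move=> [h1 h2 c1 c2] xa x'a yb y'b.
have [|al ala alE] := @mvt_filter2 R T F _ (fun y x => f x y) (fun y x => d1 x y) y' x x' b a
  (fun c z => h1 z c) _ y'b xa x'a.
  by have := @cont2_swap _ c1; exact.
have [be bea beE] := @mvt_filter2 R T F _ f d2 x y y' a b h2 (c2 (a, b)) xa yb y'b.
exists al, be; split=> // t.
by rewrite -alE -beE; ring.
Qed.

Lemma is_derive_chain2 f d1 d2 (x y : R -> R) (t x' y' : R) : has_partials f d1 d2 ->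
  is_derive t 1 x x' -> is_derive t 1 y y' ->
  is_derive t 1 (fun t => f (x t) (y t)) (d1 (x t) (y t) * x' + d2 (x t) (y t) * y').
Proof.
move=> hf xd yd; apply/is_deriveP.
have shift0 : (fun h : R => t + h) @ 0^' --> t.
  rewrite -[X in _ --> X]addr0; apply: cvgD; first exact: cvg_cst.
  exact: nbhs_dnbhs.
have xs : (fun h => x (t + h)) @ 0^' --> x t.
  by apply: (cvg_comp _ _ shift0); exact: is_derive_cont xd.
have ys : (fun h => y (t + h)) @ 0^' --> y t.
  by apply: (cvg_comp _ _ shift0); exact: is_derive_cont yd.
have [al [be [ala bea E]]] := @partials_slope _ _ _ f d1 d2 (fun=> x t) (fun h => x (t + h))
  (fun=> y t) (fun h => y (t + h)) _ _ hf (cvg_cst _) xs (cvg_cst _) ys.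
have -> : (fun h => (f (x (t + h)) (y (t + h)) - f (x t) (y t)) / h) =
  (fun h => al h * ((x (t + h) - x t) / h) + be h * ((y (t + h) - y t) / h)).
  by apply/funext => h; rewrite E; ring.
by apply: cvgD; apply: cvgM => //; apply/is_deriveP.
Qed.

Definition lin2 (a b : R) (v : R * R) : R := v.1 * a + v.2 * b.

Lemma lin2_linear a b : linear (lin2 a b : R * R -> R^o).
Proof.
move=> k u v; rewrite /lin2 /=.
change ((k * u.1 + v.1) * a + (k * u.2 + v.2) * b =
  k * (u.1 * a + u.2 * b) + (v.1 * a + v.2 * b)); ring.
Qed.

HB.instance Definition _ a b := GRing.isLinear.Build R (R * R)%type R^o _ (lin2 a b) (lin2_linear a b).

Lemma has_partials_diff f d1 d2 (p : R * R) : has_partials f d1 d2 ->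
  is_diff p (fun p => f p.1 p.2) (lin2 (d1 p.1 p.2) (d2 p.1 p.2)).
Proof.
move=> hf; set L := lin2 _ _; set g := fun p => _.
have cL : continuous L.
  by move=> v; apply: cvgD; apply: cvgMr_tmp; [exact: cvg_fst|exact: cvg_snd].
have E : g \o shift p = cst (g p) + L +o_ (0 : R * R) id.
  apply/eqaddoP => e e0.
  have F1 : (fun h : R * R => p.1 + h.1) @ (0 : R * R) --> p.1.
    by rewrite -[X in _ --> X]addr0; apply: cvgD; [exact: cvg_cst|exact: cvg_fst].
  have F2 : (fun h : R * R => p.2 + h.2) @ (0 : R * R) --> p.2.
    by rewrite -[X in _ --> X]addr0; apply: cvgD; [exact: cvg_cst|exact: cvg_snd].
  have [al [be [ala bea EE]]] := @partials_slope _ _ _ f d1 d2 (fun=> p.1) _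
    (fun=> p.2) _ _ _ hf (cvg_cst _) F1 (cvg_cst _) F2.
  have e2 : 0 < e / 2 by rewrite divr_gt0.
  near=> h.
  have A : `|d1 p.1 p.2 - al h| < e / 2 by near: h; move/cvgrPdist_lt: ala; exact.
  have B : `|d2 p.1 p.2 - be h| < e / 2 by near: h; move/cvgrPdist_lt: bea; exact.
  have -> : (g \o shift p - (cst (g p) + L)) h =
      (al h - d1 p.1 p.2) * h.1 + (be h - d2 p.1 p.2) * h.2.
    rewrite /= !fctE /= /g /L /lin2 /= (addrC h.1) (addrC h.2) opprD addrA EE.
    ring.
  have n1 : `|h.1| <= `|h| by rewrite prod_normE le_max lexx.
  have n2 : `|h.2| <= `|h| by rewrite prod_normE le_max lexx orbT.
  apply: le_trans (ler_normD _ _) _; rewrite !normrM.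
  rewrite (distrC (al h)) (distrC (be h)).
  have : `|d1 p.1 p.2 - al h| * `|h.1| <= e / 2 * `|h| by apply: ler_pM => //; exact: ltW.
  have : `|d2 p.1 p.2 - be h| * `|h.2| <= e / 2 * `|h| by apply: ler_pM => //; exact: ltW.
  lra.
have dL := diff_unique cL E.
split; last exact: dL.
by apply/diff_locallyP; rewrite dL.
Unshelve. all: by end_near. Qed.

Lemma has_partials_D f d1 d2 (p v : R * R) : has_partials f d1 d2 ->
  'D_v (fun p => f p.1 p.2) p = v.1 * d1 p.1 p.2 + v.2 * d2 p.1 p.2.
Proof.
move=> hf; have df := has_partials_diff p hf.
by rewrite deriveE ?diff_val//; exact: ex_diff.
Qed.

Lemma has_partials_C1 f d1 d2 : has_partials f d1 d2 -> C1 (fun p : R * R => f p.1 p.2).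
Proof.
move=> hf; split; first by move=> p; case: (has_partials_diff p hf).
move=> v; have -> : (fun x => 'D_v (fun p : R * R => f p.1 p.2) x) =
  (fun p => v.1 * d1 p.1 p.2 + v.2 * d2 p.1 p.2).
  by apply/funext => p; rewrite (has_partials_D _ _ hf).
case: hf => _ _ c1 c2 p.
by apply: cvgD; apply: cvgMl_tmp; [exact: c1|exact: c2].
Qed.

Lemma has_partials_cont f d1 d2 : has_partials f d1 d2 -> cont2 f.
Proof.
by move=> hf p; case: (has_partials_diff p hf) => /differentiable_continuous.
Qed.

Lemma partial1_derive (Phi : R * R -> R) x y :
  derivable Phi (x, y) ((1, 0) : R * R) ->
  is_derive x 1 (fun x => Phi (x, y)) (partial1 Phi (x, y)).
Proof.
rewrite /derivable /partial1 /derive => H; apply/is_deriveP.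
set G := fun h => h^-1 *: _ in H *.
have -> : (fun h => (Phi (x + h, y) - Phi (x, y)) / h) = G.
  apply/funext => h; rewrite /G /= [RHS]mulrC; congr (_ / _); congr (Phi _ - _).
  by congr pair; rewrite /= ?[h *: 1]mulr1 ?[h *: 0]mulr0 ?add0r// addrC.
exact: H.
Qed.

Lemma partial2_derive (Phi : R * R -> R) x y :
  derivable Phi (x, y) ((0, 1) : R * R) ->
  is_derive y 1 (fun y => Phi (x, y)) (partial2 Phi (x, y)).
Proof.
rewrite /derivable /partial2 /derive => H; apply/is_deriveP.
set G := fun h => h^-1 *: _ in H *.
have -> : (fun h => (Phi (x, y + h) - Phi (x, y)) / h) = G.
  apply/funext => h; rewrite /G /= [RHS]mulrC; congr (_ / _); congr (Phi _ - _).
  by congr pair; rewrite /= ?[h *: 1]mulr1 ?[h *: 0]mulr0 ?add0r// addrC.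
exact: H.
Qed.

Lemma C1_has_partials (Phi : R * R -> R) : C1 Phi ->
  has_partials (fun x y => Phi (x, y)) (fun x y => partial1 Phi (x, y))
    (fun x y => partial2 Phi (x, y)).
Proof.
move=> [dP cP]; split.
- by move=> x y; apply: partial1_derive; apply: diff_derivable.
- by move=> x y; apply: partial2_derive; apply: diff_derivable.
- rewrite /cont2 /=; have -> : (fun p : R * R => partial1 Phi (p.1, p.2)) = 'D_((1, 0) : R * R) Phi.
    by apply/funext => -[].
  exact: cP.
- rewrite /cont2 /=; have -> : (fun p : R * R => partial2 Phi (p.1, p.2)) = 'D_((0, 1) : R * R) Phi.
    by apply/funext => -[].
  exact: cP.
Qed.

(** Both mixed derivatives are limits of the same second difference. *)
Lemma schwarz f d1 d2 d11 d12 d21 d22 : has_partials f d1 d2 ->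
  has_partials d1 d11 d12 -> has_partials d2 d21 d22 -> forall x y, d12 x y = d21 x y.
Proof.
move=> [f1 f2 _ _] [_ h12 _ c12] [h21 _ c21 _] x y.
pose F := (0 : R)^'.
have F0 : (fun h : R => h) @ F --> 0 by exact: nbhs_dnbhs.
have xh : (fun h : R => x + h) @ F --> x.
  by rewrite -[X in _ --> X]addr0; apply: cvgD => //; exact: cvg_cst.
have yh : (fun h : R => y + h) @ F --> y.
  by rewrite -[X in _ --> X]addr0; apply: cvgD => //; exact: cvg_cst.
have /choice[z Hz] h : exists z : R * R,
    [/\ Num.min x (x + h) <= z.1 <= Num.max x (x + h),
        Num.min y (y + h) <= z.2 <= Num.max y (y + h) &
     f (x + h) (y + h) - f x (y + h) - (f (x + h) y - f x y) = d12 z.1 z.2 * h * h].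
  have D (u : R) : is_derive u 1 (fun u : R => f u (y + h) - f u y) (d1 u (y + h) - d1 u y).
    exact: is_deriveB.
  have [z1 z1i E1] := MVT_any x (x + h) D.
  have [z2 z2i E2] := MVT_any y (y + h) (h12 z1).
  exists (z1, z2); split=> //=.
  have -> : f (x + h) (y + h) - f x (y + h) - (f (x + h) y - f x y) =
    f (x + h) (y + h) - f (x + h) y - (f x (y + h) - f x y) by ring.
  by rewrite E1 E2; ring.
have /choice[w Hw] h : exists z : R * R,
    [/\ Num.min x (x + h) <= z.1 <= Num.max x (x + h),
        Num.min y (y + h) <= z.2 <= Num.max y (y + h) &
     f (x + h) (y + h) - f x (y + h) - (f (x + h) y - f x y) = d21 z.1 z.2 * h * h].
  have D (u : R) : is_derive u 1 (fun u : R => f (x + h) u - f x u) (d2 (x + h) u - d2 x u).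
    exact: is_deriveB.
  have [z2 z2i E2] := MVT_any y (y + h) D.
  have [z1 z1i E1] := MVT_any x (x + h) (h21 ^~ z2).
  exists (z1, z2); split=> //=.
  by rewrite E2 E1; ring.
have lim12 : (fun h => d12 (z h).1 (z h).2) @ F --> d12 x y.
  apply: cont2_cvg => //.
  - by apply: (cvg_between (cvg_cst x) xh) => h; have [] := Hz h.
  - by apply: (cvg_between (cvg_cst y) yh) => h; have [] := Hz h.
have lim21 : (fun h => d21 (w h).1 (w h).2) @ F --> d21 x y.
  apply: cont2_cvg => //.
  - by apply: (cvg_between (cvg_cst x) xh) => h; have [] := Hw h.
  - by apply: (cvg_between (cvg_cst y) yh) => h; have [] := Hw h.
apply: (cvg_uniq lim12); apply: (cvg_eq_near _ lim21); near=> h.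
have h0 : h != 0 by near: h; exact: nbhs_dnbhs_neq.
have [_ _ E1] := Hz h; have [_ _ E2] := Hw h.
by apply: (mulIf h0); apply: (mulIf h0); rewrite -E1 -E2.
Unshelve. all: by end_near. Qed.

End Plane.

(** * Twist maps, invariant leaves and the excess of a step *)

(** A generating function of class C^2 on the universal cover, with its
    derivatives, together with the first component gF of the lift. A
    strictly negative mixed derivative is the twist condition. *)
Record twist (R : realType) := Twist {
  gS : R -> R -> R;
  gS1 : R -> R -> R;
  gS2 : R -> R -> R;
  gS11 : R -> R -> R;
  gS12 : R -> R -> R;
  gS22 : R -> R -> R;
  gF : R -> R -> R;
  gS_d : has_partials gS gS1 gS2;
  gS1_d : has_partials gS1 gS11 gS12;
  gS2_d : has_partials gS2 gS12 gS22;
  gS_per : forall x y, gS (x + 1) (y + 1) = gS x y;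
  gS12_lt0 : forall x y, gS12 x y < 0;
  gF_cont : cont2 gF;
  gFP : forall x r y, gF x r = y <-> r = - gS1 x y
}.

(** An invariant Lipschitz foliation read on the universal cover. The leaves
    are indexed by their mean ([prim1]), increasingly, which makes the index
    the cohomology class. *)
Record leaves (R : realType) (t : twist R) := Leaves {
  eta : R -> R -> R;
  prim : R -> R -> R;
  eta_per : forall c x, eta c (x + 1) = eta c x;
  eta_cont : forall c, continuous (eta c);
  prim_d : forall c x : R, is_derive x 1 (prim c) (eta c x);
  prim0 : forall c, prim c 0 = 0;
  prim1 : forall c, prim c 1 = c;
  eta_inv : forall c x, gS2 t x (gF t x (eta c x)) = eta c (gF t x (eta c x));
  eta_lip : forall M, exists2 L, 0 < L & forall c c' x, - M <= c -> c <= c' -> c' <= M ->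
    (c' - c) / L <= eta c' x - eta c x <= L * (c' - c);
  eta_onto : forall x r, exists c, eta c x = r
}.

Section IVTs.
Context {R : realType}.

Lemma cont_IVT (f : R -> R) (a b v : R) : continuous f -> a <= b ->
  f a <= v <= f b -> exists2 c, a <= c <= b & f c = v.
Proof.
move=> cf ab /andP[av vb].
have [|c] := @IVT R f a b v ab (continuous_subspaceT cf).
  by rewrite ge_min av /= le_max vb orbT.
by rewrite in_itv/=; exists c.
Qed.

Lemma deg1_nat (f : R -> R) : (forall x, f (x + 1) = f x + 1) ->
  forall x (n : nat), f (x + n%:R) = f x + n%:R.
Proof.
move=> f1 x; elim=> [|n IH]; first by rewrite !addr0.
by rewrite -natr1 !addrA f1 IH.
Qed.

Lemma deg1_int (f : R -> R) : (forall x, f (x + 1) = f x + 1) ->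
  forall x (n : int), f (x + n%:~R) = f x + n%:~R.
Proof.
move=> f1 x [n|n]; first exact: deg1_nat.
rewrite NegzE intrN -[n.+1%:~R]/(n.+1%:R : R).
by apply: (addIr n.+1%:R); rewrite -deg1_nat// !subrK.
Qed.

Lemma per_nat (T : Type) (f : R -> T) : (forall x, f (x + 1) = f x) ->
  forall x (n : nat), f (x + n%:R) = f x.
Proof.
move=> f1 x; elim=> [|n IH]; first by rewrite addr0.
by rewrite -natr1 !addrA f1 IH.
Qed.

Lemma per_int (T : Type) (f : R -> T) : (forall x, f (x + 1) = f x) ->
  forall x (n : int), f (x + n%:~R) = f x.
Proof.
move=> f1 x [n|n]; first exact: per_nat.
rewrite NegzE intrN -[n.+1%:~R]/(n.+1%:R : R).
by rewrite -[in RHS](subrK n.+1%:R x) per_nat.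
Qed.

Lemma mod1 (x : R) : exists2 n : int, 0 <= x - n%:~R & x - n%:~R < 1.
Proof.
have /andP[a b] := floor_itv x.
by exists (Num.floor x); [rewrite subr_ge0|rewrite intrD in b; lra].
Qed.

Lemma ex_nat_gt (x : R) : exists n : nat, x < n%:R.
Proof. by exists (Num.bound `|x|); apply: le_lt_trans (ler_norm _) (archi_boundP _). Qed.

(** f x - x is bounded, so f takes arbitrarily large values of both signs. *)
Lemma deg1_onto (f : R -> R) : continuous f -> (forall x, f (x + 1) = f x + 1) ->
  forall y, exists x, f x = y.
Proof.
move=> cf f1 y.
have [n hn] := ex_nat_gt (`|y - f 0|).
have h1 := ler_norm (y - f 0); have h2 := ler_norm (- (y - f 0)); rewrite normrN in h2.
have F1 := deg1_nat f1 0 n; rewrite add0r in F1.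
have F2 := deg1_nat f1 (- n%:R) n; rewrite addNr in F2.
have [||x _ <-] := @cont_IVT f (- n%:R) n%:R y cf; last by exists x.
  by have : 0 <= n%:R :> R by []; lra.
by apply/andP; split; lra.
Qed.

(** If f x >= f y with x < y, then f returns to the value f x between y and
    y + n for n large, against injectivity. *)
Lemma deg1_inj_incr (f : R -> R) : continuous f -> (forall x, f (x + 1) = f x + 1) ->
  injective f -> {homo f : x y / x < y}.
Proof.
move=> cf f1 finj x y xy; rewrite ltNge; apply/negP => yx.
have [n hn] := ex_nat_gt (f x - f y).
have Fn := deg1_nat f1 y n.
have n0 : 0 <= n%:R :> R by [].
have [||z /andP[yz _] zx] := @cont_IVT f y (y + n%:R) (f x) cf; first lra.
  by apply/andP; split; lra.
by have := finj _ _ zx; lra.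
Qed.

Lemma per_bounded (f : R -> R) : continuous f -> (forall x, f (x + 1) = f x) ->
  exists2 M, 0 < M & forall x, `|f x| <= M.
Proof.
move=> cf f1.
have cn : {within `[0, 1], continuous (fun x => `|f x|)}.
  by apply: continuous_subspaceT => x; apply: continuous_comp; [exact: cf|exact: norm_continuous].
have [m _ mM] := EVT_max (@ler01 R) cn.
exists (`|f m| + 1); first by rewrite ltr_wpDl.
move=> x; have [n n0 n1] := mod1 x.
have : `|f (x - n%:~R)| <= `|f m| by apply: mM; rewrite in_itv/= n0 ltW.
by rewrite -(per_int f1 (x - n%:~R) n) subrK; lra.
Qed.

Lemma per_pos_min (f : R -> R) : continuous f -> (forall x, f (x + 1) = f x) ->
  (forall x, 0 < f x) -> exists2 m, 0 < m & forall x, m <= f x.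
Proof.
move=> cf f1 f0.
have [m _ mM] := EVT_min (@ler01 R) (continuous_subspaceT cf).
exists (f m) => // x; have [n n0 n1] := mod1 x.
have : f m <= f (x - n%:~R) by apply: mM; rewrite in_itv/= n0 ltW.
by rewrite -(per_int f1 (x - n%:~R) n) subrK.
Qed.

End IVTs.

Section OneLeaf.
Context {R : realType} (t : twist R) (l : leaves t).
Local Notation s := (gS t).
Local Notation s1 := (gS1 t).
Local Notation s2 := (gS2 t).
Local Notation e := (eta l).
Local Notation w := (prim l).
Implicit Types (c x y z : R).

(** The map induced by the twist on the leaf of mean c. *)
Definition dyn (c x : R) := gF t x (e c x).
Local Notation g := dyn.

Lemma s1_per x y : s1 (x + 1) (y + 1) = s1 x y.
Proof.
have [h _ _ _] := gS_d t.
have D1 := h x y.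
have D2 : is_derive x 1 (fun x => s x y) (s1 (x + 1) (y + 1)).
  have -> : (fun x => s x y) = (fun x => s (x + 1) (y + 1)).
    by apply/funext => z; rewrite gS_per.
  apply/is_deriveP; have /is_deriveP := h (x + 1) (y + 1).
  by under eq_fun do rewrite addrAC.
by have := @derive_val _ _ _ _ _ _ _ D1; rewrite (@derive_val _ _ _ _ _ _ _ D2).
Qed.

Lemma s2_per x y : s2 (x + 1) (y + 1) = s2 x y.
Proof.
have [_ h _ _] := gS_d t.
have D1 := h x y.
have D2 : is_derive y 1 (s x) (s2 (x + 1) (y + 1)).
  have -> : s x = (fun y => s (x + 1) (y + 1)).
    by apply/funext => z; rewrite gS_per.
  apply/is_deriveP; have /is_deriveP := h (x + 1) (y + 1).
  by under eq_fun do rewrite addrAC.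
by have := @derive_val _ _ _ _ _ _ _ D1; rewrite (@derive_val _ _ _ _ _ _ _ D2).
Qed.

Lemma s1_decr x y y' : y < y' -> s1 x y' < s1 x y.
Proof.
move=> yy; have [_ h _ _] := gS1_d t.
have [z _ E] := MVT_any y y' (h x).
by rewrite -subr_lt0 E nmulr_rlt0 ?gS12_lt0// subr_gt0.
Qed.

Lemma s2_decr x x' y : x < x' -> s2 x' y < s2 x y.
Proof.
move=> yy; have [h _ _ _] := gS2_d t.
have [z _ E] := MVT_any x x' (h ^~ y).
by rewrite -subr_lt0 E nmulr_rlt0 ?gS12_lt0// subr_gt0.
Qed.

Lemma eta_dyn1 c x : e c x = - s1 x (g c x).
Proof. by have [+ _] := gFP t x (e c x) (g c x); apply. Qed.

Lemma eta_dyn2 c x : e c (g c x) = s2 x (g c x).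
Proof. by rewrite /g eta_inv. Qed.

Lemma dyn_deg1 c x : g c (x + 1) = g c x + 1.
Proof.
rewrite {1}/g; apply/gFP; rewrite s1_per eta_per; exact: eta_dyn1.
Qed.

Lemma dyn_cont c : continuous (g c).
Proof. by move=> x; apply: cont2_cvg; [exact: gF_cont|exact: cvg_id|exact: eta_cont]. Qed.

Lemma dyn_inj c : injective (g c).
Proof.
move=> x y xy.
have := eta_dyn2 c x; rewrite xy eta_dyn2 => E.
have [xy'|yx'|//] := ltgtP x y.
  by have := s2_decr (g c y) xy'; lra.
by have := s2_decr (g c y) yx'; lra.
Qed.

Lemma dyn_incr c : {homo g c : x y / x < y}.
Proof. by apply: deg1_inj_incr; [exact: dyn_cont|exact: dyn_deg1|exact: dyn_inj]. Qed.

Lemma dyn_mono c : {mono g c : x y / x < y}.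
Proof. exact/leW_mono/le_mono/dyn_incr. Qed.

Lemma dyn_onto c y : exists x, g c x = y.
Proof. by apply: deg1_onto; [exact: dyn_cont|exact: dyn_deg1]. Qed.

Lemma prim_deg c x : w c (x + 1) = w c x + c.
Proof.
have D (z : R) : is_derive z 1 (fun x : R => w c (x + 1)) (e c z).
  apply/is_deriveP; have /is_deriveP := prim_d l c (z + 1).
  by rewrite eta_per; under eq_fun do rewrite addrAC.
have := eq_antiderivative D (prim_d l c) x 0.
by rewrite add0r prim1 prim0; lra.
Qed.

(** The cost of the step from x to y, corrected by the primitive of the
    leaf: a telescoping modification of S whose minima in y are the steps of
    the dynamics. *)
Definition actD (c x y : R) := w c x + s x y - w c y.
(** The critical value: minus the cost of a step of the dynamics, the same
    for all starting points by [actD_const]. *)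
Definition alph (c : R) := - actD c 0 (g c 0).
(** How much the step from x to y costs above the steps of the dynamics on
    the leaf of mean c. *)
Definition excess (c x y : R) := actD c x y + alph c.

Lemma actD_d2 c x y : is_derive y 1 (actD c x) (s2 x y - e c y).
Proof.
have [_ h _ _] := gS_d t.
apply: is_deriveB; last exact: prim_d.
have -> : s2 x y = 0 + s2 x y by rewrite add0r.
exact: is_deriveD.
Qed.

Lemma actD_d1 c x y : is_derive x 1 (actD c ^~ y) (e c x + s1 x y).
Proof.
have [h _ _ _] := gS_d t.
have -> : e c x + s1 x y = e c x + s1 x y - 0 by rewrite subr0.
apply: is_deriveB; have D := h x y; have := prim_d l c x => D2; exact: is_deriveD.
Qed.

(** The derivative in y is s2 x y - s2 x' y, where x' is the point of the
    leaf sent to y; as s2 decreases in its first argument this has the sign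
    of x' - x, hence of y - g c x. *)
Lemma actD_min c x y : y != g c x -> actD c x (g c x) < actD c x y.
Proof.
have [gi gK] := choice (dyn_onto c).
have H z : s2 x z - e c z = s2 x z - s2 (gi z) z.
  by rewrite -[in e c z](gK z) eta_dyn2 gK.
rewrite neq_lt => /orP[yg|gy].
  have [z /andP[_ zg] E] := MVT_lt yg (actD_d2 c x).
  have /(s2_decr z) K : gi z < x by rewrite -(dyn_mono c) gK.
  rewrite -subr_lt0 E H; rewrite nmulr_rlt0 ?subr_gt0//; lra.
have [z /andP[gz _] E] := MVT_lt gy (actD_d2 c x).
have /(s2_decr z) K : x < gi z by rewrite -(dyn_mono c) gK.
by rewrite -subr_gt0 E H mulr_gt0 ?subr_gt0.
Qed.

Lemma actD_min_le c x y : actD c x (g c x) <= actD c x y.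
Proof. by have [->//|/actD_min/ltW] := eqVneq y (g c x). Qed.

(** The minimum over y has derivative 0 in x: comparing each minimiser with
    the neighbouring one squeezes the quotient between two partial
    derivatives in x, and both vanish at y = g c x. Only the continuity of g
    c enters. *)
Lemma actD_const c x : actD c x (g c x) = actD c 0 (g c 0).
Proof.
pose ph x := actD c x (g c x).
suff D (z : R) : is_derive z 1 ph 0.
  have := eq_antiderivative D (fun z => is_derive_cst (0 : R) z 1) x 0.
  by rewrite subrr => /eqP; rewrite subr_eq0 => /eqP.
apply/is_deriveP.
have shift0 : (fun h : R => z + h) @ 0^' --> z.
  rewrite -[X in _ --> X]addr0; apply: cvgD; first exact: cvg_cst.
  exact: nbhs_dnbhs.
have gs : (fun h : R => g c (z + h)) @ 0^' --> g c z.
  exact: (cvg_comp _ _ shift0 (dyn_cont (c := c) (x := z))).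
have /choice[u Hu] (h : R) : exists u, Num.min z (z + h) <= u <= Num.max z (z + h) /\
    actD c (z + h) (g c z) - actD c z (g c z) = (s1 u (g c z) - s1 u (g c u)) * h.
  have [u ui E] := MVT_any z (z + h) (fun x => actD_d1 c x (g c z)).
  exists u; split=> //; rewrite E eta_dyn1; ring.
have /choice[v Hv] (h : R) : exists u, Num.min z (z + h) <= u <= Num.max z (z + h) /\
    actD c (z + h) (g c (z + h)) - actD c z (g c (z + h)) =
      (s1 u (g c (z + h)) - s1 u (g c u)) * h.
  have [u0 ui E] := MVT_any z (z + h) (fun x => actD_d1 c x (g c (z + h))).
  exists u0; split=> //; rewrite E eta_dyn1; ring.
have s1c := has_partials_cont (gS1_d t).
have uz : u @ 0^' --> z by apply: (cvg_between (cvg_cst z) shift0) => h; have [] := Hu h.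
have vz : v @ 0^' --> z by apply: (cvg_between (cvg_cst z) shift0) => h; have [] := Hv h.
have gu : (fun h => g c (u h)) @ 0^' --> g c z.
  exact: (cvg_comp _ _ uz (dyn_cont (c := c) (x := z))).
have gv : (fun h => g c (v h)) @ 0^' --> g c z.
  exact: (cvg_comp _ _ vz (dyn_cont (c := c) (x := z))).
have A : (fun h => s1 (u h) (g c z) - s1 (u h) (g c (u h))) @ 0^' --> 0.
  pose proof (limB (cont2_cvg s1c uz (cvg_cst (g c z))) (cont2_cvg s1c uz gu)) as H.
  by rewrite subrr in H.
have B : (fun h => s1 (v h) (g c (z + h)) - s1 (v h) (g c (v h))) @ 0^' --> 0.
  pose proof (limB (cont2_cvg s1c vz gs) (cont2_cvg s1c vz gv)) as H.
  by rewrite subrr in H.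
pose proof (limD (limn A) (limn B)) as AB; rewrite !normr0 addr0 in AB.
apply: (cvg_abs0 _ AB); near=> h.
rewrite subr0 normrM normfV ler_pdivrMr; last by rewrite normr_gt0; near: h; exact: nbhs_dnbhs_neq.
rewrite -/(ph z) in Hu *.
have [_ E1] := Hu h; have [_ E2] := Hv h.
have L1 : ph (z + h) <= actD c (z + h) (g c z) by exact: actD_min_le.
have L2 : ph z <= actD c z (g c (z + h)) by exact: actD_min_le.
rewrite mulrDl -!normrM -E1 -E2 -/(ph z) -/(ph (z + h)).
have := ler_norm (actD c (z + h) (g c z) - ph z).
have := ler_norm (- (ph (z + h) - actD c z (g c (z + h)))); rewrite normrN.
have := normr_ge0 (actD c (z + h) (g c z) - ph z).
have := normr_ge0 (ph (z + h) - actD c z (g c (z + h))).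
by rewrite ler_norml => *; apply/andP; split; lra.
Unshelve. all: by end_near. Qed.

Lemma excess_gt0 c x y : y != g c x -> 0 < excess c x y.
Proof. by move/actD_min; rewrite /excess /alph -(actD_const c x); lra. Qed.

Lemma excess_dyn c x : excess c x (g c x) = 0.
Proof. by rewrite /excess /alph -(actD_const c x) subrr. Qed.

Lemma excess_ge0 c x y : 0 <= excess c x y.
Proof. by have [->|/excess_gt0/ltW//] := eqVneq y (g c x); rewrite excess_dyn. Qed.

Lemma excess_per c x y : excess c (x + 1) (y + 1) = excess c x y.
Proof. by rewrite /excess /actD gS_per !prim_deg; ring. Qed.

Lemma excess_d2 c x y : is_derive y 1 (excess c x) (s2 x y - e c y).
Proof.
by rewrite -[_ - _]addr0; have D := actD_d2 c x y; apply: is_deriveD.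
Qed.

(** The action S cancels: the excesses for two leaves differ by a coboundary
    and a constant. *)
Lemma excess_diff c c' x y : excess c' x y - excess c x y =
  (w c' x - w c x) - (w c' y - w c y) + (alph c' - alph c).
Proof. by rewrite /excess /actD; ring. Qed.

(** Lipschitz in c uniformly in x, continuous in x. *)
Lemma eta_cont2 : cont2 e.
Proof.
move=> [c x] /=.
have [L L0 HL] := eta_lip l (`|c| + 1).
have HL' c1 c2 y : `|c1| <= `|c| + 1 -> `|c2| <= `|c| + 1 ->
    `|e c1 y - e c2 y| <= L * `|c1 - c2|.
  move=> h1 h2.
  wlog c12 : c1 c2 h1 h2 / c1 <= c2.
    move=> H; have [c12|/ltW c21] := leP c1 c2; first exact: H.
    by rewrite distrC (distrC c1); apply: H.
  move: h1 h2 => /ler_normlP[h1 _] /ler_normlP[_ h2].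
  have h1' : - (`|c| + 1) <= c1 by lra.
  have /andP[A B] := HL c1 c2 y h1' c12 h2.
  rewrite distrC (distrC c1) ger0_norm; last first.
    by apply: le_trans A; rewrite divr_ge0 ?subr_ge0// ltW.
  by rewrite ger0_norm ?subr_ge0.
have fc : (fun p : R * R => p.1) @ (c, x) --> c by exact: cvg_fst.
have fx : (fun p : R * R => p.2) @ (c, x) --> x by exact: cvg_snd.
pose proof (limD (limM (cvg_cst L) (limn (limB fc (cvg_cst c))))
  (limn (limB (lim_continuous fx (@eta_cont _ _ l c x)) (cvg_cst (e c x))))) as A.
rewrite /= !subrr normr0 mulr0 addr0 in A.
apply: (cvg_abs0 _ A); near=> p.
have Hp : `|c - p.1| < 1 by near: p; move/cvgrPdist_lt: fc; exact.
apply: le_trans (ler_distD (e c p.2) _ _) _; apply: lerD => //.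
apply: HL'; last lra.
have := ler_normB c (c - p.1); rewrite subKr; lra.
Unshelve. all: by end_near. Qed.

Lemma dyn_cont2 : cont2 g.
Proof. exact: (cont2_comp (gF_cont (t := t)) cont2_snd eta_cont2). Qed.

End OneLeaf.

(** * Rotation numbers, conjugacies and uniqueness of weak K.A.M. solutions *)

Section Arch.
Context {R : realType}.
Implicit Types (a b K x y : R).

(** Divide by n and let n go to infinity. *)
Lemma arch_le a b K : (forall n : nat, n%:R * a <= n%:R * b + K) -> a <= b.
Proof.
move=> H; rewrite leNgt; apply/negP => ba.
have [n hn] := ex_nat_gt (K / (a - b)).
by have := H n; move: hn; rewrite ltr_pdivrMr ?subr_gt0//; lra.
Qed.

Lemma deg1_dist (h : R -> R) : h 0 = 0 -> (forall x, h (x + 1) = h x + 1) ->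
  {homo h : x y / x <= y} -> forall x, `|h x - x| <= 1.
Proof.
move=> h0 h1 hm x; have [n n0 n1] := mod1 x.
have := deg1_int h1 (x - n%:~R) n; rewrite subrK => ->.
have A : 0 <= h (x - n%:~R) by rewrite -h0 hm.
have B : h (x - n%:~R) <= 1.
  by rewrite -[leRHS]add0r -h0 -h1 add0r hm// ltW.
by rewrite ler_norml; lra.
Qed.

Lemma iter_deg1 (f : R -> R) n : (forall x, f (x + 1) = f x + 1) ->
  forall x, iter n f (x + 1) = iter n f x + 1.
Proof. by move=> f1; elim: n => //= n IH x; rewrite IH f1. Qed.

Lemma iter_cont (f : R -> R) n : continuous f -> continuous (iter n f).
Proof.
move=> cf; elim: n => [|n IH] x; first exact: cvg_id.
exact: (continuous_comp (IH x) (cf _)).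
Qed.

End Arch.

Section Family.
Context {R : realType} (t : twist R) (l : leaves t).
Local Notation s := (gS t).
Local Notation s1 := (gS1 t).
Local Notation s2 := (gS2 t).
Local Notation e := (eta l).
Local Notation w := (prim l).
Local Notation g := (dyn l).
Local Notation al := (alph l).
Implicit Types (c x y z M : R).

Definition lipC M : R := s2val (cid2 (eta_lip l M)).

Lemma lipC_gt0 M : 0 < lipC M.
Proof. exact: (s2valP (cid2 (eta_lip l M))). Qed.

Lemma eta_lipP M c c' x : - M <= c -> c <= c' -> c' <= M ->
  (c' - c) / lipC M <= e c' x - e c x <= lipC M * (c' - c).
Proof. exact: (s2valP' (cid2 (eta_lip l M))). Qed.

Lemma eta_incr c c' x : c < c' -> e c x < e c' x.
Proof.
move=> cc; set M := Num.max `|c| `|c'|.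
have h1 : - M <= c by rewrite lerNl (le_trans (ler_norm _))// normrN le_max lexx.
have h2 : c' <= M by rewrite (le_trans (ler_norm _))// le_max lexx orbT.
have /andP[A _] := eta_lipP x h1 (ltW cc) h2.
by rewrite -subr_gt0; apply: lt_le_trans A; rewrite divr_gt0 ?subr_gt0// lipC_gt0.
Qed.

Lemma dyn_c_incr c c' x : c < c' -> g c x < g c' x.
Proof.
move=> /(eta_incr x); rewrite (eta_dyn1 l c x) (eta_dyn1 l c' x) ltrN2 => H.
rewrite ltNge; apply/negP; rewrite le_eqVlt => /orP[/eqP E|]; first by rewrite E ltxx in H.
by move=> /(s1_decr t x); lra.
Qed.

Lemma dyn_c_le c c' x : c <= c' -> g c x <= g c' x.
Proof. by rewrite le_eqVlt => /orP[/eqP->//|/(dyn_c_incr x)/ltW]. Qed.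

Lemma dyn_c_onto x y : exists c, g c x = y.
Proof. by have [c E] := eta_onto l x (- s1 x y); exists c; apply/gFP. Qed.

Lemma dyn_le c x y : x <= y -> g c x <= g c y.
Proof. by move=> xy; rewrite (le_mono (@dyn_incr _ _ l c)). Qed.

(** Difference quotient in c of the primitives of the leaves; its limits as
    c' tends to c are the candidates for the derivative of prim in c. *)
Definition dq c c' x := (w c' x - w c x) / (c' - c).
Definition sl c c' := (al c' - al c) / (c' - c).

Lemma dq0 c c' : dq c c' 0 = 0.
Proof. by rewrite /dq !prim0 subrr mul0r. Qed.

Lemma dq_sym c c' x : dq c c' x = dq c' c x.
Proof. by rewrite /dq -[X in _ / X]opprB invrN mulrN -mulNr opprB. Qed.

Lemma dq_deg1 c c' x : c != c' -> dq c c' (x + 1) = dq c c' x + 1.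
Proof.
by move=> cc; rewrite /dq !prim_deg; field; rewrite subr_eq0 eq_sym.
Qed.

Lemma dq_d c c' x : is_derive x 1 (dq c c') ((e c' x - e c x) / (c' - c)).
Proof.
rewrite [_ / _]mulrC.
have D1 := prim_d l c x; have D2 := prim_d l c' x.
have -> : dq c c' = (c' - c)^-1 \*: (fun x => w c' x - w c x).
  by apply/funext => z; rewrite /dq mulrC.
by apply: is_deriveZ; exact: is_deriveB.
Qed.

Definition biLip L (h : R -> R) := forall x y, x <= y -> (y - x) / L <= h y - h x <= L * (y - x).

Lemma biLip_lip L h x y : 0 < L -> biLip L h -> `|h x - h y| <= L * `|x - y|.
Proof.
move=> L0 H; wlog xy : x y / x <= y.
  move=> W; have [/W//|/ltW/W] := leP x y.
  by rewrite distrC (distrC y).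
have /andP[A B] := H x y xy.
rewrite distrC (distrC x) !ger0_norm ?subr_ge0//.
by rewrite -subr_ge0; apply: le_trans A; rewrite divr_ge0 ?subr_ge0// ltW.
Qed.

Lemma biLip_le L h : 0 < L -> biLip L h -> {homo h : x y / x <= y}.
Proof.
move=> L0 H x y xy; have /andP[A _] := H x y xy.
by rewrite -subr_ge0; apply: le_trans A; rewrite divr_ge0 ?subr_ge0// ltW.
Qed.

Lemma biLip_lt L h : 0 < L -> biLip L h -> {homo h : x y / x < y}.
Proof.
move=> L0 H x y xy; have /andP[A _] := H x y (ltW xy).
by rewrite -subr_gt0; apply: lt_le_trans A; rewrite divr_gt0 ?subr_gt0.
Qed.

Lemma biLip_cont L h : 0 < L -> biLip L h -> continuous h.
Proof.
move=> L0 H x; apply: (@cvg_abs0 _ _ _ _ _ (fun y => L * `|y - x|)).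
  by near=> y; exact: biLip_lip.
have ix : (fun y : R => y) @ x --> x by exact: cvg_id.
pose proof (limM (cvg_cst L) (limn (limB ix (cvg_cst x)))) as A.
by rewrite subrr normr0 mulr0 in A.
Unshelve. all: by end_near. Qed.

Lemma dq_biLip M c c' : - M <= c -> c < c' -> c' <= M -> biLip (lipC M) (dq c c').
Proof.
move=> Mc cc cM x y xy.
have [z _ ->] := MVT_any x y (dq_d c c').
have /andP[A B] := eta_lipP z Mc (ltW cc) cM.
have c0 : 0 < c' - c by rewrite subr_gt0.
apply/andP; split.
  rewrite [leLHS]mulrC ler_wpM2r ?subr_ge0// ler_pdivlMr//.
  by rewrite mulrC.
by rewrite ler_wpM2r ?subr_ge0// ler_pdivrMr.
Qed.

Lemma dq_le c c' : c < c' -> {homo dq c c' : x y / x <= y}.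
Proof.
move=> cc; apply: (@derive_ge0_nondecr _ _ _ (dq_d c c')) => z.
by rewrite divr_ge0// subr_ge0 ltW// eta_incr.
Qed.

(** Apply [excess_diff] to a step of the dynamics of c', whose own excess
    for c' is 0. *)
Lemma dq_excess c c' x : c < c' ->
  dq c c' (g c' x) = dq c c' x + sl c c' + excess l c x (g c' x) / (c' - c).
Proof.
move=> cc; have c0 : c' - c != 0 by rewrite subr_eq0 gt_eqF.
have := excess_diff l c c' x (g c' x); rewrite excess_dyn => E.
rewrite /dq /sl -!mulrDl; congr (_ / _); lra.
Qed.

Lemma dq_lower c c' x : c < c' -> dq c c' x + sl c c' <= dq c c' (g c' x).
Proof.
by move=> cc; rewrite dq_excess// lerDl divr_ge0 ?excess_ge0// subr_ge0 ltW.
Qed.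

Lemma dq_upper c c' x : c < c' -> dq c c' (g c x) <= dq c c' x + sl c c'.
Proof.
move=> cc; have c0 : 0 < c' - c by rewrite subr_gt0.
have := excess_diff l c c' x (g c x); rewrite excess_dyn subr0 => E.
have := excess_ge0 l c' x (g c x).
by rewrite /dq /sl -mulrDl ler_pM2r ?invr_gt0//; lra.
Qed.

(** A bi-Lipschitz conjugacy from the dynamics on a leaf to the translation
    by r, normalised at 0. *)
Definition is_conj c L r (h : R -> R) :=
  [/\ h 0 = 0, forall x, h (x + 1) = h x + 1, biLip L h & forall x, h (g c x) = h x + r].

Lemma conj_iter c L r h n x : is_conj c L r h -> h (iter n (g c) x) = h x + n%:R * r.
Proof.
move=> [_ _ _ H]; elim: n => [|n IH]; first by rewrite mul0r addr0.
by rewrite iterS H IH -natr1; ring.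
Qed.

Lemma conj_dist c L r h x : 0 < L -> is_conj c L r h -> `|h x - x| <= 1.
Proof. by move=> L0 [h0 h1 hb _]; apply: deg1_dist => //; exact: biLip_le hb. Qed.

(** Both r and r' are the limit of g^n(0) / n, since a conjugacy stays
    within 1 of the identity. *)
Lemma conj_rot_unique c L r h L' r' h' : 0 < L -> 0 < L' ->
  is_conj c L r h -> is_conj c L' r' h' -> r = r'.
Proof.
move=> L0 L0' H H'.
have K n : `|n%:R * r - n%:R * r'| <= 2.
  have A := conj_dist (iter n (g c) 0) L0 H.
  have B := conj_dist (iter n (g c) 0) L0' H'.
  rewrite (conj_iter _ _ H) (conj_iter _ _ H') in A B.
  case: H A B => -> _ _ _ A B; case: H' A B => -> _ _ _.
  by rewrite !add0r !ler_norml => *; lra.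
apply/eqP; rewrite eq_le; apply/andP; split; apply: (@arch_le _ _ _ 2) => n.
  by have := K n; rewrite ler_norml; lra.
by have := K n; rewrite ler_norml; lra.
Qed.

Lemma lip_lim (T : Type) (F : set_system T) {FF : Filter F} (f : T -> R -> R) L
    (x : T -> R) (a b : R) :
  (\forall t \near F, forall x y, `|f t x - f t y| <= L * `|x - y|) ->
  (fun t => f t a) @ F --> b -> x @ F --> a -> (fun t => f t (x t)) @ F --> b.
Proof.
move=> fL fa xa.
pose proof (limD (limM (cvg_cst L) (limn (limB xa (cvg_cst a))))
   (limn (limB fa (cvg_cst b)))) as A.
rewrite !subrr normr0 mulr0 addr0 in A.
apply: (cvg_abs0 _ A); near=> t0.
apply: le_trans (ler_distD (f t0 a) _ _) _; apply: lerD => //.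
by near: t0; apply: filterS fL => t0; exact.
Unshelve. all: by end_near. Qed.

(** A uniformly bi-Lipschitz family f t that semi-conjugates from above and
    from below along maps converging to g c has only conjugacies as limits:
    the two inequalities become one equality. *)
Lemma conj_lim (T : Type) (U : set_system T) (f : T -> R -> R) (r : T -> R)
    (a b : T -> R -> R) c L :
  UltraFilter U -> 0 < L ->
  (\forall t \near U, f t 0 = 0) ->
  (\forall t \near U, forall x, f t (x + 1) = f t x + 1) ->
  (\forall t \near U, biLip L (f t)) ->
  (forall x, (fun t => a t x) @ U --> g c x) ->
  (forall x, (fun t => b t x) @ U --> g c x) ->
  (\forall t \near U, forall x, f t (a t x) <= f t x + r t <= f t (b t x)) ->
  exists h rr, [/\ is_conj c L rr h, forall x, (fun t => f t x) @ U --> h x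
    & r @ U --> rr].
Proof.
move=> UU L0 f0 f1 fL ac bc fab.
have lip : \forall t \near U, forall x y, `|f t x - f t y| <= L * `|x - y|.
  by apply: filterS fL => t0 H x y; exact: biLip_lip.
have /choice[h hl] x : exists h : R, (fun t => f t x) @ U --> h.
  apply: (@bounded_ultra_cvg _ _ _ _ (L * `|x|)) => //; near=> t0.
  have E : f t0 0 = 0 by near: t0.
  have : forall x y, `|f t0 x - f t0 y| <= L * `|x - y| by near: t0.
  by move=> /(_ x 0); rewrite E !subr0.
have h0 : h 0 = 0.
  apply: (cvg_uniq (hl 0)); apply: (cvg_eq_near _ (cvg_cst 0)); near=> t0.
  by apply/esym; near: t0.
have ha x : (fun t => f t (a t x)) @ U --> h (g c x) by apply: (lip_lim lip).
have hb x : (fun t => f t (b t x)) @ U --> h (g c x) by apply: (lip_lim lip).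
have [rr rl] : exists rr : R, r @ U --> rr.
  apply: (@bounded_ultra_cvg _ _ _ _ (`|h (g c 0)| + 1)) => //; near=> t0.
  have E : f t0 0 = 0 by near: t0.
  have A : `|h (g c 0) - f t0 (a t0 0)| < 1.
    by near: t0; move/cvgrPdist_lt: (ha 0); apply.
  have B : `|h (g c 0) - f t0 (b t0 0)| < 1.
    by near: t0; move/cvgrPdist_lt: (hb 0); apply.
  have : forall x, f t0 (a t0 x) <= f t0 x + r t0 <= f t0 (b t0 x) by near: t0.
  move=> /(_ 0); rewrite E add0r => /andP[C D].
  have N1 := ler_norm (h (g c 0)); have N2 := ler_norm (- h (g c 0)); rewrite normrN in N2.
  by move: A B; rewrite !ltr_norml ler_norml => *; lra.
exists h, rr; split=> //; split=> //.
- move=> x; apply: (cvg_uniq (hl (x + 1))).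
  pose proof (limD (hl x) (cvg_cst (1 : R))) as D.
  apply: (cvg_eq_near _ D); near=> t0.
  by near: t0; apply: filterS f1 => t0 ->.
- move=> x y xy; pose proof (limB (hl y) (hl x)) as D; apply/andP; split.
    apply: (cvg_ge_cst D); near=> t0.
    by have : biLip L (f t0); [near: t0|move=> /(_ x y xy)/andP[]].
  apply: (cvg_le_cst D); near=> t0.
  by have : biLip L (f t0); [near: t0|move=> /(_ x y xy)/andP[]].
- move=> x; pose proof (limD (hl x) rl) as D.
  apply/eqP; rewrite eq_le; apply/andP; split.
    apply: (cvg_le (ha x) D); near=> t0.
    have : forall x, f t0 (a t0 x) <= f t0 x + r t0 <= f t0 (b t0 x) by near: t0.
    by move=> /(_ x)/andP[].
  apply: (cvg_le D (hb x)); near=> t0.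
  have : forall x, f t0 (a t0 x) <= f t0 x + r t0 <= f t0 (b t0 x) by near: t0.
  by move=> /(_ x)/andP[].
Unshelve. all: by end_near. Qed.

Lemma near_bound (T : Type) (F : set_system T) {FF : Filter F} (c : T -> R) (a M : R) :
  c @ F --> a -> `|a| < M -> \forall t \near F, - M <= c t /\ c t <= M.
Proof.
move=> /cvgrPdist_lt ca aM; near=> t0.
have : `|a - c t0| < M - `|a| by near: t0; apply: ca; rewrite subr_gt0.
have := ler_norm a; have := ler_norm (- a); rewrite normrN.
by rewrite ltr_norml => *; lra.
Unshelve. all: by end_near. Qed.

Lemma dyn_lim (T : Type) (F : set_system T) {FF : Filter F} (c x : T -> R) (a b : R) :
  c @ F --> a -> x @ F --> b -> (fun t => g (c t) (x t)) @ F --> g a b.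
Proof. by move=> ca xb; apply: cont2_cvg => //; exact: dyn_cont2. Qed.

(** Both [dq_lower] and [dq_upper] hold for the quotient of two nearby
    leaves. *)
Lemma dq_lim (T : Type) (U : set_system T) (c1 c2 : T -> R) c M :
  UltraFilter U -> `|c| < M -> c1 @ U --> c -> c2 @ U --> c ->
  (\forall t \near U, c1 t < c2 t) ->
  exists h r, [/\ is_conj c (lipC M) r h, forall x, (fun t => dq (c1 t) (c2 t) x) @ U --> h x
    & (fun t => sl (c1 t) (c2 t)) @ U --> r].
Proof.
move=> UU cM c1c c2c c12.
apply: (@conj_lim _ U (fun t => dq (c1 t) (c2 t)) _ (fun t => g (c1 t)) (fun t => g (c2 t))).
- exact: lipC_gt0.
- by near=> t0; exact: dq0.
- near=> t0 => x; rewrite dq_deg1//.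
  by have : c1 t0 < c2 t0; [near: t0|move=> /lt_eqF->].
- pose proof (near_bound c1c cM) as H1; pose proof (near_bound c2c cM) as H2.
  near=> t0; apply: dq_biLip; last first.
  + by have : - M <= c2 t0 /\ c2 t0 <= M; [near: t0|case].
  + by near: t0.
  + by have : - M <= c1 t0 /\ c1 t0 <= M; [near: t0|case].
- by move=> x; apply: dyn_lim => //; exact: cvg_cst.
- by move=> x; apply: dyn_lim => //; exact: cvg_cst.
- near=> t0 => x.
  have cc : c1 t0 < c2 t0 by near: t0.
  by rewrite dq_lower// dq_upper.
Unshelve. all: by end_near. Qed.

(** Take a limit of the difference quotients at c; this is where the
    foliation, and not just one leaf, is used. *)
Lemma conj_ex c : exists r, forall M, `|c| < M -> exists h, is_conj c (lipC M) r h.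
Proof.
have [U [UU U0]] := ultraFilterLemma (@at_right_proper_filter R 0).
have E M : `|c| < M -> exists h r, is_conj c (lipC M) r h.
  move=> cM.
  have xU : (fun x : R => x) @ U --> 0.
    by move=> A A0; apply: U0; apply: filterS A0 => x Ax _.
  have [||h [r [H _ _]]] := @dq_lim _ U (fun=> c) (fun x => c + x) c M UU cM (cvg_cst c).
  - by pose proof (limD (cvg_cst c) xU) as H; rewrite addr0 in H.
  - apply: U0; near=> x; rewrite ltrDl; near: x; exact: nbhs_right_gt.
  - by exists h, r.
have c1 : `|c| < `|c| + 1 by rewrite ltrDl.
have [h [r H]] := E _ c1.
exists r => M cM; have [h' [r' H']] := E _ cM; exists h'.
by rewrite (conj_rot_unique (lipC_gt0 _) (lipC_gt0 _) H H').
Unshelve. all: by end_near. Qed.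

(** The translation number of the dynamics on the leaf. *)
Definition rot c : R := projT1 (cid (conj_ex c)).

Lemma rot_conj c M : `|c| < M -> exists h, is_conj c (lipC M) (rot c) h.
Proof. exact: (projT2 (cid (conj_ex c))). Qed.

Lemma conj_rot c L r h : 0 < L -> is_conj c L r h -> r = rot c.
Proof.
move=> L0 H; have c1 : `|c| < `|c| + 1 by rewrite ltrDl.
have [h' H'] := rot_conj c1.
exact: (conj_rot_unique L0 (lipC_gt0 _) H H').
Qed.

Lemma iter_rot c n x : `|iter n (g c) x - x - n%:R * rot c| <= 2.
Proof.
have c1 : `|c| < `|c| + 1 by rewrite ltrDl.
have [h H] := rot_conj c1.
have A := conj_dist (iter n (g c) x) (lipC_gt0 _) H.
have B := conj_dist x (lipC_gt0 _) H.
rewrite (conj_iter _ _ H) in A.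
by move: A B; rewrite !ler_norml => *; lra.
Qed.

Lemma dq_dist c c' x : c < c' -> `|dq c c' x - x| <= 1.
Proof.
move=> cc; apply: deg1_dist; [exact: dq0| |exact: dq_le].
by move=> y; rewrite dq_deg1// lt_eqF.
Qed.

Lemma rot_le_sl c c' : c < c' -> rot c <= sl c c'.
Proof.
move=> cc; apply: (@arch_le _ _ _ 3) => n.
have A : dq c c' (iter n (g c) 0) <= n%:R * sl c c'.
  elim: n => [|n IH]; first by rewrite dq0 mul0r.
  by rewrite iterS; apply: le_trans (dq_upper _ cc) _; rewrite -natr1; lra.
have := dq_dist (iter n (g c) 0) cc; have := iter_rot c n 0.
by rewrite !ler_norml; lra.
Qed.

(** The excess for c of a step of the dynamics of c' is bounded below by a
    positive constant by compactness, and it accumulates at each step. *)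
Lemma rot_gt_sl c c' : c < c' -> sl c c' < rot c'.
Proof.
move=> cc; have c0 : 0 < c' - c by rewrite subr_gt0.
have [| | |m m0 Hm] := @per_pos_min R (fun x => excess l c x (g c' x)).
- move=> x; rewrite /excess /actD.
  have cw : {for x, continuous (w c)} by exact: is_derive_cont (prim_d l c x).
  have cg : {for x, continuous (g c')} by exact: dyn_cont.
  have A : (fun x => s x (g c' x)) @ x --> s x (g c' x).
    by apply: cont2_cvg => //; exact: has_partials_cont (gS_d t).
  have B : (fun x => w c (g c' x)) @ x --> w c (g c' x).
    by apply: (lim_continuous cg); exact: is_derive_cont (prim_d l c _).
  exact: (limD (limB (limD cw A) B) (cvg_cst (alph l c))).
- by move=> x; rewrite dyn_deg1 excess_per.
- by move=> x; apply: excess_gt0; rewrite gt_eqF// dyn_c_incr.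
apply: (@lt_le_trans _ _ (sl c c' + m / (c' - c))); first by rewrite ltrDl divr_gt0.
apply: (@arch_le _ _ _ 3) => n.
have A : n%:R * (sl c c' + m / (c' - c)) <= dq c c' (iter n (g c') 0).
  elim: n => [|n IH]; first by rewrite dq0 mul0r.
  rewrite iterS dq_excess//.
  have : m / (c' - c) <= excess l c (iter n (g c') 0) (g c' (iter n (g c') 0)) / (c' - c).
    by rewrite ler_pM2r ?invr_gt0.
  by rewrite -natr1; lra.
have := dq_dist (iter n (g c') 0) cc; have := iter_rot c' n 0.
by rewrite !ler_norml; lra.
Qed.

(** The slope of alph between c and c' separates the two rotation numbers. *)
Lemma rot_incr : {homo rot : x y / x < y}.
Proof. by move=> c c' cc; apply: le_lt_trans (rot_le_sl cc) (rot_gt_sl cc). Qed.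

Lemma conj_dyn_lim (T : Type) (U : set_system T) (c : T -> R) (h : T -> R -> R) a M :
  UltraFilter U -> `|a| < M -> c @ U --> a ->
  (\forall t \near U, is_conj (c t) (lipC M) (rot (c t)) (h t)) ->
  exists k, [/\ is_conj a (lipC M) (rot a) k, forall x, (fun t => h t x) @ U --> k x
    & (fun t => rot (c t)) @ U --> rot a].
Proof.
move=> UU aM ca H.
have [||||||h' [r [H' A B]]] := @conj_lim _ U h (fun t => rot (c t)) (fun t => g (c t))
  (fun t => g (c t)) a _ UU (lipC_gt0 M).
- by apply: filterS H => t0 [].
- by apply: filterS H => t0 [].
- by apply: filterS H => t0 [].
- by move=> x; apply: dyn_lim => //; exact: cvg_cst.
- by move=> x; apply: dyn_lim => //; exact: cvg_cst.
- by apply: filterS H => t0 [_ _ _ E] x; rewrite E lexx.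
by exists h'; rewrite -(conj_rot (lipC_gt0 M) H').
Qed.

Lemma rot_cont : continuous rot.
Proof.
move=> a; apply: cvg_ultraP => U UU aU.
have c1 : `|a| < `|a| + 1 by rewrite ltrDl.
have ia : (fun c => c) @ U --> a by exact: aU.
pose h c := if pselect (`|c| < `|a| + 1) is left H then projT1 (cid (rot_conj H)) else id.
have [|_ [_ _]//] := @conj_dyn_lim _ U (fun c => c) h a _ UU c1 ia.
move/cvgrPdist_lt: (ia) => ia'.
near=> c; rewrite /h; case: pselect => [H|[]]; first exact: (projT2 (cid (rot_conj H))).
have : `|a - c| < 1 by near: c; exact: ia'.
by have := ler_norm a => *; have := ler_normB a (a - c); rewrite subKr; lra.
Unshelve. all: by end_near. Qed.

Lemma rot_onto y : exists c, rot c = y.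
Proof.
have [c1 E1] := dyn_c_onto 0 (y - 3); have [c2 E2] := dyn_c_onto 0 (y + 3).
have := iter_rot c1 1 0; have := iter_rot c2 1 0; rewrite /= E1 E2 !mul1r !ler_norml => A B.
have r12 : rot c1 < rot c2 by lra.
have c12 : c1 <= c2 by rewrite leNgt; apply/negP => /rot_incr; lra.
have [|c _ <-] := @cont_IVT R rot c1 c2 y rot_cont c12; first by apply/andP; split; lra.
by exists c.
Qed.

(** The excess along an orbit of c' telescopes to (c' - c) times a
    displacement minus n times the slope of alph, which is bounded
    independently of n. *)
Lemma weak_KAM_chain c c' (X : R -> R) n x : c < c' ->
  (forall x y, X y <= X x + excess l c x y) ->
  X (iter n (g c') x) <= X x + (c' - c) * (iter n (g c') x - iter n (g c) x + 4).
Proof.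
move=> cc H; have c0 : 0 < c' - c by rewrite subr_gt0.
set z := iter n _ _.
have A : X z <= X x + (c' - c) * (dq c c' z - dq c c' x - n%:R * sl c c').
  rewrite /z; elim: n {z} => [|n IH]; first by rewrite subrr mul0r subr0 mulr0 addr0.
  rewrite iterS; set y := iter n _ _ in IH *.
  apply: le_trans (H y _) _.
  have -> : excess l c y (g c' y) = (c' - c) * (dq c c' (g c' y) - dq c c' y - sl c c').
    by rewrite dq_excess//; field; rewrite gt_eqF.
  by rewrite -natr1; lra.
apply: le_trans A _; rewrite lerD2l ler_pM2l//.
have := dq_dist z cc; have := dq_dist x cc.
have := iter_rot c n x; have : n%:R * rot c <= n%:R * sl c c'.
  by rewrite ler_wpM2l// rot_le_sl.
rewrite !ler_norml; lra.
Qed.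

Lemma iter_dyn_cont n x : continuous (fun c => iter n (g c) x).
Proof.
elim: n => [|n IH] c; first exact: cvg_cst.
have ic : (fun c : R => c) @ c --> c by exact: cvg_id.
exact: dyn_lim ic (IH c).
Qed.

Lemma iter_dyn_le c c' n x : c <= c' -> iter n (g c) x <= iter n (g c') x.
Proof.
move=> cc; elim: n => //= n IH.
by apply: le_trans (dyn_c_le _ cc); exact: dyn_le.
Qed.

Lemma iter_dyn_hit c n x z : iter n.+1 (g c) x < z ->
  exists2 c', c < c' & iter n.+1 (g c') x = z.
Proof.
move=> zc; pose p := iter n (g c) x.
have [C EC] := dyn_c_onto p z.
have cC : c < C.
  rewrite ltNge; apply/negP => /(dyn_c_le p); rewrite EC => H.
  by move: zc; rewrite iterS -/p; lra.
have H : iter n.+1 (g c) x <= z <= iter n.+1 (g C) x.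
  apply/andP; split; first exact: ltW.
  by rewrite -[leLHS]EC; apply: dyn_le; apply: iter_dyn_le; exact: ltW.
have [c' /andP[cc' _] E] := cont_IVT (@iter_dyn_cont n.+1 x) (ltW cC) H.
exists c' => //; rewrite lt_neqAle cc' andbT; apply/eqP => cE.
by move: zc; rewrite -E cE ltxx.
Qed.

(** With X the difference between u and the solution carried by the leaf,
    testing on minima and along orbits first shows that a is the critical
    value. Then a chain for some c' slightly above c joins x to y modulo 1,
    and [weak_KAM_chain] gives X y <= X x + eps. *)
Lemma weak_KAM_unique c a (u : R -> R) : continuous u -> (forall x, u (x + 1) = u x) ->
  u 0 = 0 -> (forall x y, u y <= u x + s x y + c * (x - y) + a) ->
  (forall y eps, 0 < eps -> exists x, u x + s x y + c * (x - y) + a < u y + eps) ->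
  forall x, u x = w c x - c * x.
Proof.
move=> cu u1 u0 sub sup.
pose X x := u x + c * x - w c x.
suff HX x y : X y <= X x.
  move=> x; have : X x = X 0 by apply/eqP; rewrite eq_le !HX.
  by rewrite /X u0 prim0; lra.
have X1 z : X (z + 1) = X z by rewrite /X u1 prim_deg; ring.
have cX : continuous X.
  move=> z; have cw : {for z, continuous (w c)} by exact: is_derive_cont (prim_d l c z).
  have iz : (fun y : R => y) @ z --> z by exact: cvg_id.
  exact: (limB (limD (cu z) (limM (cvg_cst c) iz)) cw).
pose b := a - al c.
have sub' z y' : X y' <= X z + excess l c z y' + b.
  have := sub z y'; rewrite /X /excess /actD /b; lra.
have b_le0 : b <= 0.
  have [m _ mM] := EVT_min (@ler01 R) (continuous_subspaceT cX).
  apply/ler_addgt0Pl => eps e0; rewrite addr0.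
  have [z Hz] := sup m eps e0.
  have Xm : X m <= X z.
    have [n n0 n1] := mod1 z; have := per_int X1 (z - n%:~R) n; rewrite subrK => ->.
    by apply: mM; rewrite in_itv/= n0 ltW.
  have := excess_ge0 l c z m; move: Xm.
  by rewrite /X /excess /actD /b; lra.
have b_ge0 : 0 <= b.
  have [M M0 HM] := per_bounded cX X1.
  apply: (@arch_le _ _ _ (2 * M)) => n; rewrite mulr0.
  have A : X (iter n (g c) 0) <= X 0 + n%:R * b.
    elim: n => [|n IH]; first by rewrite mul0r addr0.
    have := sub' (iter n (g c) 0) (g c (iter n (g c) 0)); rewrite excess_dyn -iterS.
    by rewrite -natr1; lra.
  have := HM (iter n (g c) 0); have := HM 0.
  by rewrite !ler_norml; lra.
have b0 : b = 0 by apply/eqP; rewrite eq_le b_le0.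
have sub0 z y' : X y' <= X z + excess l c z y' by have := sub' z y'; rewrite b0 addr0.
apply/ler_addgt0Pl => eps e0.
(* In the chain estimate z - iter n.+1 (g c) x + 4 is at most 5. *)
pose d := eps / 5.
have d0 : 0 < d by rewrite divr_gt0.
have rc : rot c < rot (c + d) by apply: rot_incr; rewrite ltrDl.
have [n Hn] := ex_nat_gt (5 / (rot (c + d) - rot c)).
have [k k0 k1] := mod1 (iter n.+1 (g c) x - y).
pose z := y + (k + 1)%:~R.
have zk : z = y + k%:~R + 1 by rewrite /z intrD addrA.
have gz : iter n.+1 (g c) x < z by rewrite zk; lra.
have [c' cc' Ez] := iter_dyn_hit gz.
have c'd : c' < c + d.
  rewrite ltNge; apply/negP => cd.
  have rr : rot (c + d) <= rot c'.
    by move: cd; rewrite le_eqVlt => /orP[/eqP->//|/rot_incr/ltW].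
  have A := iter_rot c' n.+1 x; have B := iter_rot c n.+1 x; rewrite Ez in A.
  move: Hn; rewrite ltr_pdivrMr ?subr_gt0// => Hn.
  have : n%:R * (rot (c + d) - rot c) <= n.+1%:R * (rot c' - rot c).
    by apply: ler_pM => //; rewrite ?ler_nat//; lra.
  move: A B; rewrite !ler_norml zk; lra.
have := weak_KAM_chain n.+1 x cc' sub0; rewrite Ez.
have -> : X z = X y by exact: per_int.
move=> H; apply: le_trans H _; rewrite addrC lerD2r.
have : (c' - c) * (z - iter n.+1 (g c) x + 4) <= d * 5.
  by apply: ler_pM; rewrite ?zk; lra.
by rewrite /d; lra.
Qed.

End Family.

(** * Differentiability of the dynamics on a leaf *)

Section Jacobi.
Context {R : realType}.

Lemma cvg_uniq_near (T : Type) (F : set_system T) {FF : ProperFilter F} (f g : T -> R) (a b : R) :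
  f @ F --> a -> g @ F --> b -> (\forall t \near F, f t = g t) -> a = b.
Proof. by move=> fa gb fg; exact: (cvg_uniq (cvg_eq_near fg fa) gb). Qed.

(** The Wronskian of the two solutions is constant. Were it positive, the
    ratio k / k' would increase by a fixed amount at each step, against
    boundedness. *)
Lemma jacobi_unique (A B k k' : nat -> R) (m K Bm : R) :
  0 < m -> (forall j, 0 < B j <= Bm) ->
  (forall j, m <= k j <= K) -> (forall j, m <= k' j <= K) ->
  (forall j, B j * k j + B j.+1 * k j.+2 = A j * k j.+1) ->
  (forall j, B j * k' j + B j.+1 * k' j.+2 = A j * k' j.+1) ->
  k 0%N = 1 -> k' 0%N = 1 -> k 1%N <= k' 1%N.
Proof.
move=> m0 HB Hk Hk' Ek Ek' k0 k'0; rewrite leNgt; apply/negP => kk.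
pose W j := B j * (k j.+1 * k' j - k' j.+1 * k j).
have WE j : W j = W 0%N.
  elim: j => // j <-; rewrite /W.
  have -> : B j.+1 * (k j.+2 * k' j.+1 - k' j.+2 * k j.+1) =
    (B j * k j + B j.+1 * k j.+2) * k' j.+1 - (B j * k' j + B j.+1 * k' j.+2) * k j.+1
     + B j * (k j.+1 * k' j - k' j.+1 * k j) by ring.
  by rewrite Ek Ek'; ring.
have W0 : 0 < W 0%N.
  by rewrite /W k0 k'0 !mulr1 mulr_gt0 ?subr_gt0//; case/andP: (HB 0%N).
have k'_gt0 j : 0 < k' j by apply: lt_le_trans m0 _; case/andP: (Hk' j).
have K0 : 0 < K by have := k'_gt0 0%N; case/andP: (Hk' 0%N); lra.
have Bm0 : 0 < Bm by case/andP: (HB 0%N); lra.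
pose d := W 0%N / (Bm * (K * K)).
have d0 : 0 < d by rewrite divr_gt0// !mulr_gt0.
have step j : k j / k' j + d <= k j.+1 / k' j.+1.
  rewrite -lerBrDl.
  have -> : k j.+1 / k' j.+1 - k j / k' j = W j / (B j * (k' j * k' j.+1)).
    rewrite /W; field; rewrite !gt_eqF//.
    by case/andP: (HB j).
  have /andP[B0 BB] := HB j; have /andP[_ q1] := Hk' j; have /andP[_ q2] := Hk' j.+1.
  rewrite WE /d ler_pM2l// lef_pV2 ?posrE ?mulr_gt0//.
  have kk2 : k' j * k' j.+1 <= K * K by apply: ler_pM => //; exact: ltW.
  by apply: ler_pM => //; [exact: ltW|rewrite mulr_ge0// ltW].
have : d <= 0.
  apply: (@arch_le _ _ _ (K / m)) => n; rewrite mulr0 add0r.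
  have H : n%:R * d <= k n / k' n.
    elim: n => [|n IH]; first by rewrite mul0r k0 k'0 divr1.
    by apply: le_trans (step n); rewrite -natr1; lra.
  apply: le_trans H _; have /andP[_ q1] := Hk n; have /andP[q2 _] := Hk' n.
  apply: ler_pM => //.
  - by apply: le_trans (ltW m0) _; case/andP: (Hk n).
  - by rewrite invr_ge0 ltW.
  - by rewrite lef_pV2 ?posrE.
lra.
Qed.

End Jacobi.

Section Slope.
Context {R : realType} (t : twist R) (l : leaves t).
Local Notation s := (gS t).
Local Notation s1 := (gS1 t).
Local Notation s2 := (gS2 t).
Local Notation s11 := (gS11 t).
Local Notation s12 := (gS12 t).
Local Notation s22 := (gS22 t).
Local Notation e := (eta l).
Local Notation w := (prim l).
Local Notation g := (dyn l).
Implicit Types (c x y z M : R).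

(** The conjugacy to a translation bounds all the iterates at once, with
    constants independent of n. *)
Lemma iter_biLip c M n : `|c| < M -> biLip (lipC l M * lipC l M) (iter n (g c)).
Proof.
move=> cM x y xy; have L0 := lipC_gt0 l M; set L := lipC l M in L0 *.
have [h H] := rot_conj l cM; have [_ _ hb _] := H.
have it : iter n (g c) x <= iter n (g c) y by elim: n => //= n IH; exact: dyn_le.
have /andP[A B] := hb x y xy; have /andP[A' B'] := hb _ _ it.
rewrite !(conj_iter _ _ H) -/L in A B A' B'.
apply/andP; split.
  rewrite invfM mulrA ler_pdivrMr// (mulrC _ L).
  by apply: le_trans A _; apply: le_trans B'; lra.
by rewrite -mulrA -ler_pdivrMl// mulrC; apply: le_trans A' _; apply: le_trans B; lra.
Qed.

Lemma biLip_quot L (h : R -> R) x y : biLip L h -> x != y ->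
  L^-1 <= (h x - h y) / (x - y) <= L.
Proof.
move=> H; wlog xy : x y / x < y.
  move=> W xy; have := xy; rewrite neq_lt => /orP[/W|yx]; first exact.
  by have := W y x yx; rewrite -(opprB (h x)) -(opprB x) invrN mulrNN eq_sym; apply.
move=> _; have /andP[A B] := H x y (ltW xy).
rewrite -(opprB (h y)) -(opprB y) invrN mulrNN.
by rewrite ler_pdivlMr ?subr_gt0// mulrC A/= ler_pdivrMr ?subr_gt0.
Qed.

(** Consecutive steps of an orbit meet on the leaf: both expressions of eta
    agree at the middle point. *)
Lemma euler_lagrange c x : s2 x (g c x) + s1 (g c x) (g c (g c x)) = 0.
Proof. by rewrite -eta_dyn2 {1}eta_dyn1 addNr. Qed.

Lemma iter_dyn_lim (T : Type) (F : set_system T) {FF : Filter F} (c x : T -> R) c0 x0 n :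
  c @ F --> c0 -> x @ F --> x0 ->
  (fun t => iter n (g (c t)) (x t)) @ F --> iter n (g c0) x0.
Proof. by move=> cc xx; elim: n => //= n IH; exact: dyn_lim. Qed.

(** Subtract the equations of [euler_lagrange] along the orbits of two
    points of the same leaf, divide by the distance of the points and let
    them collide: the difference quotients of the iterates converge to a
    solution of the linearised equation, positive and bounded by
    [iter_biLip]. *)
Lemma jacobi_limit (T : Type) (U : set_system T) (c y z : T -> R) c0 x0 M :
  UltraFilter U -> `|c0| < M -> c @ U --> c0 -> y @ U --> x0 -> z @ U --> x0 ->
  (\forall t \near U, y t != z t) ->
  let o j := iter j (g c0) x0 in
  let K := lipC l M * lipC l M in
  exists k : nat -> R,
   [/\ forall j, (fun t => (iter j (g (c t)) (y t) - iter j (g (c t)) (z t)) / (y t - z t)) @ U --> k j,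
    k 0%N = 1, forall j, K^-1 <= k j <= K &
    forall j, - s12 (o j) (o j.+1) * k j + - s12 (o j.+1) (o j.+2) * k j.+2 =
      (s22 (o j) (o j.+1) + s11 (o j.+1) (o j.+2)) * k j.+1].
Proof.
move=> UU cM cc yx zx yz o K.
pose q j t := (iter j (g (c t)) (y t) - iter j (g (c t)) (z t)) / (y t - z t).
have qb j : \forall t \near U, K^-1 <= q j t <= K.
  pose proof (limn cc) as ca; move/cvgrPdist_lt: ca => ca.
  near=> t0.
  have h1 : `|c t0| < M.
    have : `| `|c0| - `|c t0| | < M - `|c0| by near: t0; apply: ca; rewrite subr_gt0.
    by rewrite ltr_norml; lra.
  have h2 : y t0 != z t0 by near: t0.
  exact: biLip_quot (iter_biLip j h1) h2.
have L0 := lipC_gt0 l M.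
have K0 : 0 < K by rewrite mulr_gt0.
have /choice[k hk] j : exists k : R, q j @ U --> k.
  apply: (@bounded_ultra_cvg _ _ _ _ K UU); apply: filterS (qb j) => t0 /andP[A B].
  by rewrite ger0_norm//; apply: le_trans A; rewrite invr_ge0 ltW.
exists k; split=> //.
- apply: (cvg_uniq (hk 0%N)); apply: (cvg_eq_near _ (cvg_cst (1 : R))).
  by apply: filterS yz => t0 h; rewrite /q /= divff// subr_eq0.
- move=> j; apply/andP; split.
    by apply: (cvg_ge_cst (hk j)); apply: filterS (qb j) => ? /andP[].
  by apply: (cvg_le_cst (hk j)); apply: filterS (qb j) => ? /andP[].
- move=> j.
  pose Y i t := iter i (g (c t)) (y t); pose Z i t := iter i (g (c t)) (z t).
  have Yl i : Y i @ U --> o i by exact: iter_dyn_lim.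
  have Zl i : Z i @ U --> o i by exact: iter_dyn_lim.
  have [a1 [b1 [a1l b1l E1]]] := partials_slope (gS2_d t) (Zl j) (Yl j) (Zl j.+1) (Yl j.+1).
  have [a2 [b2 [a2l b2l E2]]] := partials_slope (gS1_d t) (Zl j.+1) (Yl j.+1) (Zl j.+2) (Yl j.+2).
  have E t0 : a1 t0 * q j t0 + b1 t0 * q j.+1 t0 + (a2 t0 * q j.+1 t0 + b2 t0 * q j.+2 t0) = 0.
    have := E1 t0; have := E2 t0.
    have := euler_lagrange (c t0) (Y j t0); have := euler_lagrange (c t0) (Z j t0).
    rewrite /q -/(Y j t0) -/(Z j t0) -/(Y j.+1 t0) -/(Z j.+1 t0) -/(Y j.+2 t0) -/(Z j.+2 t0).
    rewrite -[g (c t0) (Y j t0)]/(Y j.+1 t0) -[g (c t0) (Z j t0)]/(Z j.+1 t0).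
    rewrite -[g (c t0) (Y j.+1 t0)]/(Y j.+2 t0) -[g (c t0) (Z j.+1 t0)]/(Z j.+2 t0).
    move=> H1 H2 H3 H4; rewrite !mulrA -!mulrDl addrACA.
    apply/eqP; rewrite mulf_eq0; apply/orP; left; apply/eqP; lra.
  pose proof (limD (limD (limM a1l (hk j)) (limM b1l (hk j.+1)))
    (limD (limM a2l (hk j.+1)) (limM b2l (hk j.+2)))) as lim.
  have E0 : \forall t \near U, 0 = a1 t * q j t + b1 t * q j.+1 t +
      (a2 t * q j.+1 t + b2 t * q j.+2 t) by near=> t0; rewrite E.
  pose proof (cvg_uniq_near (cvg_cst (0 : R)) lim E0) as H.
  by move: H; lra.
Unshelve. all: by end_near. Qed.

Lemma s12_orbit_bound c : exists Bm, forall x, 0 < - s12 x (g c x) <= Bm.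
Proof.
have [_ _ _ c12] := gS1_d t.
have [||M M0 HM] := @per_bounded R (fun x => s12 x (g c x)).
- move=> x; have ix : (fun y : R => y) @ x --> x by exact: cvg_id.
  exact: (cont2_cvg c12 ix (dyn_cont (l := l) (c := c) (x := x))).
- move=> x; rewrite dyn_deg1.
  have [_ h _ _] := gS1_d t.
  have D1 := h x (g c x).
  have D2 : is_derive (g c x) 1 (s1 x) (s12 (x + 1) (g c x + 1)).
    have -> : s1 x = (fun y => s1 (x + 1) (y + 1)).
      by apply/funext => z; rewrite s1_per.
    apply/is_deriveP; have /is_deriveP := h (x + 1) (g c x + 1).
    by under eq_fun do rewrite addrAC.
  by have := @derive_val _ _ _ _ _ _ _ D1; rewrite (@derive_val _ _ _ _ _ _ _ D2).
exists M => x; rewrite oppr_gt0 gS12_lt0/=.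
by apply: le_trans (HM x); rewrite -normrN ler_norm.
Qed.

(** Any two ultrafilter limits extend to bounded positive solutions of the
    same Jacobi equation with value 1 at 0, and these agree by
    [jacobi_unique]. The leaf is allowed to vary together with the two
    points, which yields joint continuity for free. *)
Lemma slope_ex c0 x0 : exists2 r : R, 0 < r &
  forall (T : Type) (F : set_system T) (c y z : T -> R), Filter F ->
    c @ F --> c0 -> y @ F --> x0 -> z @ F --> x0 -> (\forall t \near F, y t != z t) ->
    (fun t => (g (c t) (y t) - g (c t) (z t)) / (y t - z t)) @ F --> r.
Proof.
have [M cM] : exists M, `|c0| < M by exists (`|c0| + 1); rewrite ltrDl.
have L0 := lipC_gt0 l M.
have K0 : 0 < lipC l M * lipC l M by rewrite mulr_gt0.
have [Bm HB] := s12_orbit_bound c0.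
have [U [UU U0]] := ultraFilterLemma (@at_right_proper_filter R 0).
have hU : (fun h : R => h) @ U --> 0.
  by move=> A A0; apply: U0; apply: filterS A0 => x Ax _.
have xU : (fun h : R => x0 + h) @ U --> x0.
  by pose proof (limD (cvg_cst x0) hU) as H; rewrite addr0 in H.
have [|k [kl k0 kK kE]] := jacobi_limit UU cM (cvg_cst c0) xU (cvg_cst x0).
  apply: U0; near=> h; rewrite -subr_eq0 addrC addKr gt_eqF//.
exists (k 1%N).
  by have /andP[A _] := kK 1%N; apply: lt_le_trans A; rewrite invr_gt0.
move=> T F c y z FF cc yx zx yz.
apply: cvg_ultraP => V VV FV.
have cF (f : T -> R) (a : R) : f @ F --> a -> f @ V --> a by move=> H A /H /FV.
have [|k' [k'l k'0 k'K k'E]] := jacobi_limit VV cM (cF _ _ cc) (cF _ _ yx) (cF _ _ zx).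
  exact: FV.
have -> : k 1%N = k' 1%N.
  have m0 : 0 < (lipC l M * lipC l M)^-1 by rewrite invr_gt0.
  apply/eqP; rewrite eq_le; apply/andP; split.
    by apply: (jacobi_unique m0 _ kK k'K kE k'E) => // j; exact: HB.
  by apply: (jacobi_unique m0 _ k'K kK k'E kE) => // j; exact: HB.
exact: k'l 1%N.
Unshelve. all: by end_near. Qed.

Definition slope c x : R := s2val (cid2 (slope_ex c x)).

Lemma slope_gt0 c x : 0 < slope c x.
Proof. exact: (s2valP (cid2 (slope_ex c x))). Qed.

Lemma slope_lim (T : Type) (F : set_system T) {FF : Filter F} (c y z : T -> R) c0 x0 :
    c @ F --> c0 -> y @ F --> x0 -> z @ F --> x0 -> (\forall t \near F, y t != z t) ->
    (fun t => (g (c t) (y t) - g (c t) (z t)) / (y t - z t)) @ F --> slope c0 x0.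
Proof. by move=> *; apply: (s2valP' (cid2 (slope_ex c0 x0))). Qed.

Lemma slope_derive c x : is_derive x 1 (g c) (slope c x).
Proof.
apply/is_deriveP.
have hU : (fun h : R => h) @ 0^' --> 0 by exact: nbhs_dnbhs.
have xU : (fun h : R => x + h) @ 0^' --> x.
  by pose proof (limD (cvg_cst x) hU) as H; rewrite addr0 in H.
have H : \forall h \near 0^', x + h != x.
  near=> h; rewrite -subr_eq0 addrC addKr; near: h; exact: nbhs_dnbhs_neq.
pose proof (slope_lim (cvg_cst c) xU (cvg_cst x) H) as A.
by apply: cvg_eq_near A; near=> h; congr (_ / _); ring.
Unshelve. all: by end_near. Qed.

(** The quotients in [slope_lim] are close to slope c0 x0 for all nearby
    data at once; let the two points collide first. *)
Lemma slope_cont2 : cont2 slope.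
Proof.
move=> [c0 x0] /=; apply/cvgrPdist_le => eps e0.
pose F := filter_prod (nbhs (c0, x0)) (0 : R)^'.
have FF : Filter F by exact: filter_prod_filter.
have f1 : (fun p : (R * R) * R => p.1) @ F --> (c0, x0) by exact: cvg_fst.
have f2 : (fun p : (R * R) * R => p.2) @ F --> 0.
  by move=> A A0; apply: cvg_snd; exact: nbhs_dnbhs.
have fc : (fun p : (R * R) * R => p.1.1) @ F --> c0.
  exact: (cvg_comp (fun p : (R * R) * R => p.1) fst f1 cvg_fst).
have fx : (fun p : (R * R) * R => p.1.2) @ F --> x0.
  exact: (cvg_comp (fun p : (R * R) * R => p.1) snd f1 cvg_snd).
pose proof (limD fx f2) as fy; rewrite addr0 in fy.
have fn : \forall p \near F, p.1.2 + p.2 != p.1.2.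
  exists (setT, [set h | h != 0]).
    split; first exact: filterT.
    by rewrite /=; near=> h; near: h; exact: nbhs_dnbhs_neq.
  by move=> p [_ /= p0]; rewrite -subr_eq0 addrC addKr.
pose proof (slope_lim fc fy fx fn) as H.
move/cvgrPdist_le: H => /(_ _ e0)[[A B] [nA nB] AB].
near=> p.
have Ap : A p by near: p.
have D : (fun h => (g p.1 (p.2 + h) - g p.1 p.2) / h) @ 0^' --> slope p.1 p.2.
  by apply/is_deriveP; exact: slope_derive.
pose proof (limn (limB (cvg_cst (slope c0 x0)) D)) as D'.
apply: (cvg_le_cst D').
apply: filterS nB => h Bh.
have := AB (p, h) (conj Ap Bh).
by rewrite /= (addrC p.2) addrK.
Unshelve. all: by end_near. Qed.

End Slope.

(** * Leaves with irrational rotation number *)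

Section Irrational.
Context {R : realType}.
Implicit Types (x y z a r : R).

Definition irr r := forall (q : nat) (p : int), (0 < q)%N -> q%:R * r != p%:~R.

(** Pigeonhole: two of the first multiples of r fall in the same cell of
    length 1/N modulo 1. *)
Lemma dirichlet r (N : nat) : (0 < N)%N -> exists2 n : nat, (0 < n)%N &
  exists k : int, `|n%:R * r + k%:~R| < N%:R^-1.
Proof.
move=> N0; have NR : 0 < N%:R :> R by rewrite ltr0n.
have /choice[m Hm] (i : 'I_N.+1) : exists m : int, 0 <= i%:R * r - m%:~R < 1.
  by have [m m0 m1] := mod1 (i%:R * r); exists m; rewrite m0.
have /choice[f Hf] (i : 'I_N.+1) : exists j : 'I_N,
   j%:R <= N%:R * (i%:R * r - (m i)%:~R) < j%:R + 1.
  have /andP[a b] := Hm i; set v := _ - _ in a b *.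
  have v0 : 0 <= N%:R * v by rewrite mulr_ge0.
  have /andP[c d] := floor_itv (N%:R * v).
  have fl0 : (0 <= Num.floor (N%:R * v))%R by rewrite floor_ge0.
  have E : (Num.floor (N%:R * v))%:~R = `|Num.floor (N%:R * v)|%N%:R :> R.
    by rewrite -[in LHS](gez0_abs fl0).
  rewrite intrD E in d; rewrite E in c.
  have jN : (`|Num.floor (N%:R * v)| < N)%N.
    rewrite -(ltr_nat R); apply: le_lt_trans c _.
    by rewrite -[ltRHS]mulr1 ltr_pM2l.
  by exists (Ordinal jN); rewrite c d.
have [i [j [ij fij]]] : exists i j : 'I_N.+1, (i < j)%N /\ f i = f j.
  apply: contrapT => H.
  have finj : injective f.
    move=> i j fij; apply/val_inj; have [lt|gt|//] := ltngtP i j.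
      by exfalso; apply: H; exists i, j.
    by exfalso; apply: H; exists j, i.
  by have := leq_card f finj; rewrite !card_ord ltnn.
exists (j - i)%N; first by rewrite subn_gt0.
exists (m i - m j).
have /andP[a b] := Hf i; have /andP[c d] := Hf j; rewrite fij in a b.
rewrite natrB ?(ltnW ij)// intrB -(ltr_pM2l NR) mulfV ?gt_eqF//.
rewrite -[X in X * _](ger0_norm (ltW NR)) -normrM ltr_norml; lra.
Qed.

Lemma irr_gap r eps : irr r -> 0 < eps -> exists2 n : nat, (0 < n)%N &
  exists k : int, 0 < `|n%:R * r + k%:~R| < eps.
Proof.
move=> ir e0; have [N HN] := ex_nat_gt (eps^-1).
have N0 : (0 < N)%N by rewrite -(ltr_nat R); apply: lt_trans HN; rewrite invr_gt0.
have [n n0 [k Hk]] := dirichlet r N0; exists n => //; exists k.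
rewrite normr_gt0 (lt_trans Hk) ?andbT.
  by rewrite -[k]opprK intrN subr_eq0; exact: ir.
by rewrite -(invrK eps) ltf_pV2 ?posrE ?invr_gt0// ltr0n.
Qed.

(** Multiples of a nonzero step shorter than eps. *)
Lemma irr_dense r (T eps : R) : irr r -> 0 < eps ->
  exists (n : nat) (k : int), `|n%:R * r + k%:~R - T| < eps.
Proof.
move=> ir e0; have [m m0 [k0 /andP[d0 de]]] := irr_gap ir e0.
set d := _ + _ in d0 de.
have dn0 : d != 0 by rewrite -normr_gt0.
have [K HK] : exists K : int, 0 <= (T - K%:~R) / d.
  have [K K0 K1] := mod1 T.
  have [dp|dm] := ltP 0 d; first by exists K; rewrite divr_ge0// ltW.
  by exists (K + 1); rewrite intrD mulr_le0 ?invr_le0//; lra.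
have /andP[a b] := floor_itv ((T - K%:~R) / d).
set j := Num.floor _ in a b.
have j0 : (0 <= j)%R by rewrite floor_ge0.
have E : j%:~R = `|j|%N%:R :> R by rewrite -[in LHS](gez0_abs j0).
exists (`|j| * m)%N, (k0 * `|j|%N%:Z + K).
have -> : (`|j| * m)%:R * r + (k0 * `|j|%N%:Z + K)%:~R - T = `|j|%N%:R * d - (T - K%:~R).
  by rewrite natrM intrD intrM /d -[(`|j|%N%:Z)%:~R]/(`|j|%N%:R : R); ring.
apply: le_lt_trans de; rewrite intrD E in b; rewrite E in a.
have -> : `|j|%N%:R * d - (T - K%:~R) = (`|j|%N%:R - (T - K%:~R) / d) * d.
  by field.
rewrite normrM -[leRHS]mul1r ler_wpM2r// ler_norml; lra.
Qed.

End Irrational.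

Section DynLip.
Context {R : realType} (t : twist R) (l : leaves t).
Local Notation g := (dyn l).
Implicit Types (c x y z M : R).

Definition dynK M := lipC l M * lipC l M.

Lemma dynK_gt0 M : 0 < dynK M.
Proof. by rewrite mulr_gt0// lipC_gt0. Qed.

Lemma dyn_lip M c y z : `|c| < M -> `|g c y - g c z| <= dynK M * `|y - z|.
Proof. by move=> cM; apply: biLip_lip; [exact: dynK_gt0|exact: (iter_biLip l 1 cM)]. Qed.

Lemma dyn_colip M c y z : `|c| < M -> `|y - z| <= dynK M * `|g c y - g c z|.
Proof.
move=> cM; have [->|yz] := eqVneq y z; first by rewrite !subrr normr0 mulr0.
have /andP[A _] := biLip_quot (iter_biLip l 1 cM) yz.
rewrite -[iter 1 _]/(g c) -/(dynK M) in A.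
have K0 := dynK_gt0 M; have q0 : 0 < (g c y - g c z) / (y - z).
  by apply: lt_le_trans A; rewrite invr_gt0.
rewrite -[g c y - g c z](divfK (x := y - z)) ?subr_eq0//.
rewrite normrM (gtr0_norm q0) mulrA -[leLHS]mul1r ler_wpM2r//.
by rewrite -(mulfV (lt0r_neq0 K0)) ler_pM2l.
Qed.

End DynLip.

Section IrrationalLeaf.
Context {R : realType} (t : twist R) (l : leaves t).
Local Notation g := (dyn l).
Implicit Types (c x y z M : R).
Variables (c : R) (L : R) (h : R -> R).
Hypotheses (L0 : 0 < L) (hc : is_conj l c L (rot l c) h) (ic : irr (rot l c)).

(** The conjugacy carries an orbit to an orbit of an irrational rotation,
    and its inverse is Lipschitz. *)
Lemma orbit_dense x y eps : 0 < eps ->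
  exists (n : nat) (k : int), `|iter n (g c) x + k%:~R - y| < eps.
Proof.
move=> e0; have [_ h1 hb _] := hc.
have [n [k H]] := irr_dense (h y - h x) ic (divr_gt0 e0 L0).
exists n, k; set u := _ + k%:~R.
have hu : h u = h x + n%:R * rot l c + k%:~R.
  by rewrite /u (deg1_int h1) (conj_iter _ _ hc).
have E : n%:R * rot l c + k%:~R - (h y - h x) = h u - h y by rewrite hu; ring.
rewrite E in H.
have [uy|yu] := leP u y.
  have /andP[A _] := hb u y uy.
  move: H; rewrite distrC ger0_norm; last by apply: le_trans A; rewrite divr_ge0 ?subr_ge0// ltW.
  rewrite distrC ger0_norm ?subr_ge0// => H.
  by have := le_lt_trans A H; rewrite ltr_pM2r ?invr_gt0.
have /andP[A _] := hb y u (ltW yu).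
move: H; rewrite ger0_norm; last by apply: le_trans A; rewrite divr_ge0 ?subr_ge0// ltW.
rewrite ger0_norm ?subr_ge0 1?ltW// => H.
by have := le_lt_trans A H; rewrite ltr_pM2r ?invr_gt0.
Qed.

Lemma orbit_inv (T : Type) (X : R -> T) n (k : int) x : (forall x, X (x + 1) = X x) ->
  (forall x, X (g c x) = X x) -> X (iter n (g c) x + k%:~R) = X x.
Proof.
move=> X1 Xg; rewrite per_int//.
by elim: n => //= n IH; rewrite Xg.
Qed.

(** Every neighbourhood of y contains a point of the orbit of x, so upper
    semicontinuity at y gives X x <= X y, and conversely. *)
Lemma usc_inv_const (X : R -> R) : (forall x, X (x + 1) = X x) -> (forall x, X (g c x) = X x) ->
  (forall y a, X y < a -> exists2 d, 0 < d & forall z, `|z - y| < d -> X z <= a) ->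
  forall x y, X x = X y.
Proof.
move=> X1 Xg usc.
suff H x y : X x <= X y by move=> x y; apply/eqP; rewrite eq_le !H.
apply/ler_addgt0Pl => eps e0.
have [|d d0 Hd] := usc y (eps + X y); first by rewrite ltrDr.
have [n [k Hn]] := orbit_dense x y d0.
by have := Hd _ Hn; rewrite orbit_inv.
Qed.

Lemma cont_inv_const (X : R -> R) : continuous X -> (forall x, X (x + 1) = X x) ->
  (forall x, X (g c x) = X x) -> forall x y, X x = X y.
Proof.
move=> cX X1 Xg; apply: usc_inv_const => // y a ya.
have /cvgrPdist_lt/(_ (a - X y))[|d d0 Hd] := cX y; first by rewrite subr_gt0.
exists d => // z zy; have := Hd z; rewrite /= distrC => /(_ zy).
by rewrite ltr_norml => ?; lra.
Qed.

Lemma conj_unique_irr L' h' : 0 < L' -> is_conj l c L' (rot l c) h' -> h' = h.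
Proof.
move=> L0' hc'; have [h0 h1 hb hg] := hc; have [h'0 h'1 hb' hg'] := hc'.
pose X x := h' x - h x.
have E : forall x y, X x = X y.
  apply: cont_inv_const.
  - move=> x; exact: (limB (biLip_cont L0' hb' (x := x)) (biLip_cont L0 hb (x := x))).
  - by move=> x; rewrite /X h1 h'1; ring.
  - by move=> x; rewrite /X hg hg'; ring.
apply/funext => x; have := E x 0; rewrite /X h0 h'0; lra.
Qed.

(** The upper bounds of the slopes of chords of ph near x. *)
Definition upS (ph : R -> R) x : set R := [set a | exists2 d, 0 < d &
  forall y z, `|y - x| < d -> `|z - x| < d -> z < y -> ph y - ph z <= a * (y - z)].
(** The upper slope of ph at x. Chords near x, not only chords from x, enter
    the definition, which makes it upper semicontinuous. *)
Definition Dup ph x := inf (upS ph x).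

Section Upper.
Variable ph : R -> R.
Hypotheses (phL : forall y z, z < y -> `|ph y - ph z| <= L * (y - z))
  (ph1 : forall y z, ph (y + 1) - ph (z + 1) = ph y - ph z)
  (phg : forall y z, ph (g c y) - ph (g c z) = ph y - ph z).

Lemma upS_up x a b : a <= b -> upS ph x a -> upS ph x b.
Proof.
move=> ab [d d0 H]; exists d => // y z yx zx zy; apply: le_trans (H y z yx zx zy) _.
by rewrite ler_pM2r ?subr_gt0.
Qed.

Lemma upS_L x : upS ph x L.
Proof. by exists 1 => // y z _ _ zy; apply: le_trans (ler_norm _) (phL zy). Qed.

Lemma upS_lb x m : (forall y z, z < y -> m * (y - z) <= ph y - ph z) -> lbound (upS ph x) m.
Proof.
move=> Hm a [d d0 H].
have d2 : 0 < d / 2 by rewrite divr_gt0.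
have E : x + d / 2 - x = d / 2 by ring.
have A : x < x + d / 2 by rewrite ltrDl.
have d2d : d / 2 < d by rewrite ltr_pdivrMr//; lra.
have := H (x + d / 2) x; rewrite E subrr normr0 gtr0_norm// => /(_ d2d d0 A) B.
by have := le_trans (Hm _ _ A) B; rewrite E ler_pM2r.
Qed.

Lemma upS_hinf x : has_inf (upS ph x).
Proof.
split; first by exists L; exact: upS_L.
exists (- L); apply: upS_lb => y z zy; have := phL zy.
by rewrite ler_norml mulNr => /andP[].
Qed.

Lemma Dup_lt x a : Dup ph x < a -> upS ph x a.
Proof. by move=> /(inf_lt (upS_hinf x).1)[b Sb ba]; apply: upS_up Sb; exact: ltW. Qed.

Lemma Dup_le x a : upS ph x a -> Dup ph x <= a.
Proof. by apply: ge_inf; case: (upS_hinf x). Qed.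

Lemma Dup_ge x m : (forall y z, z < y -> m * (y - z) <= ph y - ph z) -> m <= Dup ph x.
Proof. by move=> Hm; apply: lb_le_inf; [case: (upS_hinf x)|exact: upS_lb]. Qed.

Lemma Dup_usc y a : Dup ph y < a -> exists2 d, 0 < d & forall z, `|z - y| < d -> Dup ph z <= a.
Proof.
move=> /Dup_lt[d d0 H]; exists (d / 2); first by rewrite divr_gt0.
move=> z zy; apply: Dup_le; exists (d / 2); first by rewrite divr_gt0.
have tri u : `|u - z| < d / 2 -> `|u - y| < d.
  by move=> uz; apply: le_lt_trans (ler_distD z _ _) _; lra.
by move=> u v uz vz; apply: H; exact: tri.
Qed.

Lemma Dup_per x : Dup ph (x + 1) = Dup ph x.
Proof.
rewrite /Dup; congr inf; apply/seteqP; split=> a [d d0 H]; exists d => // y z yx zx zy.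
  have -> : y - z = (y + 1) - (z + 1) by ring.
  rewrite -ph1; apply: H; last by rewrite ltrD2r.
    by have -> : y + 1 - (x + 1) = y - x by ring.
  by have -> : z + 1 - (x + 1) = z - x by ring.
have := ph1 (y - 1) (z - 1); rewrite !subrK => ->.
have -> : y - z = (y - 1) - (z - 1) by ring.
apply: H; last by rewrite ltrD2r.
  by have -> : y - 1 - x = y - (x + 1) by ring.
by have -> : z - 1 - x = z - (x + 1) by ring.
Qed.

Lemma slope_eps x eps : 0 < eps -> exists2 d, 0 < d & forall y z, `|y - x| < d -> `|z - x| < d ->
  z < y -> `|g c y - g c z - slope l c x * (y - z)| <= eps * (y - z).
Proof.
move=> e0; have /cvgrPdist_le/(_ _ e0)[d d0 H] := @cont2_1 _ _ c (@slope_cont2 _ _ l) x.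
exists d => // y z yx zx zy.
have [u /andP[u1 u2] ->] := MVT_lt zy (slope_derive l c).
rewrite -mulrBl normrM (gtr0_norm (x := y - z)) ?subr_gt0// ler_pM2r ?subr_gt0//.
rewrite distrC; apply: H; rewrite /= distrC.
by move: yx zx; rewrite !ltr_norml; lra.
Qed.

(** Since ph (g y) - ph (g z) = ph y - ph z, only the length of the chord
    changes under g, by the factor slope. *)
Lemma Dup_dyn x : Dup ph (g c x) * slope l c x = Dup ph x.
Proof.
have cM : `|c| < `|c| + 1 by rewrite ltrDl.
have K0 := dynK_gt0 l (`|c| + 1).
have gl y z := dyn_lip l y z cM; have gu y z := dyn_colip l y z cM.
move: (dynK l _) K0 gl gu => K K0 gl gu.
have r0 := slope_gt0 l c x; set r := slope l c x in r0 *.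
have a0 (a : R) : 0 < `|a| + 1 by rewrite ltr_wpDl.
apply/eqP; rewrite eq_le; apply/andP; split.
  rewrite -ler_pdivlMr//; apply/ler_addgt0Pl => eps e0.
  pose a := Dup ph x + r * eps / 2.
  have [d d0 Ha] : upS ph x a by apply: Dup_lt; rewrite ltrDl divr_gt0// mulr_gt0.
  pose e1 := eps / 2 / (`|a / r| + 1) / K.
  have e10 : 0 < e1 by rewrite !divr_gt0.
  have [d1 d10 H1] := slope_eps x e10.
  pose dd := Num.min d d1 / K.
  have dd0 : 0 < dd by rewrite divr_gt0// lt_min d0.
  apply: Dup_le; exists dd => // y' z' y'x z'x zy.
  have [y yE] := dyn_onto l c y'; have [z zE] := dyn_onto l c z'.
  have cl u : `|g c u - g c x| < dd -> `|u - x| < d /\ `|u - x| < d1.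
    move=> H; have : `|u - x| < Num.min d d1.
      by apply: le_lt_trans (gu u x) _; rewrite mulrC -ltr_pdivlMr.
    by rewrite lt_min => /andP.
  rewrite -yE in y'x; rewrite -zE in z'x.
  have [yd yd1] := cl _ y'x; have [zd zd1] := cl _ z'x.
  have yz : z < y by rewrite -(dyn_mono l c) yE zE.
  have A := Ha y z yd zd yz; have B := H1 y z yd1 zd1 yz.
  rewrite -yE -zE phg; apply: le_trans A _.
  have gyz : 0 < g c y - g c z by rewrite subr_gt0 yE zE.
  have C : y - z <= K * (g c y - g c z).
    by have := gu y z; rewrite !gtr0_norm ?subr_gt0// yE zE.
  have -> : a * (y - z) = a / r * (g c y - g c z) - a / r * (g c y - g c z - r * (y - z)).
    by field; rewrite gt_eqF.
  have D : - (a / r * (g c y - g c z - r * (y - z))) <= eps / 2 * (g c y - g c z).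
    apply: le_trans (ler_norm _) _; rewrite normrN normrM.
    apply: (@le_trans _ _ ((`|a / r| + 1) * (e1 * (K * (g c y - g c z))))).
      apply: ler_pM => //; first by rewrite lerDl.
      by apply: le_trans B _; rewrite ler_pM2l.
    rewrite /e1 le_eqVlt; apply/orP; left; apply/eqP; field.
    by rewrite !gt_eqF.
  have -> : eps + Dup ph x / r = a / r + eps / 2 by rewrite /a; field; rewrite gt_eqF.
  by rewrite [leRHS]mulrDl lerD2l.
apply/ler_addgt0Pl => eps e0.
pose a := Dup ph (g c x) + eps / 2 / r.
have [d d0 Ha] : upS ph (g c x) a by apply: Dup_lt; rewrite ltrDl !divr_gt0.
pose e1 := eps / 2 / (`|a| + 1).
have e10 : 0 < e1 by rewrite !divr_gt0.
have [d1 d10 H1] := slope_eps x e10.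
have dd0 : 0 < Num.min (d / K) d1 by rewrite lt_min divr_gt0.
apply: Dup_le; exists (Num.min (d / K) d1) => // y z yx zx zy.
have cl u : `|u - x| < Num.min (d / K) d1 -> `|g c u - g c x| < d /\ `|u - x| < d1.
  rewrite lt_min => /andP[A B]; split=> //.
  by apply: le_lt_trans (gl u x) _; rewrite mulrC -ltr_pdivlMr.
have [yd yd1] := cl _ yx; have [zd zd1] := cl _ zx.
have gzy : g c z < g c y by rewrite dyn_mono.
have A := Ha _ _ yd zd gzy; have B := H1 y z yd1 zd1 zy.
rewrite -phg; apply: le_trans A _.
have yz0 : 0 < y - z by rewrite subr_gt0.
have -> : a * (g c y - g c z) = a * r * (y - z) + a * (g c y - g c z - r * (y - z)) by ring.
have D : a * (g c y - g c z - r * (y - z)) <= eps / 2 * (y - z).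
  apply: le_trans (ler_norm _) _; rewrite normrM.
  apply: (@le_trans _ _ ((`|a| + 1) * (e1 * (y - z)))).
    by apply: ler_pM => //; rewrite lerDl.
  rewrite /e1 le_eqVlt; apply/orP; left; apply/eqP; field.
  by rewrite gt_eqF.
have -> : eps + Dup ph (g c x) * r = a * r + eps / 2 by rewrite /a; field; rewrite gt_eqF.
by rewrite [leRHS]mulrDl lerD2l.
Qed.

End Upper.

(** The upper slope P and the lower slope N of h are both divided by slope
    along the dynamics, so P / N is invariant; it is upper semicontinuous,
    hence constant along dense orbits, and then P = q N is both upper and
    lower semicontinuous. The primitive of the continuous function P
    satisfies the same functional equations as h up to a factor, so it is
    proportional to h. *)
Lemma conj_C1_irr : exists p : R -> R, [/\ continuous p, forall x, 0 < p x &
  forall x, is_derive x 1 h (p x)].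
Proof.
have [h0 h1 hb hg] := hc.
have hL y z : z < y -> `|h y - h z| <= L * (y - z).
  by move=> zy; have := biLip_lip y z L0 hb; rewrite (gtr0_norm (x := y - z)) ?subr_gt0.
have nL y z : z < y -> `|- h y - - h z| <= L * (y - z).
  by move=> zy; rewrite -opprD normrN hL.
have h1' y z : h (y + 1) - h (z + 1) = h y - h z by rewrite !h1; ring.
have n1' y z : - h (y + 1) - - h (z + 1) = - h y - - h z by rewrite !h1; ring.
have hg' y z : h (g c y) - h (g c z) = h y - h z by rewrite !hg; ring.
have ng' y z : - h (g c y) - - h (g c z) = - h y - - h z by rewrite !hg; ring.
pose P x := Dup h x; pose N x := - Dup (fun y => - h y) x.
have Nlow x : L^-1 <= N x.
  rewrite /N lerNr; apply: (Dup_le nL); exists 1 => // y z _ _ zy.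
  have /andP[A _] := hb z y (ltW zy).
  by rewrite mulNr (mulrC L^-1); lra.
have N0 x : 0 < N x by apply: lt_le_trans (Nlow x); rewrite invr_gt0.
have Plow x : L^-1 <= P x.
  apply: (Dup_ge hL) => y z zy; have /andP[A _] := hb z y (ltW zy).
  by rewrite mulrC.
have P0 x : 0 < P x by apply: lt_le_trans (Plow x); rewrite invr_gt0.
have Pg x : P (g c x) * slope l c x = P x by exact: (Dup_dyn hL hg').
have Ng x : N (g c x) * slope l c x = N x.
  by rewrite /N mulNr (Dup_dyn nL ng').
have P1 x : P (x + 1) = P x by exact: (Dup_per h1').
have N1 x : N (x + 1) = N x by rewrite /N (Dup_per n1').
have Pusc y a : P y < a -> exists2 d, 0 < d & forall z, `|z - y| < d -> P z <= a.
  exact: (Dup_usc hL).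
have Nlsc y a : a < N y -> exists2 d, 0 < d & forall z, `|z - y| < d -> a <= N z.
  rewrite /N ltrNr => /(Dup_usc nL)[d d0 Hd]; exists d => // z zy.
  by rewrite lerNr Hd.
clearbody P N.
have Qc : forall x y, P x / N x = P y / N y.
  apply: usc_inv_const.
  - by move=> x; rewrite P1 N1.
  - move=> x; rewrite -[in RHS](Pg x) -[in RHS](Ng x); field.
    by rewrite !gt_eqF// slope_gt0.
  - move=> y a; rewrite ltr_pdivrMr// => Ha.
    have a0 : 0 < a by have := lt_trans (P0 y) Ha; rewrite pmulr_lgt0.
    pose e := (a * N y - P y) / (1 + a) / 2.
    have e0 : 0 < e by rewrite !divr_gt0 ?subr_gt0// addr_gt0.
    have eE : (1 + a) * (2 * e) = a * N y - P y by rewrite /e; field; rewrite gt_eqF// addr_gt0.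
    have [|d1 d10 H1] := Pusc y (P y + e); first by rewrite ltrDl.
    have [|d2 d20 H2] := Nlsc y (N y - e); first by rewrite ltrBlDr ltrDl.
    exists (Num.min d1 d2); first by rewrite lt_min d10.
    move=> z; rewrite lt_min => /andP[z1 z2].
    rewrite ler_pdivrMr//; have A := H1 z z1; have B := H2 z z2.
    have : a * (N y - e) <= a * N z by rewrite ler_pM2l.
    have : 0 < a * e by rewrite mulr_gt0.
    by lra.
pose q := P 0 / N 0.
have q0 : 0 < q by rewrite divr_gt0.
have PqN x : P x = q * N x.
  by rewrite /q (Qc 0 x) divfK// gt_eqF.
have cP : continuous P.
  move=> x; apply/cvgrPdist_le => e e0.
  have [|d1 d10 H1] := Pusc x (P x + e); first by rewrite ltrDl.
  have [|d2 d20 H2] := Nlsc x (N x - e / q); first by rewrite ltrBlDr ltrDl divr_gt0.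
  exists (Num.min d1 d2); first by rewrite /= lt_min d10.
  move=> z; rewrite /= distrC lt_min => /andP[z1 z2].
  have A := H1 z z1; have B := H2 z z2.
  have C : q * (N x - e / q) <= q * N z by rewrite ler_pM2l.
  rewrite mulrBr -!PqN mulrC divfK ?gt_eqF// in C.
  by rewrite ler_norml; lra.
have [W W0 Wd] := antiderivative cP.
have Wc x y : W (x + 1) - W x = W (y + 1) - W y.
  have D z : is_derive z 1 (fun z : R => W (z + 1)) (P z).
    apply/is_deriveP; have /is_deriveP := Wd (z + 1).
    by rewrite P1; under eq_fun do rewrite addrAC.
  by have := eq_antiderivative D Wd x y; lra.
have Wg x y : W (g c x) - W x = W (g c y) - W y.
  have D z : is_derive z 1 (fun z : R => W (g c z)) (P z).
    rewrite -(Pg z); have D1 := Wd (g c z); have D2 := slope_derive l c z.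
    exact: (@is_derive1_comp _ W (g c) z _ _ D1 D2).
  by have := eq_antiderivative D Wd x y; lra.
pose k := W 1.
have k0 : 0 < k.
  have := derive_gt0_incr Wd P0 ltr01; rewrite W0.
  exact.
have k1 x : W (x + 1) = W x + k by have := Wc x 0; rewrite add0r W0 /k; lra.
pose X x := W x - k * h x.
have cX : continuous X.
  move=> x; have cW : {for x, continuous W} by exact: is_derive_cont (Wd x).
  exact: (limB cW (limM (cvg_cst k) (biLip_cont L0 hb (x := x)))).
have X1 x : X (x + 1) = X x by rewrite /X k1 h1; ring.
pose b := X (g c 0) - X 0.
have Xg x : X (g c x) = X x + b.
  by have := Wg x 0; rewrite /b /X !hg; lra.
have b0 : b = 0.
  have [M M0 HM] := per_bounded cX X1.
  have it n : X (iter n (g c) 0) = X 0 + n%:R * b.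
    elim: n => [|n IH]; first by rewrite mul0r addr0.
    by rewrite iterS Xg IH -natr1; ring.
  apply/eqP; rewrite eq_le; apply/andP; split; apply: (@arch_le _ _ _ (2 * M)) => n.
    by have := HM (iter n (g c) 0); have := HM 0; rewrite it !ler_norml; lra.
  by have := HM (iter n (g c) 0); have := HM 0; rewrite it !ler_norml; lra.
have XC : forall x y, X x = X y.
  by apply: cont_inv_const => // x; rewrite Xg b0 addr0.
have hE : h = k^-1 \*: W.
  apply/funext => x; have := XC x 0; rewrite /X W0 h0 mulr0 subrr => /eqP.
  rewrite subr_eq0 => /eqP E; rewrite /= E.
  by rewrite -[LHS](mulKf (lt0r_neq0 k0)).
exists (fun x => k^-1 * P x); split.
- by move=> x; exact: (limM (cvg_cst k^-1) (cP x)).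
- by move=> x; rewrite mulr_gt0// invr_gt0.
- by move=> x; rewrite hE; have := Wd x => D; exact: is_deriveZ.
Qed.

End IrrationalLeaf.

(** * Leaves with rational rotation number *)

Section Quadratic.
Context {R : realType}.

(** Second order mean value theorem at a zero of E: compare E with the
    square of the distance to a by Cauchy's mean value theorem. *)
Lemma cauchy2 (E dE : R -> R) (a b : R) : a != b -> E a = 0 ->
  (forall x : R, is_derive x 1 E (dE x)) ->
  exists x, [/\ x != a, `|x - a| <= `|b - a| & E b * (2 * (x - a)) = dE x * (b - a) ^+ 2].
Proof.
move=> ab Ea dEE.
pose f x := E x * (b - a) ^+ 2 - E b * (x - a) ^+ 2.
have df (x : R) : is_derive x 1 f (dE x * (b - a) ^+ 2 - E b * (2 * (x - a))).
  have D1 := dEE x.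
  have D2 : is_derive x 1 (fun x : R => (x - a) ^+ 2) (2 * (x - a)).
    apply/is_deriveP.
    have k0 : (fun k : R => k) @ 0^' --> 0 by exact: nbhs_dnbhs.
    pose proof (limD (cvg_cst (2 * (x - a))) k0) as lk; rewrite addr0 in lk.
    apply: cvg_eq_near lk; near=> k.
    have kn : k != 0 by near: k; exact: nbhs_dnbhs_neq.
    by field.
  have -> : f = (fun x => (b - a) ^+ 2 *: E x - E b *: (x - a) ^+ 2).
    by apply/funext => z; rewrite /f mulrC.
  have -> : dE x * (b - a) ^+ 2 - E b * (2 * (x - a)) =
    (b - a) ^+ 2 *: dE x - E b *: (2 * (x - a)) by rewrite mulrC.
  by apply: is_deriveB; exact: is_deriveZ.
have fa : f a = 0 by rewrite /f Ea subrr expr0n /=; ring.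
have fb : f b = 0 by rewrite /f; ring.
move: ab; rewrite neq_lt => /orP[ab|ba].
  have [x /andP[ax xb] H] := MVT_lt ab df.
  exists x; rewrite gt_eqF//; split=> //.
    by rewrite !gtr0_norm ?subr_gt0 ?(lt_trans ax xb)// lerD2r ltW.
  move: H; rewrite fa fb subrr => /esym/eqP; rewrite mulf_eq0 [X in _ || X]gt_eqF ?subr_gt0// orbF.
  by rewrite subr_eq0 => /eqP->.
have [x /andP[ax xb] H] := MVT_lt ba df.
exists x; rewrite lt_eqF//; split=> //.
  by rewrite !ltr0_norm ?subr_lt0// lerN2 lerD2r ltW.
move: H; rewrite fa fb subrr => /esym/eqP; rewrite mulf_eq0 [X in _ || X]gt_eqF ?subr_gt0// orbF.
by rewrite subr_eq0 => /eqP->.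
Unshelve. all: by end_near. Qed.

End Quadratic.

Section Rational.
Context {R : realType} (t : twist R) (l : leaves t).
Local Notation s := (gS t).
Local Notation s1 := (gS1 t).
Local Notation s2 := (gS2 t).
Local Notation s12 := (gS12 t).
Local Notation e := (eta l).
Local Notation w := (prim l).
Local Notation g := (dyn l).
Local Notation al := (alph l).
Implicit Types (c x y z M : R).

Lemma dq_lim_ne (T : Type) (U : set_system T) (c : T -> R) c0 M :
  UltraFilter U -> `|c0| < M -> c @ U --> c0 -> (\forall t \near U, c t != c0) ->
  exists h, is_conj l c0 (lipC l M) (rot l c0) h /\
    forall x, (fun t => dq l c0 (c t) x) @ U --> h x.
Proof.
move=> UU cM cc cn.
have [cgt|cle] := ultra_near_or (fun t => c0 < c t) UU.
  have [h [r [H A _]]] := dq_lim l UU cM (cvg_cst c0) cc cgt.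
  by exists h; split=> //; rewrite -(conj_rot (lipC_gt0 l M) H).
have clt : \forall t \near U, c t < c0.
  near=> t0; rewrite lt_neqAle; apply/andP; split; first by near: t0.
  by rewrite leNgt; apply/negP; near: t0.
have [h [r [H A _]]] := dq_lim l UU cM cc (cvg_cst c0) clt.
exists h; split; first by rewrite -(conj_rot (lipC_gt0 l M) H).
by move=> x; under eq_fun do rewrite dq_sym; exact: A.
Unshelve. all: by end_near. Qed.

Section Step.
Variables (T : Type) (U : set_system T) (c : T -> R) (c0 : R).
Hypotheses (UU : UltraFilter U) (cc : c @ U --> c0) (cn : \forall t \near U, c t != c0).

(** Difference quotient in c of the leaves at the point y. *)
Definition De t0 y := (e (c t0) y - e c0 y) / (c t0 - c0).

Lemma De_bound M : `|c0| < M -> \forall t \near U, forall y, (lipC l M)^-1 <= De t y <= lipC l M.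
Proof.
move=> cM; pose proof (near_bound cc cM) as nb.
have [c0a c0b] : - M <= c0 /\ c0 <= M.
  by have := ler_norm c0; have := ler_norm (- c0); rewrite normrN; split; lra.
near=> t0 => y.
have [ca cb] : - M <= c t0 /\ c t0 <= M by near: t0.
have : c t0 != c0 by near: t0.
rewrite /De neq_lt => /orP[lt|gt].
  have /andP[A B] := eta_lipP l y ca (ltW lt) c0b.
  rewrite -(opprB (e c0 y)) -(opprB c0) invrN mulrNN.
  by rewrite ler_pdivlMr ?subr_gt0// mulrC A/= ler_pdivrMr ?subr_gt0.
have /andP[A B] := eta_lipP l y c0a (ltW gt) cb.
by rewrite ler_pdivlMr ?subr_gt0// mulrC A/= ler_pdivrMr ?subr_gt0.
Unshelve. all: by end_near. Qed.

Lemma dyn_ne : \forall t \near U, forall x, g (c t) x != g c0 x.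
Proof.
near=> t0 => x; have : c t0 != c0 by near: t0.
by rewrite neq_lt => /orP[] /(dyn_c_incr l x) H; rewrite ?(lt_eqF H) ?(gt_eqF H).
Unshelve. all: by end_near. Qed.

Lemma dyn_near_M M : `|c0| < M -> \forall t \near U, `|c t| < M.
Proof.
move=> cM; pose proof (limn cc) as ca; move/cvgrPdist_lt: ca => ca.
near=> t0; have : `| `|c0| - `|c t0| | < M - `|c0| by near: t0; apply: ca; rewrite subr_gt0.
by rewrite ltr_norml; lra.
Unshelve. all: by end_near. Qed.

(** The maps g (c t) are uniformly co-Lipschitz. *)
Lemma cvg_pinv (z u : T -> R) x0 : z @ U --> x0 ->
  (fun t => g (c t) (u t)) @ U --> g c0 x0 -> u @ U --> x0.
Proof.
move=> zx gu.
have [M cM] : exists M, `|c0| < M by exists (`|c0| + 1); rewrite ltrDl.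
have gx : (fun t => g (c t) x0) @ U --> g c0 x0 by apply: dyn_lim => //; exact: cvg_cst.
pose proof (limM (cvg_cst (dynK l M)) (limn (limB gu gx))) as A.
rewrite subrr normr0 mulr0 in A.
pose proof (dyn_near_M cM) as nM.
apply: (cvg_abs0 _ A); near=> t0; apply: dyn_colip; by near: t0.
Unshelve. all: by end_near. Qed.

Variables (x : T -> R) (x0 pi : R).
Hypotheses (xx : x @ U --> x0) (Dpi : (fun t => De t (x t)) @ U --> pi).
Local Notation b := (- s12 x0 (g c0 x0)).
Local Notation r := (slope l c0 x0).

Let b0 : 0 < b. Proof. by rewrite oppr_gt0 gS12_lt0. Qed.
Let s12n : s12 x0 (g c0 x0) != 0. Proof. by rewrite ltr0_neq0// gS12_lt0. Qed.

(** Differentiate eta c y = - s1 y (g c y) in c with y fixed: the quotient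
    of the leaves at x is b times that of the dynamics. *)
Lemma step_dyn : (fun t => (g (c t) (x t) - g c0 (x t)) / (c t - c0)) @ U --> pi / b.
Proof.
have gx : (fun t => g (c t) (x t)) @ U --> g c0 x0 by exact: dyn_lim.
have g0x : (fun t => g c0 (x t)) @ U --> g c0 x0 by apply: dyn_lim => //; exact: cvg_cst.
have [al' [be [ala bea E]]] := partials_slope (gS1_d t) xx xx g0x gx.
pose proof (lim_div (lt0r_neq0 b0) Dpi (limN bea)) as A.
have bn : \forall t \near U, be t < 0.
  move/cvgrPdist_lt: bea => bea; near=> t0.
  have : `|s12 x0 (g c0 x0) - be t0| < b by near: t0; exact: bea.
  by rewrite ltr_norml; lra.
apply: cvg_eq_near A; near=> t0.
have B0 : be t0 < 0 by near: t0.
have C0 : c t0 != c0 by near: t0.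
rewrite /De !eta_dyn1.
have -> : - s1 (x t0) (g (c t0) (x t0)) - - s1 (x t0) (g c0 (x t0)) =
   - (s1 (x t0) (g (c t0) (x t0)) - s1 (x t0) (g c0 (x t0))) by ring.
rewrite E subrr mulr0 add0r; field.
by rewrite subr_eq0 C0 lt_eqF.
Unshelve. all: by end_near. Qed.

(** The point sent by g (c t) to g c0 x differs from x by the displacement
    of [step_dyn] divided by the slope; read the difference of the leaves at
    g c0 x through s2. *)
Lemma step_next : (fun t => De t (g c0 (x t))) @ U --> pi / r.
Proof.
have g0x : (fun t => g c0 (x t)) @ U --> g c0 x0 by apply: dyn_lim => //; exact: cvg_cst.
have /choice[u Hu] t0 : exists u, g (c t0) u = g c0 (x t0) by exact: dyn_onto.
have ux : u @ U --> x0.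
  by apply: (cvg_pinv xx); under eq_fun do rewrite Hu.
have xu : \forall t \near U, x t != u t.
  pose proof dyn_ne as ne; near=> t0.
  have H : forall x, g (c t0) x != g c0 x by near: t0.
  by apply/eqP => E; have := H (x t0); rewrite {1}E Hu eqxx.
have [al' [be [ala bea E]]] := partials_slope (gS2_d t) xx ux g0x g0x.
pose proof (slope_lim (l := l) cc xx ux xu) as sl.
have r0 := slope_gt0 l c0 x0.
pose proof (limM (limN ala) (lim_div (lt0r_neq0 r0) step_dyn sl)) as A.
have -> : pi / r = - s12 x0 (g c0 x0) * (pi / b / r).
  by field; rewrite ?s12n ?(lt0r_neq0 r0).
apply: cvg_eq_near A; near=> t0.
have C0 : c t0 != c0 by near: t0.
have X0 : x t0 != u t0 by near: t0.
have gn : g (c t0) (x t0) != g c0 (x t0).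
  by near: t0; apply: filterS dyn_ne => t1; exact.
have D1 : e (c t0) (g c0 (x t0)) = s2 (u t0) (g c0 (x t0)) by rewrite -(Hu t0) eta_dyn2.
rewrite /De D1 eta_dyn2 E subrr mulr0 addr0 Hu.
by field; rewrite !subr_eq0 C0 X0 gn.
Unshelve. all: by end_near. Qed.

(** Second order expansion at its zero: the excess for c (t) vanishes at g
    (c t) x and is evaluated at distance pi / b (c t - c0); its second
    derivative there is b / r. *)
Lemma step_excess : (fun t => excess l (c t) (x t) (g c0 (x t)) / (c t - c0) ^+ 2) @ U
  --> pi ^+ 2 / (2 * b * r).
Proof.
have gx : (fun t => g (c t) (x t)) @ U --> g c0 x0 by exact: dyn_lim.
have g0x : (fun t => g c0 (x t)) @ U --> g c0 x0 by apply: dyn_lim => //; exact: cvg_cst.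
have /choice[xi Hxi] t0 : exists xi, g (c t0) (x t0) != g c0 (x t0) ->
   [/\ xi != g (c t0) (x t0), `|xi - g (c t0) (x t0)| <= `|g c0 (x t0) - g (c t0) (x t0)| &
     excess l (c t0) (x t0) (g c0 (x t0)) * (2 * (xi - g (c t0) (x t0))) =
     (s2 (x t0) xi - e (c t0) xi) * (g c0 (x t0) - g (c t0) (x t0)) ^+ 2].
  have [E|ne] := eqVneq (g (c t0) (x t0)) (g c0 (x t0)); first by exists 0 => /eqP.
  have [xi Hxi] := cauchy2 ne (excess_dyn l (c t0) (x t0)) (excess_d2 l (c t0) (x t0)).
  by exists xi.
have /choice[z Hz] t0 : exists z, g (c t0) z = xi t0 by exact: dyn_onto.
pose proof dyn_ne as ne.
have xil : xi @ U --> g c0 x0.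
  pose proof (limD (limn (limB g0x gx)) (limn (limB gx (cvg_cst (g c0 x0))))) as A.
  rewrite !subrr normr0 addr0 in A.
  apply: (cvg_abs0 _ A); near=> t0.
  have H : forall x, g (c t0) x != g c0 x by near: t0.
  have [_ B _] := Hxi t0 (H (x t0)).
  by apply: le_trans (ler_distD (g (c t0) (x t0)) _ _) _; rewrite lerD2r.
have zx : z @ U --> x0 by apply: (cvg_pinv xx); under eq_fun do rewrite Hz.
have zn : \forall t \near U, z t != x t.
  near=> t0.
  have H : forall x, g (c t0) x != g c0 x by near: t0.
  have [B _ _] := Hxi t0 (H (x t0)).
  by apply/eqP => E; move: B; rewrite -(Hz t0) E eqxx.
have [al' [be [ala bea E]]] := partials_slope (gS2_d t) zx xx xil xil.
pose proof (slope_lim (l := l) cc zx xx zn) as sl.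
have r0 := slope_gt0 l c0 x0.
pose proof (limM (limM (cvg_cst (2^-1 : R)) (lim_div (lt0r_neq0 r0) (limN ala) sl))
  (limX (n := 2) step_dyn)) as A.
have -> : pi ^+ 2 / (2 * b * r) = 2^-1 * (- s12 x0 (g c0 x0) / r) * (pi / b) ^+ 2.
  by field; rewrite ?s12n ?(lt0r_neq0 r0).
apply: cvg_eq_near A; near=> t0.
have C0 : c t0 != c0 by near: t0.
have Z0 : z t0 != x t0 by near: t0.
have H : forall x, g (c t0) x != g c0 x by near: t0.
have [B _ K] := Hxi t0 (H (x t0)).
have xz : x t0 - z t0 != 0 by rewrite subr_eq0 eq_sym.
have E2 : s2 (x t0) (xi t0) - e (c t0) (xi t0) = al' t0 * (x t0 - z t0).
  have := E t0; rewrite subrr mulr0 addr0 => <-.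
  by rewrite -(Hz t0) eta_dyn2.
rewrite E2 in K; rewrite (Hz t0).
have n0 : xi t0 - g (c t0) (x t0) != 0 by rewrite subr_eq0.
have -> : excess l (c t0) (x t0) (g c0 (x t0)) =
   al' t0 * (x t0 - z t0) * (g c0 (x t0) - g (c t0) (x t0)) ^+ 2 / (2 * (xi t0 - g (c t0) (x t0))).
  by rewrite -K mulfK// mulf_neq0.
have C0' : c t0 - c0 != 0 by rewrite subr_eq0.
have Z0' : z t0 - x t0 != 0 by rewrite subr_eq0.
by field; rewrite n0 C0' Z0'.
Unshelve. all: by end_near. Qed.

End Step.

(** The product of the inverse slopes along i steps, that is the inverse
    derivative of the i-th iterate. *)
Fixpoint kap (c : R) (i : nat) (x : R) : R :=
  if i is j.+1 then kap c j x / slope l c (iter j (g c) x) else 1.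

(** The second order coefficient of the total excess of a periodic orbit, by
    [step_excess], for a unit displacement of the leaf at x. *)
Definition mu (c : R) (q : nat) (x : R) : R := \sum_(i <- iota 0 q)
  kap c i x ^+ 2 / (2 * (- s12 (iter i (g c) x) (iter i.+1 (g c) x)) * slope l c (iter i (g c) x)).

Lemma kap_gt0 c i x : 0 < kap c i x.
Proof. by elim: i => //= i IH; rewrite divr_gt0// slope_gt0. Qed.

Lemma mu_term_gt0 c i x : 0 < kap c i x ^+ 2 /
  (2 * (- s12 (iter i (g c) x) (iter i.+1 (g c) x)) * slope l c (iter i (g c) x)).
Proof.
by rewrite divr_gt0 ?exprn_gt0 ?kap_gt0// !mulr_gt0 ?slope_gt0// oppr_gt0 gS12_lt0.
Qed.

Lemma mu_gt0 c q x : (0 < q)%N -> 0 < mu c q x.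
Proof.
case: q => // q _; rewrite /mu /= big_cons ltr_wpDr ?mu_term_gt0//.
by apply: sumr_ge0 => i _; rewrite ltW// mu_term_gt0.
Qed.

Lemma mu_cont c q : continuous (mu c q).
Proof.
move=> x; rewrite /mu; apply: lim_sum => i.
have ix j : (fun y => iter j (g c) y) @ x --> iter j (g c) x.
  by apply: iter_cont; exact: dyn_cont.
have sx j : (fun y => slope l c (iter j (g c) y)) @ x --> slope l c (iter j (g c) x).
  by apply: cont2_cvg; [exact: slope_cont2|exact: cvg_cst|exact: ix].
have kx : (fun y => kap c i y) @ x --> kap c i x.
  elim: i => [|i IH] /=; first exact: cvg_cst.
  by apply: lim_div => //; rewrite gt_eqF// slope_gt0.
apply: lim_div.
- by rewrite gt_eqF// !mulr_gt0 ?slope_gt0// oppr_gt0 gS12_lt0.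
- exact: limX.
- apply: limM (sx i); apply: limM; first exact: cvg_cst.
  apply: limN; apply: cont2_cvg; [by have [_ _ _] := gS1_d t|exact: ix|exact: (ix i.+1)].
Qed.

Section RationalLimit.
Variables (c0 M : R) (q : nat) (p : int).
Hypotheses (cM : `|c0| < M) (q0 : (0 < q)%N) (qp : q%:R * rot l c0 = p%:~R).

(** A conjugacy to a translation by p / q turns the q-th iterate into the
    translation by p. *)
Lemma rat_periodic x : iter q (g c0) x = x + p%:~R.
Proof.
have [h H] := rot_conj l cM; have [_ h1 hb _] := H.
have E : h (iter q (g c0) x) = h (x + p%:~R).
  by rewrite (conj_iter _ _ H) (deg1_int h1) qp.
have lt := biLip_lt (lipC_gt0 l M) hb.
have [xy|xy|//] := ltgtP (iter q (g c0) x) (x + p%:~R).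
  by have := lt _ _ xy; rewrite E ltxx.
by have := lt _ _ xy; rewrite E ltxx.
Qed.

Lemma prim_degz c x (k : int) : w c (x + k%:~R) = w c x + k%:~R * c.
Proof.
have H z : (fun z => w c z - z * c) (z + 1) = w c z - z * c by rewrite prim_deg; ring.
by have := per_int H x k; lra.
Qed.

(** The excesses of the leaf of mean c along an orbit of the periodic leaf
    of mean c0 telescope, because the orbit closes up modulo p. The total is
    the same for all orbits. *)
Lemma sum_excess c x :
  \sum_(i <- iota 0 q) excess l c (iter i (g c0) x) (iter i.+1 (g c0) x) =
  q%:R * (al c - al c0) - p%:~R * (c - c0).
Proof.
pose V y := w c y - w c0 y.
have H n : \sum_(i <- iota 0 n) excess l c (iter i (g c0) x) (iter i.+1 (g c0) x) =
   V x - V (iter n (g c0) x) + n%:R * (al c - al c0).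
  elim: n => [|n IH]; first by rewrite big_nil subrr mul0r addr0.
  rewrite -addn1 iotaD big_cat IH /= big_seq1 add0n.
  have := excess_diff l c0 c (iter n (g c0) x) (g c0 (iter n (g c0) x)).
  rewrite excess_dyn subr0 => ->; rewrite -/(V _) natrD -!/(V _) addn1 /=.
  by rewrite /V; ring.
rewrite H rat_periodic /V !prim_degz; ring.
Qed.

(** The common value of the total excess, in units of (c - c0)^2. *)
Definition beta c := (q%:R * (al c - al c0) - p%:~R * (c - c0)) / (c - c0) ^+ 2.

Section AlongU.
Variables (T : Type) (U : set_system T) (c : T -> R).
Hypotheses (UU : UltraFilter U) (cc : c @ U --> c0) (cn : \forall t \near U, c t != c0).

(** Sum [step_excess] over a period: the limit of beta is the square of the
    limiting displacement at x0 times mu. *)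
Lemma rat_beta (x : T -> R) x0 : x @ U --> x0 ->
  exists pi : R, [/\ 0 < pi, (fun t => De c c0 t (x t)) @ U --> pi &
    (fun t => beta (c t)) @ U --> pi ^+ 2 * mu c0 q x0].
Proof.
move=> xx; pose proof (De_bound UU cc cn cM) as Db.
have L0 := lipC_gt0 l M.
have [pi Dpi] : exists pi : R, (fun t => De c c0 t (x t)) @ U --> pi.
  apply: (@bounded_ultra_cvg _ _ _ _ (lipC l M) UU); apply: filterS Db => t0 H.
  have /andP[A B] := H (x t0); rewrite ger0_norm//.
  by apply: le_trans A; rewrite invr_ge0 ltW.
exists pi; split=> //.
  have : (lipC l M)^-1 <= pi.
    by apply: (cvg_ge_cst Dpi); apply: filterS Db => t0 H; have /andP[] := H (x t0).
  by apply: lt_le_trans; rewrite invr_gt0.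
have xi i : (fun t => iter i (g c0) (x t)) @ U --> iter i (g c0) x0.
  by apply: iter_dyn_lim => //; exact: cvg_cst.
have Di i : (fun t => De c c0 t (iter i (g c0) (x t))) @ U --> pi * kap c0 i x0.
  elim: i => [|i IH]; first by rewrite mulr1.
  by have := step_next UU cc cn (xi i) IH; rewrite /= mulrA.
have Ei i := step_excess UU cc cn (xi i) (Di i).
pose proof (lim_sum (r := iota 0 q) Ei) as S.
have -> : pi ^+ 2 * mu c0 q x0 = \sum_(i <- iota 0 q) (pi * kap c0 i x0) ^+ 2 /
   (2 * - s12 (iter i (g c0) x0) (g c0 (iter i (g c0) x0)) * slope l c0 (iter i (g c0) x0)).
  by rewrite /mu big_distrr /=; apply: eq_bigr => i _; rewrite exprMn mulrA.
apply: cvg_eq_near S; near=> t0.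
by rewrite -big_distrl /= sum_excess.
Unshelve. all: by end_near. Qed.

(** As beta does not depend on the orbit, pi^2 mu is constant; so the
    displacement of the leaves is determined at all points by its value at
    one. *)
Lemma rat_De : exists2 A, 0 < A & forall (x : T -> R) x0, x @ U --> x0 ->
  (fun t => De c c0 t (x t)) @ U --> Num.sqrt (A / mu c0 q x0).
Proof.
have [pi [pi0 _ B]] := rat_beta (cvg_cst (0 : R)).
exists (pi ^+ 2 * mu c0 q 0); first by rewrite mulr_gt0 ?exprn_gt0 ?mu_gt0.
move=> x x0 xx; have [pi' [pi'0 D' B']] := rat_beta xx.
by rewrite (cvg_uniq B B') mulfK ?gt_eqF ?mu_gt0// sqrtr_sqr gtr0_norm.
Qed.

(** The limits of the quotients of the leaves, uniform in the base point,
    are the derivatives of the limits of the quotients of the primitives. *)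
Lemma rat_limit : exists h A, [/\ 0 < A, is_conj l c0 (lipC l M) (rot l c0) h,
  forall x, (fun t => dq l c0 (c t) x) @ U --> h x,
  forall (x : T -> R) x0, x @ U --> x0 -> (fun t => De c c0 t (x t)) @ U --> Num.sqrt (A / mu c0 q x0) &
  forall x : R, is_derive x 1 h (Num.sqrt (A / mu c0 q x))].
Proof.
have [h [H hl]] := dq_lim_ne UU cM cc cn.
have [A A0 DA] := rat_De.
exists h, A; split=> // x.
have cP : continuous (fun x => Num.sqrt (A / mu c0 q x)).
  move=> y; have D : (fun x => A / mu c0 q x) @ y --> A / mu c0 q y.
    by apply: lim_div; [rewrite gt_eqF// mu_gt0|exact: cvg_cst|exact: mu_cont].
  exact: (lim_continuous D (@sqrt_continuous _ _)).
have key y z : exists2 u, Num.min y z <= u <= Num.max y z &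
    h z - h y = Num.sqrt (A / mu c0 q u) * (z - y).
  have /choice[xi Hxi] t0 : exists xi, Num.min y z <= xi <= Num.max y z /\
     dq l c0 (c t0) z - dq l c0 (c t0) y = De c c0 t0 xi * (z - y).
    by have [u u1 u2] := MVT_any y z (dq_d l c0 (c t0)); exists u.
  have [u xiu] : exists u : R, xi @ U --> u.
    apply: (@bounded_ultra_cvg _ _ _ _ (`|y| + `|z|) UU); near=> t0.
    have [/andP[a b] _] := Hxi t0.
    have y1 := ler_norm y; have z1 := ler_norm z.
    have y2 := ler_norm (- y); have z2 := ler_norm (- z); rewrite normrN in y2; rewrite normrN in z2.
    have y3 := normr_ge0 y; have z3 := normr_ge0 z.
    by move: a b; rewrite ler_norml; have [yz|yz] := leP y z; lra.
  exists u.
    apply/andP; split.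
      by apply: (cvg_ge_cst xiu); near=> t0; have [/andP[]] := Hxi t0.
    by apply: (cvg_le_cst xiu); near=> t0; have [/andP[]] := Hxi t0.
  pose proof (limB (hl z) (hl y)) as L1.
  pose proof (limM (DA _ _ xiu) (cvg_cst (z - y))) as L2.
  pose proof (cvg_uniq_near L1 L2) as K; apply: K.
  by near=> t0; have [_] := Hxi t0.
apply/is_deriveP.
have k0 : (fun k : R => k) @ 0^' --> 0 by exact: nbhs_dnbhs.
pose proof (limD (cvg_cst x) k0) as xk; rewrite addr0 in xk.
have /choice[u Hu] (k : R) : exists u, Num.min x (x + k) <= u <= Num.max x (x + k) /\
    h (x + k) - h x = Num.sqrt (A / mu c0 q u) * k.
  by have [u u1 u2] := key x (x + k); exists u; split=> //; rewrite u2; ring.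
have ux : u @ 0^' --> x by apply: (cvg_between (cvg_cst x) xk) => k; have [] := Hu k.
pose proof (lim_continuous ux (@cP x)) as L3.
apply: cvg_eq_near L3; near=> k.
have [_ ->] := Hu k; rewrite mulfK//; near: k; exact: nbhs_dnbhs_neq.
Unshelve. all: by end_near. Qed.

End AlongU.

(** The two densities are proportional and have the same integral over a
    period. *)
Lemma rat_unique (h h' : R -> R) (A A' : R) : 0 < A -> 0 < A' -> h 0 = 0 -> h' 0 = 0 -> h 1 = 1 -> h' 1 = 1 ->
  (forall x : R, is_derive x 1 h (Num.sqrt (A / mu c0 q x))) ->
  (forall x : R, is_derive x 1 h' (Num.sqrt (A' / mu c0 q x))) -> A = A' /\ h = h'.
Proof.
move=> A0 A0' h0 h'0 h1 h'1 hd h'd.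
pose k := Num.sqrt (A' / A).
have kd (x : R) : is_derive x 1 (k \*: h) (Num.sqrt (A' / mu c0 q x)).
  have -> : Num.sqrt (A' / mu c0 q x) = k *: Num.sqrt (A / mu c0 q x).
    rewrite /k -[RHS]sqrtrM ?divr_ge0 ?ltW//; congr Num.sqrt.
    by field; rewrite !gt_eqF// mu_gt0.
  by have := hd x => D; exact: is_deriveZ.
have E x : k * h x = h' x.
  by have := eq_antiderivative kd h'd x 0; rewrite /= h0 h'0 ![_ *: _]/GRing.scale /= mulr0 !subr0.
have k1 : k = 1 by have := E 1; rewrite h1 h'1 mulr1.
split; last by apply/funext => x; rewrite -E k1 mul1r.
have : k ^+ 2 = 1 by rewrite k1 expr1n.
rewrite sqr_sqrtr ?divr_ge0 ?ltW// => /(congr1 ( *%R^~ A)).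
by rewrite divfK ?gt_eqF// mul1r.
Qed.

End RationalLimit.
End Rational.

(** * The derivative of the leaves with respect to the mean *)

Section Steps.
Context {R : realType}.
Implicit Types (y z : R).

(** Going from y to beyond z in steps of bounded length along T, f can only
    decrease, and the last step overshoots by at most d. *)
Lemma step_mono (f T : R -> R) (K d dl : R) : 0 <= K -> 0 < dl ->
  (forall y, y + dl <= T y <= y + d) -> (forall y, f (T y) <= f y) ->
  (forall y z, `|f y - f z| <= K * `|y - z|) -> forall y z, y <= z -> f z <= f y + K * d.
Proof.
move=> K0 dl0 HT Hf fK y z yz.
have big n : y + n%:R * dl <= iter n T y.
  elim: n => [|n IH]; first by rewrite mul0r addr0.
  by rewrite iterS; have /andP[A _] := HT (iter n T y); rewrite -natr1; lra.
have ex : exists n, z < iter n T y.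
  have [n Hn] := ex_nat_gt ((z - y) / dl); exists n; apply: lt_le_trans (big n).
  by move: Hn; rewrite ltr_pdivrMr//; lra.
case: (ex_minnP ex) => -[/= zy|n zn Hn]; first by move: zy; rewrite ltNge yz.
have nz : iter n T y <= z by rewrite leNgt; apply/negP => /Hn; rewrite ltnn.
have A : f (iter n T y) <= f y.
  by elim: n {zn Hn nz} => //= n IH; apply: le_trans (Hf _) IH.
have /andP[_ B] := HT (iter n T y); rewrite iterS in zn.
have := fK z (iter n T y); rewrite (ger0_norm (x := z - _)) ?subr_ge0// ler_norml => /andP[_ C].
have : K * (z - iter n T y) <= K * d by rewrite ler_wpM2l//; lra.
by lra.
Qed.

Lemma step_mono_left (f T : R -> R) (K d dl : R) : 0 <= K -> 0 < dl ->
  (forall y, y - d <= T y <= y - dl) -> (forall y, f y <= f (T y)) ->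
  (forall y z, `|f y - f z| <= K * `|y - z|) -> forall y z, y <= z -> f z <= f y + K * d.
Proof.
move=> K0 dl0 HT Hf fK y z yz.
have := @step_mono (fun y => - f (- y)) (fun y => - T (- y)) K d dl K0 dl0 _ _ _ (- z) (- y).
rewrite !opprK lerN2 => H; have {H} : - f y <= - f z + K * d.
  apply: H => //.
  - by move=> u; have := HT (- u); lra.
  - by move=> u; rewrite opprK lerN2.
  - by move=> u v; have := fK (- u) (- v); rewrite -opprD normrN -opprD normrN.
by lra.
Qed.

(** A bound that holds in the limit along every converging family of points
    holds uniformly near the limit: otherwise select bad points in a period
    and pass to the limit. *)
Lemma ultra_unif (T : Type) (U : set_system T) (f : T -> R -> R) (v a : R) :
  UltraFilter U -> (\forall t \near U, forall y, f t (y + 1) = f t y) ->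
  (forall (y : T -> R) y0, y @ U --> y0 -> (fun t => f t (y t)) @ U --> v) -> v < a ->
  \forall t \near U, forall y, f t y < a.
Proof.
move=> UU f1 fl va.
have [//|nP] := ultra_near_or (fun t => forall y, f t y < a) UU.
exfalso.
have /choice[y Hy] t : exists y, 0 <= y <= 1 /\ ((forall y, f t (y + 1) = f t y) ->
    ~ (forall y, f t y < a) -> a <= f t y).
  have [A|nA] := pselect ((forall y, f t (y + 1) = f t y) /\ ~ (forall y, f t y < a)); last first.
    by exists 0; rewrite lexx ler01; split=> // *; exfalso; apply: nA.
  have [A1 /existsNP[y /negP]] := A; rewrite -leNgt => ay.
  have [n n0 n1] := mod1 y; exists (y - n%:~R); rewrite n0 ltW//; split=> // _ _.
  by have := per_int A1 (y - n%:~R) n; rewrite subrK => <-.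
have [y0 yl] : exists y0 : R, y @ U --> y0.
  apply: (@bounded_ultra_cvg _ _ _ _ 1 UU); near=> t.
  by have [/andP[A B] _] := Hy t; rewrite ger0_norm.
have := fl _ _ yl; move=> L1.
suff : a <= v by rewrite leNgt va.
apply: (cvg_ge_cst L1); near=> t.
have [_ H] := Hy t; apply: H; first by near: t.
by near: t; exact: nP.
Unshelve. all: by end_near. Qed.

End Steps.

Section Transverse.
Context {R : realType} (t : twist R) (l : leaves t).
Local Notation s12 := (gS12 t).
Local Notation e := (eta l).
Local Notation w := (prim l).
Local Notation g := (dyn l).
Implicit Types (c x y z M : R).

Lemma not_irr (r : R) : ~ irr r -> exists (q : nat) (p : int), (0 < q)%N /\ q%:R * r = p%:~R.
Proof.
move=> /existsNP[q /existsNP[p]] /not_implyP[q0 /negP]; rewrite negbK => /eqP E.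
by exists q, p.
Qed.

(** In the irrational case every limit is the unique conjugacy; in the
    rational case every limit is given by [rat_limit] and all of them agree
    by [rat_unique]. *)
Lemma dq_conv c0 : exists h p : R -> R, [/\ forall M, `|c0| < M -> is_conj l c0 (lipC l M) (rot l c0) h,
  continuous p, forall x, 0 < p x, forall x : R, is_derive x 1 h (p x) &
  forall (T : Type) (F : set_system T) (c : T -> R), Filter F -> c @ F --> c0 ->
    (\forall t \near F, c t != c0) -> forall x, (fun t => dq l c0 (c t) x) @ F --> h x].
Proof.
have [M0 cM0] : exists M, `|c0| < M by exists (`|c0| + 1); rewrite ltrDl.
have [U [UU U0]] := ultraFilterLemma (@at_right_proper_filter R 0).
have hU : (fun h : R => h) @ U --> 0.
  by move=> A A0; apply: U0; apply: filterS A0 => x Ax _.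
have cU : (fun h : R => c0 + h) @ U --> c0.
  by pose proof (limD (cvg_cst c0) hU) as H; rewrite addr0 in H.
have cn : \forall h \near U, c0 + h != c0.
  by apply: U0; near=> h; rewrite -subr_eq0 addrC addKr gt_eqF.
have [ir|/not_irr[q [p [q0 qp]]]] := pselect (irr (rot l c0)).
  have [h [H hl]] := dq_lim_ne l UU cM0 cU cn.
  have [p [cp p0 pd]] := conj_C1_irr (lipC_gt0 l M0) H ir.
  exists h, p; split=> //.
    move=> M cM; have [h' H'] := rot_conj l cM.
    by rewrite -(conj_unique_irr (lipC_gt0 l M0) H ir (lipC_gt0 l M) H').
  move=> T F c FF cc cn' x; apply: cvg_ultraP => V VV FV.
  have ccV : c @ V --> c0 by move=> A /cc /FV.
  have [h' [H' hl']] := dq_lim_ne l VV cM0 ccV (FV _ cn').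
  by rewrite -(conj_unique_irr (lipC_gt0 l M0) H ir (lipC_gt0 l M0) H').
have [h [A [A0 H hl _ hd]]] := rat_limit cM0 q0 qp UU cU cn.
have [h0 h1 _ _] := H.
have h11 : h 1 = 1 by rewrite -[1 in LHS]add0r h1 h0 add0r.
have U' (T : Type) (V : set_system T) (c : T -> R) M : UltraFilter V -> c @ V --> c0 ->
    (\forall t \near V, c t != c0) -> `|c0| < M ->
    is_conj l c0 (lipC l M) (rot l c0) h /\ forall x, (fun t => dq l c0 (c t) x) @ V --> h x.
  move=> VV cc' cn' cM.
  have [h' [A' [A'0 H' hl' _ hd']]] := rat_limit cM q0 qp VV cc' cn'.
  have [h'0 h'1 _ _] := H'.
  have h'11 : h' 1 = 1 by rewrite -[1 in LHS]add0r h'1 h'0 add0r.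
  by have [_ ->] := rat_unique q0 A0 A'0 h0 h'0 h11 h'11 hd hd'.
exists h, (fun x => Num.sqrt (A / mu l c0 q x)); split=> //.
- by move=> M cM; have [] := U' _ _ _ M UU cU cn cM.
- move=> y; have D : (fun x => A / mu l c0 q x) @ y --> A / mu l c0 q y.
    by apply: lim_div; [rewrite gt_eqF// mu_gt0|exact: cvg_cst|exact: mu_cont].
  exact: (lim_continuous D (@sqrt_continuous _ _)).
- by move=> x; rewrite sqrtr_gt0 divr_gt0// mu_gt0.
- move=> T F c FF cc cn' x; apply: cvg_ultraP => V VV FV.
  have ccV : c @ V --> c0 by move=> B /cc /FV.
  by have [_] := U' _ _ _ M0 VV ccV (FV _ cn') cM0; apply.
Unshelve. all: by end_near. Qed.

(** The distinguished conjugacy from the dynamics on the leaf of mean c to a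
    rotation, characterised as the derivative of prim in c. At rational
    leaves it is one among many conjugacies. *)
Definition hh c : R -> R := projT1 (cid (dq_conv c)).
(** The derivative of [hh]. *)
Definition dens c : R -> R := projT1 (cid (projT2 (cid (dq_conv c)))).

Lemma hh_spec c0 : [/\ forall M, `|c0| < M -> is_conj l c0 (lipC l M) (rot l c0) (hh c0),
  continuous (dens c0), forall x, 0 < dens c0 x, forall x : R, is_derive x 1 (hh c0) (dens c0 x) &
  forall (T : Type) (F : set_system T) (c : T -> R), Filter F -> c @ F --> c0 ->
    (\forall t \near F, c t != c0) -> forall x, (fun t => dq l c0 (c t) x) @ F --> hh c0 x].
Proof. exact: (projT2 (cid (projT2 (cid (dq_conv c0))))). Qed.

Lemma hh_conj c M : `|c| < M -> is_conj l c (lipC l M) (rot l c) (hh c).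
Proof. by case: (hh_spec c) => H _ _ _ _; exact: H. Qed.

Lemma hh_d c x : is_derive x 1 (hh c) (dens c x).
Proof. by case: (hh_spec c). Qed.

Lemma dens_cont c : continuous (dens c).
Proof. by case: (hh_spec c). Qed.

Lemma hh_dq (T : Type) (F : set_system T) {FF : Filter F} (c : T -> R) c0 x :
  c @ F --> c0 -> (\forall t \near F, c t != c0) -> (fun t => dq l c0 (c t) x) @ F --> hh c0 x.
Proof. by case: (hh_spec c0) => _ _ _ _ H cc cn; exact: H. Qed.

Lemma prim_dc c x : is_derive c 1 (fun c => w c x) (hh c x).
Proof.
apply/is_deriveP.
have h0 : (fun h : R => h) @ 0^' --> 0 by exact: nbhs_dnbhs.
have cc : (fun h : R => c + h) @ 0^' --> c.
  by pose proof (limD (cvg_cst c) h0) as H; rewrite addr0 in H.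
have cn : \forall h \near 0^', c + h != c.
  near=> h; rewrite -subr_eq0 addrC addKr; near: h; exact: nbhs_dnbhs_neq.
pose proof (hh_dq (x := x) cc cn) as H.
by apply: cvg_eq_near H; near=> h; rewrite /dq (_ : c + h - c = h)//; ring.
Unshelve. all: by end_near. Qed.

Section RationalContinuity.
Variables (c0 M : R) (q : nat) (p : int).
Hypotheses (cM : `|c0| < M) (q0 : (0 < q)%N) (qp : q%:R * rot l c0 = p%:~R).
Variables (T : Type) (U : set_system T) (c : T -> R).
Hypotheses (UU : UltraFilter U) (cc : c @ U --> c0) (cn : \forall t \near U, c t != c0).
Local Notation H := (hh c0).
Local Notation P := (dens c0).

(** The limit of the quotients of the leaves is the density itself. *)
Let De_dens : exists2 A, 0 < A & (forall x, P x ^+ 2 * mu l c0 q x = A) /\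
  forall (x : T -> R) x0, x @ U --> x0 -> (fun t => De l c c0 t (x t)) @ U --> P x0.
Proof.
have [h [A [A0 hc hl DA hd]]] := rat_limit cM q0 qp UU cc cn.
have hH : h = H by apply/funext => x; exact: (cvg_uniq (hl x) (hh_dq (x := x) cc cn)).
have PE x : P x = Num.sqrt (A / mu l c0 q x).
  have D1 := hh_d c0 x; have D2 := hd x; rewrite hH in D2.
  by have := @derive_val _ _ _ _ _ _ _ D1; rewrite (@derive_val _ _ _ _ _ _ _ D2).
exists A => //; split=> [x|x x0 xx]; last by rewrite PE; exact: DA.
by rewrite PE sqr_sqrtr ?divr_ge0 ?ltW ?mu_gt0// divfK// gt_eqF// mu_gt0.
Qed.

Let Tq t0 y := iter q (g (c t0)) y - p%:~R.

Let Tq1 t0 y : Tq t0 (y + 1) = Tq t0 y + 1.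
Proof. by rewrite /Tq (iter_deg1 q (dyn_deg1 l (c t0))); ring. Qed.

(** Telescope H along q steps of the dynamics of c t: each step gains P
    (x_(i+1)) P (x_i) / b_i to first order, and the sum over a period is 2
    A. *)
Let Dt_lim : exists2 m : R, 0 < m & forall (x : T -> R) x0, x @ U --> x0 ->
  (fun t => (H (Tq t (x t)) - H (x t)) / (c t - c0)) @ U --> m.
Proof.
have [A A0 [PA DP]] := De_dens.
have [_ H1 _ Hg] := hh_conj cM.
exists (2 * A) => [|x x0 xx]; first by rewrite mulr_gt0.
have xi i : (fun t => iter i (g (c t)) (x t)) @ U --> iter i (g c0) x0 by exact: iter_dyn_lim.
have Pg y : P (g c0 y) = P y / slope l c0 y.
  pose proof (DP _ _ (cvg_cst y)) as D1.
  pose proof (step_next UU cc cn (cvg_cst y) D1) as S.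
  pose proof (DP _ _ (cvg_cst (g c0 y))) as D2.
  exact: (cvg_uniq D2 S).
have Pk i : P (iter i (g c0) x0) = P x0 * kap l c0 i x0.
  by elim: i => [|i IH]; rewrite ?mulr1// iterS Pg IH /= mulrA.
have Li i : (fun t => (H (iter i.+1 (g (c t)) (x t)) - H (iter i (g (c t)) (x t)) - rot l c0) / (c t - c0)) @ U
   --> P (iter i.+1 (g c0) x0) * (P (iter i (g c0) x0) / (- s12 (iter i (g c0) x0) (iter i.+1 (g c0) x0))).
  have S := step_dyn UU cc cn (xi i) (DP _ _ (xi i)).
  have g0 : (fun t => g c0 (iter i (g (c t)) (x t))) @ U --> iter i.+1 (g c0) x0.
    by apply: dyn_lim => //; exact: cvg_cst.
  have [be bel E] := mvt_filter (hh_d c0) (@dens_cont c0 _) g0 (xi i.+1).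
  pose proof (limM bel S) as K; apply: cvg_eq_near K; near=> t0.
  have -> : H (iter i.+1 (g (c t0)) (x t0)) - H (iter i (g (c t0)) (x t0)) - rot l c0 =
    H (iter i.+1 (g (c t0)) (x t0)) - H (g c0 (iter i (g (c t0)) (x t0))) by rewrite Hg; ring.
  by rewrite E mulrA.
pose proof (lim_sum (r := iota 0 q) Li) as S.
have -> : 2 * A = \sum_(i <- iota 0 q) P (iter i.+1 (g c0) x0) *
   (P (iter i (g c0) x0) / (- s12 (iter i (g c0) x0) (iter i.+1 (g c0) x0))).
  rewrite -(PA x0) /mu mulrA big_distrr /=; apply: eq_bigr => i _.
  rewrite Pg Pk; have n1 := slope_gt0 l c0 (iter i (g c0) x0).
  have n2 := gS12_lt0 t (iter i (g c0) x0) (g c0 (iter i (g c0) x0)).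
  by field; rewrite (lt0r_neq0 n1) (ltr0_neq0 n2).
apply: cvg_eq_near S; near=> t0.
rewrite -big_distrl /=; congr (_ / _).
have tele n : \sum_(i <- iota 0 n) (H (iter i.+1 (g (c t0)) (x t0)) - H (iter i (g (c t0)) (x t0)) - rot l c0) =
   H (iter n (g (c t0)) (x t0)) - H (x t0) - n%:R * rot l c0.
  elim: n => [|n IH]; first by rewrite big_nil mul0r subrr subr0.
  rewrite -addn1 iotaD big_cat IH /= big_seq1 add0n natrD addn1 /=; ring.
rewrite tele qp /Tq -[in RHS](subrK p%:~R (iter q _ _)) //.
have := deg1_int H1 (iter q (g (c t0)) (x t0) - p%:~R) p; rewrite subrK => ->.
ring.
Unshelve. all: by end_near. Qed.

Let Hstep : exists m : R, [/\ 0 < m, forall (x : T -> R) x0, x @ U --> x0 ->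
  (fun t => (H (Tq t (x t)) - H (x t)) / (c t - c0)) @ U --> m &
  \forall t \near U, forall y, m / 2 < (H (Tq t y) - H y) / (c t - c0) < 2 * m].
Proof.
have [m m0 Hm] := Dt_lim; exists m; split=> //.
have [_ H1 _ _] := hh_conj cM.
have per : \forall t \near U, forall y,
    (H (Tq t (y + 1)) - H (y + 1)) / (c t - c0) = (H (Tq t y) - H y) / (c t - c0).
  by near=> t0 => y; rewrite Tq1 !H1 opprD addrACA subrr addr0.
have per' : \forall t \near U, forall y,
    - ((H (Tq t (y + 1)) - H (y + 1)) / (c t - c0)) = - ((H (Tq t y) - H y) / (c t - c0)).
  by apply: filterS per => t0 E y; rewrite E.
have m2 : m < 2 * m by lra.
have m3 : - m < - (m / 2) by lra.
pose proof (ultra_unif UU per Hm m2) as A.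
pose proof (ultra_unif UU per' (fun (y : T -> R) (y0 : R) yy => limN (Hm y y0 yy)) m3) as B.
near=> t0 => y.
have A0 : forall y, (H (Tq t0 y) - H y) / (c t0 - c0) < 2 * m by near: t0.
have B0 : forall y, - ((H (Tq t0 y) - H y) / (c t0 - c0)) < - (m / 2) by near: t0.
by rewrite A0 andbT -ltrN2.
Unshelve. all: by end_near. Qed.

(** The differences of f t along Tq have the sign of v, uniformly by
    [ultra_unif], and the steps of Tq shrink, so [step_mono] passes to the
    limit. *)
Let mono_lim (f : T -> R -> R) (k : R -> R) (K v : R) : 0 <= K -> v < 0 ->
  (\forall t \near U, forall y z, `|f t y - f t z| <= K * `|y - z|) ->
  (forall t y, f t (Tq t (y + 1)) - f t (y + 1) = f t (Tq t y) - f t y) ->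
  (forall y, (fun t => f t y) @ U --> k y) ->
  (forall (x : T -> R) x0, x @ U --> x0 ->
     (fun t => (f t (Tq t (x t)) - f t (x t)) / (c t - c0)) @ U --> v) ->
  forall y z, y <= z -> k z <= k y.
Proof.
move=> K0 v0 fK f1 fk fv y z yz.
have [m [m0 _ Hm]] := Hstep.
have per : \forall t \near U, forall y,
  (f t (Tq t (y + 1)) - f t (y + 1)) / (c t - c0) = (f t (Tq t y) - f t y) / (c t - c0).
  by near=> t0 => u; rewrite f1.
pose proof (ultra_unif UU per fv v0) as neg.
have L0 := lipC_gt0 l M; set L := lipC l M in L0.
have [_ _ Hb _] := hh_conj cM; rewrite -/L in Hb.
have Hm' := biLip_lt L0 Hb.
have cl : (fun t => K * (L * (2 * m * `|c t - c0|))) @ U --> 0.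
  pose proof (limM (cvg_cst K) (limM (cvg_cst L) (limM (cvg_cst (2 * m))
    (limn (limB cc (cvg_cst c0)))))) as A.
  by rewrite subrr normr0 !mulr0 in A.
pose proof (limD (fk y) cl) as lim; rewrite addr0 in lim.
apply: (cvg_le (fk z) lim); near=> t0.
have C0 : c t0 != c0 by near: t0.
have A1 : forall y, m / 2 < (H (Tq t0 y) - H y) / (c t0 - c0) < 2 * m by near: t0.
have A2 : forall y, (f t0 (Tq t0 y) - f t0 y) / (c t0 - c0) < 0 by near: t0.
have A3 : forall y z, `|f t0 y - f t0 z| <= K * `|y - z| by near: t0.
move: C0; rewrite neq_lt => /orP[lt|gt].
  have d0 : 0 < c0 - c t0 by rewrite subr_gt0.
  have X u : [/\ Tq t0 u <= u, m / 2 * (c0 - c t0) < H u - H (Tq t0 u) &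
     H u - H (Tq t0 u) < 2 * m * (c0 - c t0)].
    have := A1 u; rewrite -(opprB (H u)) -(opprB c0) invrN mulrNN.
    rewrite ltr_pdivlMr// ltr_pdivrMr// => /andP[a b]; split=> //.
    rewrite leNgt; apply/negP => /Hm'; have : 0 < m / 2 * (c0 - c t0) by rewrite mulr_gt0// divr_gt0.
    by lra.
  apply: (@step_mono_left _ _ (Tq t0) K _ (m / 2 * (c0 - c t0) / L)) => //.
  - by rewrite divr_gt0// mulr_gt0// divr_gt0.
  - move=> u; have [a b d] := X u; have /andP[b1 b2] := Hb _ _ a.
    rewrite ltr0_norm ?subr_lt0// opprB.
    have h1 : m / 2 * (c0 - c t0) / L <= u - Tq t0 u.
      by rewrite ler_pdivrMr// [leRHS]mulrC; apply: le_trans b2; exact: ltW.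
    have h2 : u - Tq t0 u <= L * (2 * m * (c0 - c t0)).
      by rewrite -ler_pdivrMl// [leLHS]mulrC; apply: le_trans b1 _; exact: ltW.
    by apply/andP; split; lra.
  - move=> u; have := A2 u; rewrite -(opprB c0) invrN mulrN oppr_lt0 pmulr_lgt0 ?invr_gt0//.
    by rewrite subr_gt0 => /ltW.
have d0 : 0 < c t0 - c0 by rewrite subr_gt0.
have X u : [/\ u <= Tq t0 u, m / 2 * (c t0 - c0) < H (Tq t0 u) - H u &
   H (Tq t0 u) - H u < 2 * m * (c t0 - c0)].
  have := A1 u; rewrite ltr_pdivlMr// ltr_pdivrMr// => /andP[a b]; split=> //.
  rewrite leNgt; apply/negP => /Hm'; have : 0 < m / 2 * (c t0 - c0) by rewrite mulr_gt0// divr_gt0.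
  by lra.
apply: (@step_mono _ _ (Tq t0) K _ (m / 2 * (c t0 - c0) / L)) => //.
- by rewrite divr_gt0// mulr_gt0// divr_gt0.
- move=> u; have [a b d] := X u; have /andP[b1 b2] := Hb _ _ a.
  rewrite gtr0_norm//.
  have h1 : m / 2 * (c t0 - c0) / L <= Tq t0 u - u.
    by rewrite ler_pdivrMr// [leRHS]mulrC; apply: le_trans b2; exact: ltW.
  have h2 : Tq t0 u - u <= L * (2 * m * (c t0 - c0)).
    by rewrite -ler_pdivrMl// [leLHS]mulrC; apply: le_trans b1 _; exact: ltW.
  by apply/andP; split; lra.
- by move=> u; have := A2 u; rewrite pmulr_llt0 ?invr_gt0// subr_lt0 => /ltW.
Unshelve. all: by end_near. Qed.

(** Let k be a limit of hh at leaves tending to the rational leaf c0. The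
    maps Tq = g^q - p of these leaves move all points by the same amount m
    (c - c0) when measured by H, and by a constant when measured by hh (c
    t). For nu slightly above or below the limit a of the ratio, hh - nu H
    is monotone along orbits of Tq, whose steps are short, so that k - nu H
    is monotone in the limit. Letting nu tend to a gives k = a H, and the
    normalisation gives a = 1. *)
Lemma rat_cont (k : R -> R) : is_conj l c0 (lipC l M) (rot l c0) k ->
  (forall x, (fun t => hh (c t) x) @ U --> k x) -> k = H.
Proof.
move=> [k0 k1 _ _] hk.
have [m [m0 Hm _]] := Hstep.
have L0 := lipC_gt0 l M; set L := lipC l M in L0.
have [H0 H1 Hb _] := hh_conj cM; rewrite -/L in Hb.
have nM := dyn_near_M UU cc cM.
pose sg t0 := q%:R * rot l (c t0) - p%:~R.
have hT t0 y : hh (c t0) (Tq t0 y) = hh (c t0) y + sg t0.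
  have cM' : `|c t0| < `|c t0| + 1 by rewrite ltrDl.
  have Hc := hh_conj cM'; have [_ h1 _ _] := Hc.
  have := deg1_int h1 (Tq t0 y) p; rewrite {1}/Tq subrK (conj_iter _ _ Hc) /sg; lra.
have fK nu : \forall t0 \near U, forall y z,
    `|(hh (c t0) y - nu * H y) - (hh (c t0) z - nu * H z)| <= (L + `|nu| * L) * `|y - z|.
  near=> t0 => y z.
  have cM' : `|c t0| < M by near: t0.
  have [_ _ hb _] := hh_conj cM'.
  have -> : hh (c t0) y - nu * H y - (hh (c t0) z - nu * H z) =
    (hh (c t0) y - hh (c t0) z) - nu * (H y - H z) by ring.
  apply: le_trans (ler_normB _ _) _; rewrite mulrDl lerD//; first exact: biLip_lip.
  by rewrite normrM -mulrA ler_wpM2l// biLip_lip.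
have [la lal] : exists la : R, (fun t => sg t / (c t - c0)) @ U --> la.
  pose proof (Hm _ _ (cvg_cst (0 : R))) as D0.
  move/cvgrPdist_lt: D0 => /(_ _ (@ltr01 R)) D0.
  apply: (@bounded_ultra_cvg _ _ _ _ (L * (L * (m + 1))) UU); near=> t0.
  have cM' : `|c t0| < M by near: t0.
  have [_ _ hb _] := hh_conj cM'.
  have C0 : 0 < `|c t0 - c0| by rewrite normr_gt0 subr_eq0; near: t0.
  have E : sg t0 = hh (c t0) (Tq t0 0) - hh (c t0) 0 by rewrite hT; ring.
  have D1 : `|m - (H (Tq t0 0) - H 0) / (c t0 - c0)| < 1 by near: t0.
  rewrite normrM normfV ler_pdivrMr// E.
  apply: le_trans (biLip_lip (Tq t0 0) 0 L0 hb) _; rewrite -mulrA ler_pM2l//.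
  have [ab|ab] := eqVneq (Tq t0 0) 0.
    by rewrite ab subrr normr0 !mulr_ge0// ?addr_ge0 ?ltW.
  have /andP[B _] := biLip_quot Hb ab.
  have : `|Tq t0 0 - 0| <= L * `|H (Tq t0 0) - H 0|.
    rewrite -ler_pdivrMl//; apply: le_trans (_ : _ <= `|(H (Tq t0 0) - H 0) / (Tq t0 0 - 0)| * `|Tq t0 0 - 0|) _.
      by rewrite ler_wpM2r// (le_trans B) ?ler_norm.
    by rewrite -normrM divfK// subr_eq0.
  move=> B2; apply: le_trans B2 _; rewrite -mulrA ler_pM2l//.
  rewrite -ler_pdivrMr// -normfV -normrM.
  have := ler_normB m (m - (H (Tq t0 0) - H 0) / (c t0 - c0)).
  by rewrite subKr (gtr0_norm m0); lra.
have drift nu (x : T -> R) x0 : x @ U --> x0 ->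
    (fun t => ((hh (c t) (Tq t (x t)) - nu * H (Tq t (x t))) - (hh (c t) (x t) - nu * H (x t))) / (c t - c0)) @ U
      --> la - nu * m.
  move=> xx; pose proof (limB lal (limM (cvg_cst nu) (Hm _ _ xx))) as A.
  by apply: cvg_eq_near A; near=> t0; rewrite hT; ring.
have per nu t0 y : hh (c t0) (Tq t0 (y + 1)) - nu * H (Tq t0 (y + 1)) - (hh (c t0) (y + 1) - nu * H (y + 1))
    = hh (c t0) (Tq t0 y) - nu * H (Tq t0 y) - (hh (c t0) y - nu * H y).
  have cM' : `|c t0| < `|c t0| + 1 by rewrite ltrDl.
  by have [_ h1 _ _] := hh_conj cM'; rewrite Tq1 !h1 !H1; ring.
have Kn (nu : R) : 0 <= L + `|nu| * L by rewrite addr_ge0 ?mulr_ge0// ltW.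
have up nu y z : la - nu * m < 0 -> y <= z -> k z - nu * H z <= k y - nu * H y.
  move=> nu0; apply: (@mono_lim (fun t y => hh (c t) y - nu * H y) (fun y => k y - nu * H y) _ _
    (Kn nu) nu0 (fK nu) (per nu)) => [u|x x0]; last exact: drift.
  exact: (limB (hk u) (cvg_cst (nu * H u))).
have down nu y z : 0 < la - nu * m -> y <= z -> nu * H z - k z <= nu * H y - k y.
  rewrite -oppr_lt0 => nu0.
  apply: (@mono_lim (fun t y => nu * H y - hh (c t) y) (fun y => nu * H y - k y) _ _ (Kn nu) nu0).
  - apply: filterS (fK nu) => t0 F y' z'; apply: le_trans (F y' z').
    by rewrite -normrN le_eqVlt; apply/orP; left; apply/eqP; congr `| _ |; ring.
  - by move=> t0 u; have := per nu t0 u; lra.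
  - by move=> u; exact: (limB (cvg_cst (nu * H u)) (hk u)).
  - move=> x x0 xx; pose proof (limN (drift nu x x0 xx)) as A.
    by apply: cvg_eq_near A; near=> t0; rewrite -mulNr; congr (_ / _); ring.
pose a := la / m.
have am : a * m = la by rewrite /a divfK// gt_eqF.
have kE z : 0 <= z -> k z = a * H z.
  move=> z0; have Hz : 0 <= H z by rewrite -H0; apply: (biLip_le L0 Hb).
  apply/eqP; rewrite eq_le; apply/andP; split; apply/ler_addgt0Pl => eps e0.
    have Z : 0 < H z + 1 by rewrite ltr_wpDl.
    have d0 : 0 < eps / (H z + 1) by rewrite divr_gt0.
    have := up (a + eps / (H z + 1)) 0 z; rewrite H0 k0 mulr0 subr0 mulrDl am.
    have nu0 : la - (la + eps / (H z + 1) * m) < 0.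
      by have : 0 < eps / (H z + 1) * m by [rewrite mulr_gt0]; lra.
    move=> /(_ nu0 z0).
    have : eps / (H z + 1) * H z <= eps.
      by rewrite mulrAC ler_pdivrMr// ler_pM2l// lerDl.
    by rewrite mulrDl; lra.
  have Z : 0 < H z + 1 by rewrite ltr_wpDl.
  have d0 : 0 < eps / (H z + 1) by rewrite divr_gt0.
  have := down (a - eps / (H z + 1)) 0 z; rewrite H0 k0 mulr0 subr0 mulrBl am.
  have nu0 : 0 < la - (la - eps / (H z + 1) * m).
    by have : 0 < eps / (H z + 1) * m by [rewrite mulr_gt0]; lra.
  move=> /(_ nu0 z0).
  have : eps / (H z + 1) * H z <= eps.
    by rewrite mulrAC ler_pdivrMr// ler_pM2l// lerDl.
  by rewrite mulrBl; lra.
have a1 : a = 1.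
  have := kE 1 ler01; have := k1 0; have := H1 0.
  by rewrite !add0r k0 H0 !add0r => -> ->; rewrite mulr1.
apply/funext => x; have [n n0 n1] := mod1 x.
have := kE _ n0; rewrite a1 mul1r => E.
have := deg1_int k1 (x - n%:~R) n; have := deg1_int H1 (x - n%:~R) n.
by rewrite subrK E => -> ->.
Unshelve. all: by end_near. Qed.

End RationalContinuity.

(** Limits of hh at varying leaves are conjugacies of the limit leaf. At an
    irrational leaf there is only one; at a rational leaf use [rat_cont]. *)
Lemma hh_cont2 : cont2 hh.
Proof.
move=> [c0 x0] /=; apply: cvg_ultraP => U UU FU.
have f1 : (fun p : R * R => p.1) @ U --> c0 by move=> A A0; apply: FU; exact: cvg_fst A0.
have f2 : (fun p : R * R => p.2) @ U --> x0 by move=> A A0; apply: FU; exact: cvg_snd A0.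
have [M cM] : exists M, `|c0| < M by exists (`|c0| + 1); rewrite ltrDl.
have nM := dyn_near_M UU f1 cM.
have nC : \forall p \near U, is_conj l p.1 (lipC l M) (rot l p.1) (hh p.1).
  by apply: filterS nM => p; exact: hh_conj.
have [k [kc hk _]] := conj_dyn_lim UU cM f1 nC.
have L0 := lipC_gt0 l M.
have lip : \forall p \near U, forall x y, `|hh p.1 x - hh p.1 y| <= lipC l M * `|x - y|.
  by apply: filterS nC => p [_ _ hb _] x y; exact: biLip_lip.
pose proof (lip_lim lip (hk x0) f2) as L1.
suff kE : k = hh c0 by rewrite kE in L1.
have [ir|/not_irr[q [p [q0 qp]]]] := pselect (irr (rot l c0)).
  by have := conj_unique_irr L0 (hh_conj cM) ir L0 kc.
have [ceq|cne] := ultra_near_or (fun p : R * R => p.1 = c0) UU.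
  apply/funext => x; apply: (cvg_uniq (hk x)).
  by apply: (cvg_eq_near _ (cvg_cst (hh c0 x))); apply: filterS ceq => u ->.
have cne' : \forall p \near U, p.1 != c0 by apply: filterS cne => u /eqP.
exact: (rat_cont cM q0 qp UU f1 cne' kc hk).
Qed.

End Transverse.

(** * The covering of the annulus; implicit functions *)

Section Covering.
Context {R : realType}.
Implicit Types (x y z e : R).

Lemma circle_ballP (a b : circle R) e : ball a e b <-> circle_dist a b < e.
Proof. by []. Qed.

Lemma int_dist_wit x : exists k : int, int_dist x = `|x - k%:~R|.
Proof. by eexists. Qed.

Lemma int_dist_norm x : int_dist x <= `|x|.
Proof. by apply: le_trans (int_dist_le x 0) _; rewrite subr0. Qed.

Lemma int_dist_small x : `|x| < 2^-1 -> int_dist x = `|x|.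
Proof.
move=> h; rewrite /int_dist; have -> : Num.floor (x + 2^-1) = 0; last by rewrite subr0.
by apply: floor_def; rewrite add0r; move: h; rewrite ltr_norml => /andP[]; lra.
Qed.

Lemma circle_pi_int x (k : int) : circle_pi (x + k%:~R) = circle_pi x.
Proof. by apply/circle_piP; rewrite addrAC subrr add0r intr_int. Qed.

Lemma circle_pi1 x : circle_pi (x + 1) = circle_pi x.
Proof. exact: (circle_pi_int x 1). Qed.

Lemma circle_pi_eq x y : circle_pi x = circle_pi y -> exists k : int, x = y + k%:~R.
Proof. by move/circle_piP/intrP => [k kE]; exists k; rewrite -kE; ring. Qed.

Lemma circle_pi_cont : continuous (@circle_pi R).
Proof.
move=> x; apply/cvg_ballP => e e0; near=> y.
apply/circle_ballP; rewrite circle_distE; apply: le_lt_trans (int_dist_norm _) _.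
by near: y; apply/nbhs_ballP; exists e.
Unshelve. all: by end_near. Qed.

(** The distance on the circle is realised by suitable lifts. *)
Lemma circle_pi_open x (B : set R) : nbhs x B -> nbhs (circle_pi x) (@circle_pi R @` B).
Proof.
move=> /nbhs_ballP[e /= e0 eB]; apply/nbhs_ballP; exists e => //= b.
rewrite -(circle_reprK b) circle_ballP circle_distE => h.
have [k kE] := int_dist_wit (x - repr b); rewrite kE in h.
exists (repr b + k%:~R); last by rewrite circle_pi_int.
by apply: eB; rewrite /ball/= opprD addrA.
Qed.

Lemma lim_pair (X Y : topologicalType) (T : Type) (F : set_system T) {FF : Filter F}
    (f : T -> X) (g : T -> Y) (a : X) (b : Y) :
  f @ F --> a -> g @ F --> b -> (fun t => (f t, g t)) @ F --> (a, b).
Proof. exact: (cvg_pair (G := nbhs a) (H := nbhs b)). Qed.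

Lemma annulus_pi_cont : continuous (@annulus_pi R).
Proof.
move=> [x r]; rewrite /annulus_pi/=; apply: lim_pair; last exact: cvg_snd.
by apply: (@continuous_comp _ _ _ fst (@circle_pi R)); [exact: cvg_fst|exact: circle_pi_cont].
Qed.

Lemma annulus_pi_open p (B : set (R * R)) :
  nbhs p B -> nbhs (annulus_pi p) (@annulus_pi R @` B).
Proof.
case: p => x r [[B1 B2] /= [b1 b2] b12].
exists (@circle_pi R @` B1, B2); first by split => //; exact: circle_pi_open.
by move=> [_ s] /= [[y y1 <-] s2]; exists (y, s) => //; exact: b12.
Qed.

Lemma annulus_piK (p : annulus R) : annulus_pi (repr p.1, p.2) = p.
Proof. by rewrite /annulus_pi /= circle_reprK; case: p. Qed.

Lemma annulus_pi_ex (p : annulus R) : exists q, annulus_pi q = p.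
Proof. by exists (repr p.1, p.2); exact: annulus_piK. Qed.

(** An open surjection is a quotient map. *)
Lemma quotient_cont (X Y Z : topologicalType) (pi : X -> Y) (f : Y -> Z) :
  (forall (x : X) B, nbhs x B -> nbhs (pi x) (pi @` B)) -> (forall y : Y, exists x : X, pi x = y) ->
  continuous (f \o pi) -> continuous f.
Proof.
move=> po ps fc y A; have [x <-] := ps y => /(fc x) /(po x).
by apply: filterS => _ [z zA <-].
Qed.

Lemma annulus_cont (Z : topologicalType) (f : annulus R -> Z) :
  continuous (f \o @annulus_pi R) -> continuous f.
Proof. exact: quotient_cont annulus_pi_open annulus_pi_ex. Qed.

Lemma circle_cont (Z : topologicalType) (f : circle R -> Z) :
  continuous (f \o @circle_pi R) -> continuous f.
Proof. by apply: quotient_cont circle_pi_open _ => y; exists (repr y); exact: circle_reprK. Qed.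

Lemma circle_compact : compact [set: circle R].
Proof.
have -> : [set: circle R] = @circle_pi R @` `[0, 1].
  apply/seteqP; split=> // b _; have [n n0 n1] := mod1 (repr b).
  exists (repr b - n%:~R); first by rewrite /= in_itv/= n0 ltW.
  by rewrite -(circle_pi_int _ n) subrK circle_reprK.
apply: continuous_compact; last exact: segment_compact.
by apply: continuous_subspaceT => x; exact: circle_pi_cont.
Qed.

Lemma annulus_compact_bound (K : set (annulus R)) : compact K ->
  exists2 M, 0 < M & forall p, K p -> `|p.2| <= M.
Proof.
move=> cK; have : compact (snd @` K).
  by apply: continuous_compact => //; apply: continuous_subspaceT => x; exact: cvg_snd.
move=> /compact_bounded[M [_ hM]]; exists (`|M| + 1); first by rewrite ltr_wpDl.
move=> p Kp; apply: (hM (`|M| + 1)); last by exists p.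
by apply: le_lt_trans (ler_norm M) _; rewrite ltrDl.
Qed.

(** Lifts of the self-maps of the annulus of degree one in the angle. *)
Definition deg1_lift (G : R * R -> R * R) :=
  forall x r, G (x + 1, r) = ((G (x, r)).1 + 1, (G (x, r)).2).

(** The map of the annulus induced by G, evaluated at the canonical lift;
    independent of the lift when G satisfies [deg1_lift]. *)
Definition desc (G : R * R -> R * R) (p : annulus R) : annulus R :=
  annulus_pi (G (repr p.1, p.2)).

Lemma deg1_lift_int G x r (k : int) : deg1_lift G ->
  G (x + k%:~R, r) = ((G (x, r)).1 + k%:~R, (G (x, r)).2).
Proof.
move=> g1; rewrite [LHS]surjective_pairing; congr pair.
  by apply: (deg1_int (f := fun x => (G (x, r)).1)) => y; rewrite g1.
by apply: (per_int (f := fun x => (G (x, r)).2)) => y; rewrite g1.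
Qed.

Lemma descE G q : deg1_lift G -> desc G (annulus_pi q) = annulus_pi (G q).
Proof.
move=> g1; case: q => x r; rewrite /desc /=.
have [k ->] := circle_pi_eq (circle_reprK (circle_pi x)).
by rewrite deg1_lift_int// /annulus_pi /= circle_pi_int.
Qed.

Lemma desc_lift G : deg1_lift G -> continuous G -> is_lift G (desc G).
Proof. by move=> g1 gc; split=> // q; rewrite descE. Qed.

Lemma desc_cont G : deg1_lift G -> continuous G -> continuous (desc G).
Proof.
move=> g1 gc; apply: annulus_cont => q; rewrite /comp.
have -> : (fun x : R * R => desc G (annulus_pi x)) = @annulus_pi R \o G.
  by apply/funext => x; exact: descE.
by apply: continuous_comp; [exact: gc|exact: annulus_pi_cont].
Qed.

Lemma deg1_lift_cancel G H : deg1_lift G -> deg1_lift H -> cancel G H ->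
  cancel (desc G) (desc H).
Proof.
by move=> g1 h1 gh p; have [q <-] := annulus_pi_ex p; rewrite !descE// gh.
Qed.

(** Convex combinations of the identity and G on the universal cover descend
    to the annulus. *)
Lemma desc_homotopic G : deg1_lift G -> continuous G -> homotopic_to_id (desc G).
Proof.
move=> g1 gc; pose L (t : R) (q : R * R) : R * R := ((1 - t) * q.1 + t * (G q).1, (1 - t) * q.2 + t * (G q).2).
have L1 t : deg1_lift (L t).
  by move=> x r; rewrite /L g1 /=; congr pair; ring.
exists (fun t => desc (L t)); split.
- apply: continuous_subspaceT.
  pose pi (z : R * (R * R)) : R * annulus R := (z.1, annulus_pi z.2).
  apply: (@quotient_cont _ _ _ pi).
  + move=> [t q] B [[B1 B2] /= [b1 b2] b12].
    exists (B1, @annulus_pi R @` B2); first by split=> //; exact: annulus_pi_open.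
    by move=> [u _] /= [u1 [q' q2 <-]]; exists (u, q') => //; exact: b12.
  + by move=> [t p]; have [q <-] := annulus_pi_ex p; exists (t, q).
  rewrite (_ : _ \o pi = @annulus_pi R \o (fun w : R * (R * R) => L w.1 w.2)); last first.
    by apply/funext => -[t q]; exact: descE.
  move=> [t q]; apply: continuous_comp; last exact: annulus_pi_cont.
  have G2 : (fun z : R * (R * R) => G z.2) @ (t, q) --> G q.
    by apply: continuous_comp; [exact: cvg_snd|exact: gc].
  have T : (fun z : R * (R * R) => z.1) @ (t, q) --> t by exact: cvg_fst.
  have Q : (fun z : R * (R * R) => z.2) @ (t, q) --> q by exact: cvg_snd.
  have fs : forall q : R * R, {for q, continuous fst} by move=> ?; exact: cvg_fst.
  have ss : forall q : R * R, {for q, continuous snd} by move=> ?; exact: cvg_snd.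
  by apply: lim_pair; apply: limD; apply: limM => //; do ?[apply: limB => //; exact: cvg_cst];
    do ?[exact: (cvg_comp _ _ Q (fs _))]; do ?[exact: (cvg_comp _ _ Q (ss _))];
    do ?[exact: (cvg_comp _ _ G2 (fs _))]; do ?[exact: (cvg_comp _ _ G2 (ss _))].
- move=> p; have [[x r] <-] := annulus_pi_ex p; rewrite descE// /L/=.
  by rewrite subr0 !mul1r !mul0r !addr0.
- move=> p; have [[x r] <-] := annulus_pi_ex p; rewrite !descE// /L/=.
  by rewrite subrr !mul1r !mul0r !add0r -surjective_pairing.
Qed.

End Covering.

Section Implicit.
Context {R : realType}.

Lemma lim_gt (T : Type) (F : set_system T) {FF : Filter F} (f : T -> R) (a b : R) :
  f @ F --> a -> b < a -> \forall t \near F, b < f t.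
Proof. by move=> fa; apply: cvgr_gt. Qed.

(** By monotonicity, f (x t) (a t) is separated from f x0 a0 as long as a t
    is not within e of a0. *)
Lemma implicit_lim (T : Type) (F : set_system T) {FF : Filter F} (f : R -> R -> R)
    (x a : T -> R) (x0 a0 : R) : cont2 f -> (forall x, {homo f x : a b / a < b}) ->
  x @ F --> x0 -> (fun t => f (x t) (a t)) @ F --> f x0 a0 -> a @ F --> a0.
Proof.
move=> fc fi xx ff; apply/cvgrPdist_lt => e e0.
have m (z : R -> R) : {homo z : a b / a < b} -> forall u v, z u < z v -> u < v.
  by move=> zi u v; rewrite !ltNge; apply: contra; rewrite le_eqVlt => /predU1P[->//|/zi/ltW].
have lo : f x0 (a0 - e) < f x0 a0 by apply: fi; lra.
have hi : f x0 a0 < f x0 (a0 + e) by apply: fi; lra.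
pose proof (cont2_cvg fc xx (cvg_cst (a0 - e))) as L.
pose proof (cont2_cvg fc xx (cvg_cst (a0 + e))) as H.
pose proof (limB ff L) as L'; pose proof (limB H ff) as H'.
near=> t.
have h1 : 0 < f (x t) (a t) - f (x t) (a0 - e).
  by near: t; apply: lim_gt L' _; rewrite subr_gt0.
have h2 : 0 < f (x t) (a0 + e) - f (x t) (a t).
  by near: t; apply: lim_gt H' _; rewrite subr_gt0.
rewrite subr_gt0 in h1; rewrite subr_gt0 in h2.
have := m _ (fi _) _ _ h1; have := m _ (fi _) _ _ h2.
by rewrite ltr_norml; lra.
Unshelve. all: by end_near. Qed.

Lemma implicit_cont2 (f k : R -> R -> R) : cont2 f -> (forall x, {homo f x : a b / a < b}) ->
  (forall x r, f x (k x r) = r) -> cont2 k.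
Proof.
move=> fc fi fk [x r]; apply: (@implicit_lim _ _ _ f (fun p => p.1) _ x) => //.
  exact: cvg_fst.
rewrite (_ : (fun t => _) = snd); first by rewrite fk; exact: cvg_snd.
by apply/funext => p; rewrite fk.
Qed.

Lemma pos_partial_incr (f f1 f2 : R -> R -> R) : has_partials f f1 f2 ->
  (forall x y, 0 < f2 x y) -> forall x, {homo f x : a b / a < b}.
Proof.
by move=> [_ d2 _ _] f20 x; apply: (derive_gt0_incr (df := f2 x)) => z.
Qed.

Lemma has_partials_comp (f f1 f2 g g1 g2 h h1 h2 : R -> R -> R) :
  has_partials f f1 f2 -> has_partials g g1 g2 -> has_partials h h1 h2 ->
  has_partials (fun x y => f (g x y) (h x y))
    (fun x y => f1 (g x y) (h x y) * g1 x y + f2 (g x y) (h x y) * h1 x y)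
    (fun x y => f1 (g x y) (h x y) * g2 x y + f2 (g x y) (h x y) * h2 x y).
Proof.
move=> Hf Hg Hh; have gc := has_partials_cont Hg; have hc := has_partials_cont Hh.
have [_ _ f1c f2c] := Hf; have [dg1 dg2 cg1 cg2] := Hg; have [dh1 dh2 ch1 ch2] := Hh.
split=> [x y|x y||].
- exact: (@is_derive_chain2 _ f f1 f2 (fun x => g x y) (fun x => h x y)).
- exact: (@is_derive_chain2 _ f f1 f2 (fun y => g x y) (fun y => h x y)).
- move=> p; apply: limD; apply: limM; first exact: (cont2_comp f1c gc hc);
    [exact: cg1|exact: (cont2_comp f2c gc hc)|exact: ch1].
- move=> p; apply: limD; apply: limM; first exact: (cont2_comp f1c gc hc);
    [exact: cg2|exact: (cont2_comp f2c gc hc)|exact: ch2].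
Qed.

Lemma has_partials_fst : has_partials (fun x _ : R => x) (fun _ _ => 1) (fun _ _ => 0).
Proof.
split=> [x y|x y||]; [exact: is_derive_id|exact: is_derive_cst|..].
  by move=> p; exact: cvg_cst.
by move=> p; exact: cvg_cst.
Qed.

Lemma has_partials_snd : has_partials (fun _ y : R => y) (fun _ _ => 0) (fun _ _ => 1).
Proof. exact: (has_partials_swap has_partials_fst). Qed.

Lemma has_partials_ext (f g f1 g1 f2 g2 : R -> R -> R) :
  (forall x y, f x y = g x y) -> (forall x y, f1 x y = g1 x y) ->
  (forall x y, f2 x y = g2 x y) -> has_partials f f1 f2 -> has_partials g g1 g2.
Proof.
move=> e0 e1 e2.
have -> : g = f by apply/funext => x; apply/funext => y; rewrite e0.
have -> : g1 = f1 by apply/funext => x; apply/funext => y; rewrite e1.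
by have -> : g2 = f2 by apply/funext => x; apply/funext => y; rewrite e2.
Qed.

Lemma implicit_partials (f f1 f2 k : R -> R -> R) : has_partials f f1 f2 ->
  (forall x y, 0 < f2 x y) -> (forall x r, f x (k x r) = r) ->
  has_partials k (fun x r => - f1 x (k x r) / f2 x (k x r)) (fun x r => (f2 x (k x r))^-1).
Proof.
move=> Hf f20 fk; have fc := has_partials_cont Hf.
have kc : cont2 k := implicit_cont2 fc (pos_partial_incr Hf f20) fk.
have n0 x y : f2 x y != 0 by rewrite gt_eqF.
have [_ _ f1c f2c] := Hf.
have kdx x r : (fun y => k y r) @ x --> k x r by exact: (cont2_2 (y := r) kc).
have h0 : (fun h : R => h) @ 0^' --> (0 : R) by move=> A A0; apply: nbhs_dnbhs.
have sh (x : R) : (fun h : R => x + h) @ 0^' --> x.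
  by pose proof (limD (cvg_cst x) h0) as A; rewrite addr0 in A.
have kd2 (x : R) : continuous (k x) by exact: cont2_1.
have c2 (g : R -> R -> R) : cont2 g -> cont2 (fun x r => g x (k x r)).
  by move=> gc; exact: (cont2_comp gc cont2_fst kc).
split=> [x r|x r||].
- apply/is_deriveP.
  have kl : (fun h => k (x + h) r) @ 0^' --> k x r by exact: (cvg_comp _ _ (sh x) (kdx x r)).
  pose proof (partials_slope Hf (cvg_cst x) (sh x) (cvg_cst (k x r)) kl) as [a [b [al bl ab]]].
  pose proof (lim_div (n0 _ _) (limN al) bl) as A.
  apply: cvg_eq_near A; near=> h.
  have hn : h != 0 by near: h; exact: nbhs_dnbhs_neq.
  have := ab h; rewrite !fk subrr addrAC subrr add0r => E.
  have bn : b h != 0.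
    by rewrite gt_eqF//; near: h; exact: lim_gt bl (f20 _ _).
  by apply/eqP; rewrite eqr_div//; apply/eqP; lra.
- apply/is_deriveP.
  have kl : (fun h => k x (r + h)) @ 0^' --> k x r by exact: (cvg_comp _ _ (sh r) (kd2 x r)).
  pose proof (partials_slope Hf (cvg_cst x) (cvg_cst x) (cvg_cst (k x r)) kl) as [a [b [al bl ab]]].
  pose proof (limV (n0 _ _) bl) as A.
  apply: cvg_eq_near A; near=> h.
  have hn : h != 0 by near: h; exact: nbhs_dnbhs_neq.
  have := ab h; rewrite !fk subrr mulr0 add0r addrAC subrr add0r => E.
  have bn : b h != 0.
    by rewrite gt_eqF//; near: h; exact: lim_gt bl (f20 _ _).
  by apply/eqP; rewrite eq_sym -[X in _ == X]div1r eqr_div//; apply/eqP; lra.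
- by move=> p; apply: lim_div; [exact: n0|apply: limN; exact: (c2 _ f1c p)|exact: (c2 _ f2c p)].
- by move=> p; apply: limV; [exact: n0|exact: (c2 _ f2c p)].
Unshelve. all: by end_near. Qed.

Lemma C1_pair (V : normedModType R) (f g : V -> R) : C1 f -> C1 g ->
  C1 (fun v => (f v, g v)).
Proof.
move=> [df cf] [dg cg]; split=> [x|v].
  exact: differentiable_pair.
have -> : (fun x => 'D_v (fun v => (f v, g v)) x) = (fun x => ('D_v f x, 'D_v g x)).
  apply/funext => x; rewrite !deriveE//; last exact: differentiable_pair.
  by rewrite diff_pair.
by move=> x; apply: lim_pair; [exact: cf|exact: cg].
Qed.

(** Uniform continuity on compact sets, by extracting limits of a sequence
    of counterexamples. *)
Lemma cont2_unif (f : R -> R -> R) (M e : R) : cont2 f -> 0 < e -> exists2 d, 0 < d &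
  forall x y y', `|x| <= M -> `|y| <= M -> `|y' - y| < d -> `|f x y' - f x y| < e.
Proof.
move=> fc e0; apply/not_exists2P => H.
have w (n : nat) : exists z : R * R * R, [/\ `|z.1.1| <= M, `|z.1.2| <= M,
    `|z.2 - z.1.2| < n.+1%:R^-1 & e <= `|f z.1.1 z.2 - f z.1.1 z.1.2|].
  case: (H n.+1%:R^-1) => [|h]; first by rewrite invr_gt0.
  apply: contrapT => h'; apply: h => x y y' xM yM yy.
  by rewrite ltNge; apply/negP => fe; apply: h'; exists (x, y, y').
have {}w := choice w; case: w => z zP.
have [U [UU FU]] := ultraFilterLemma (@eventually_filter).
have [x xl] : exists l : R, (fun n => (z n).1.1) @ U --> l.
  by apply: (bounded_ultra_cvg (M := M)); near=> n; have [] := zP n.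
have [y yl] : exists l : R, (fun n => (z n).1.2) @ U --> l.
  by apply: (bounded_ultra_cvg (M := M)); near=> n; have [] := zP n.
have y'l : (fun n => (z n).2) @ U --> y.
  have d0 : (fun n => (z n).2 - (z n).1.2) @ U --> (0 : R).
    apply: (cvg_abs0 (g := fun n => n.+1%:R^-1)).
      by near=> n; rewrite subr0; have [_ _ /ltW] := zP n.
    by move=> A nA; exact: FU (@cvg_harmonic R A nA).
  pose proof (limD d0 yl) as A; rewrite add0r in A; apply: cvg_eq_near A; near=> n; ring.
pose proof (limn (limB (cont2_cvg fc xl y'l) (cont2_cvg fc xl yl))) as lim0; rewrite subrr normr0 in lim0.
have := cvg_ge_cst (b := e) lim0; rewrite leNgt e0 => h; suff: false by [].
by apply: h; near=> n; have [] := zP n.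
Unshelve. all: by end_near. Qed.

End Implicit.

(** * From generating functions and foliations to twists and leaves *)

Section TwistOfMap.
Context {R : realType}.
Implicit Types (x y r : R).

(** Chain rule for the composition with the inverse. *)
Lemma diffeo_deriv_neq0 (g dg : R -> R) x : C1_diffeo g -> is_derive x 1 g (dg x) -> dg x != 0.
Proof.
move=> [h [[dfg _] [dfh _] gh _]] Dg; apply/eqP => g0.
have Dh : is_derive (g x) 1 h ('D_1 h (g x)) by apply: derivableP; apply: diff_derivable.
have := @is_derive1_comp R h g x _ _ Dh Dg; rewrite g0 mulr0 => D0.
have hg : h \o g = id by apply/funext => z; exact: gh.
rewrite hg in D0.
have := @derive_val _ _ _ _ _ _ _ D0; rewrite derive_id => /eqP.
by rewrite oner_eq0.
Qed.

Lemma decreasing_deriv_le0 (g : R -> R) (d x : R) : {homo g : x y /~ x < y} ->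
  is_derive x 1 g d -> d <= 0.
Proof.
move=> gd /is_deriveP Dg; apply: (cvg_le_cst Dg); near=> h.
have h0 : h != 0 by near: h; exact: nbhs_dnbhs_neq.
case: (ltgtP h 0) h0 => // hh _.
  have : g x < g (x + h) by apply: gd; lra.
  by move=> ?; rewrite mulr_ge0_le0// ?invr_le0 ?ltW// subr_gt0.
have : g (x + h) < g x by apply: gd; lra.
by move=> ?; rewrite mulr_le0_ge0// ?invr_ge0 ?ltW// subr_lt0.
Unshelve. all: by end_near. Qed.

(** Strict negativity of the mixed derivative comes from the C^1 inverse of
    Theta |-> dS/dtheta. *)
Lemma twist_ex (F : R * R -> R * R) (S : R * R -> R) : continuous F -> generating_function F S ->
  exists t : twist R, [/\ forall x y, gS t x y = S (x, y),
    forall x y, gS1 t x y = partial1 S (x, y),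
    forall x y, gS2 t x y = partial2 S (x, y) &
    forall x r, F (x, r) = (gF t x r, gS2 t x (gF t x r))].
Proof.
move=> Fc [[CS CD] Sper _ [dec2 dec1] SF].
have H0 := C1_has_partials CS.
have C1S : C1 (partial1 S) by exact: (CD (1, 0)).
have C2S : C1 (partial2 S) by exact: (CD (0, 1)).
have H1 := C1_has_partials C1S.
have H2 := C1_has_partials C2S.
have sw := schwarz H0 H1 H2.
have H2' : has_partials (fun x y => partial2 S (x, y))
    (fun x y => partial2 (partial1 S) (x, y)) (fun x y => partial2 (partial2 S) (x, y)).
  apply: has_partials_ext H2 => x y; first by [].
    by rewrite sw.
  by [].
have neg x y : partial2 (partial1 S) (x, y) < 0.
  have [_ D _ _] := H1; have [df dd] := dec1 x.
  rewrite lt_neqAle (decreasing_deriv_le0 dd (D x y)) andbT.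
  exact: (@diffeo_deriv_neq0 _ (fun y => partial2 (partial1 S) (x, y)) y df (D x y)).
have Fp x r y : (F (x, r)).1 = y <-> r = - partial1 S (x, y).
  split=> [<-|rE].
    by have [/(_ _)[]] := SF x r (F (x, r)).1 (F (x, r)).2; first exact: surjective_pairing.
  have [_ /(_ _)] := SF x r y (partial2 S (x, y)).
  by move=> /(_ (conj rE erefl)) ->.
have cF : cont2 (fun x r => (F (x, r)).1).
  move=> p; rewrite (_ : (fun p => _) = fst \o F); last by apply/funext => -[].
  by apply: continuous_comp; [exact: Fc|exact: cvg_fst].
exists (Twist H0 H1 H2' Sper neg cF Fp); split=> //= x r.
by rewrite [LHS]surjective_pairing; have [/(_ (surjective_pairing _))[_ <-]] := SF x r (F (x, r)).1 (F (x, r)).2.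
Qed.

End TwistOfMap.

Section Foliation.
Context {R : realType} (t : twist R) (f : annulus R -> annulus R) (F : R * R -> R * R)
  (E0 : R -> circle R -> R).
Hypotheses (FP : forall x r, F (x, r) = (gF t x r, gS2 t x (gF t x r)))
  (Ff : forall p, annulus_pi (F p) = f (annulus_pi p)) (fol : lipschitz_foliation f E0).
Implicit Types (a b c x y r K M B L : R).

Let E a x := E0 a (circle_pi x).

Lemma IVT_any (h : R -> R) (x y v : R) : continuous h -> h x <= v <= h y -> exists z, h z = v.
Proof.
move=> hc /andP[xv vy]; have [xy|/ltW yx] := leP x y.
  by have [|z _ zE] := @cont_IVT R h x y v hc xy; [apply/andP|exists z].
have [|||z _ zE] := @cont_IVT R (fun z => - h z) y x (- v); last by exists z; apply: oppr_inj.
- by move=> z; apply: limN; exact: hc.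
- by [].
- by rewrite !lerN2 vy.
Qed.

Lemma fol_cont2 : cont2 E.
Proof.
have [_ [h [chc _ _ _]] _ _] := fol; move=> [a x].
have sc : {for (x, a) : R * R, continuous (snd \o ((fun p : annulus R => (p.1, E0 p.2 p.1) : annulus R) \o @annulus_pi R))}.
  apply: continuous_comp; last exact: cvg_snd.
  by apply: continuous_comp; [exact: annulus_pi_cont|exact: chc].
apply: (cvg_comp (fun p : R * R => (p.2, p.1)) _ _ sc).
by apply: lim_pair; [exact: cvg_snd|exact: cvg_fst].
Qed.

Lemma fol_per a x : E a (x + 1) = E a x.
Proof. by rewrite /E circle_pi1. Qed.

Lemma fol_inj a b x : E a x = E b x -> a = b.
Proof.
have [_ [h [_ _ ch _]] _ _] := fol => ab.
have := ch (circle_pi x, a); rewrite /= -/(E a x) ab.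
by have := ch (circle_pi x, b); rewrite /= -/(E b x) => -> [].
Qed.

Lemma fol_onto x r : exists a, E a x = r.
Proof.
have [_ [h [_ _ _ hc]] _ _] := fol.
have := hc (circle_pi x, r); case: (h _) => y a /= [yx ar].
by exists a; rewrite /E -yx.
Qed.

(** The inverse of the chart is continuous, so it maps the compact set |r|
    <= K to a compact set. *)
Lemma fol_proper K : exists B, forall a x, `|E a x| <= K -> `|a| <= B.
Proof.
have [_ [h [_ hcont ch _]] _ _] := fol.
have cK : compact ([set: circle R] `*` `[- K, K]).
  by apply: compact_setX; [exact: circle_compact|exact: segment_compact].
have cI : compact (h @` ([set: circle R] `*` `[- K, K])).
  by apply: continuous_compact => //; apply: continuous_subspaceT => p; exact: hcont.
have [B _ hB] := annulus_compact_bound cI; exists B => a x aK.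
have := ch (circle_pi x, a); rewrite /= => hE.
suff : `|(h (circle_pi x, E a x)).2| <= B by rewrite /E hE.
apply: hB; exists (circle_pi x, E a x) => //; split=> //=.
by rewrite in_itv/=; move: aK; rewrite ler_norml.
Qed.

(** A sequence of counterexamples has a limit (x, a, b). If a = b it
    contradicts the local bi-Lipschitz condition at (x, a); if not, both
    differences have nonzero limits. *)
Lemma fol_unif B : exists2 L, 0 < L & forall x a b, `|a| <= B -> `|b| <= B ->
  `|b - a| <= L * `|E b x - E a x| /\ `|E b x - E a x| <= L * `|b - a|.
Proof.
apply/not_exists2P => H.
pose bad (n : nat) (z : R * R * R) :=
  ~ (`|z.2 - z.1.2| <= n.+1%:R * `|E z.2 z.1.1 - E z.1.2 z.1.1| /\
     `|E z.2 z.1.1 - E z.1.2 z.1.1| <= n.+1%:R * `|z.2 - z.1.2|).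
have w (n : nat) : exists z : R * R * R, [/\ 0 <= z.1.1 <= 1, `|z.1.2| <= B, `|z.2| <= B & bad n z].
  case: (H n.+1%:R) => [|h]; first by rewrite ltr0Sn.
  apply: contrapT => h'; apply: h => x a b aB bB.
  have [k k0 k1] := mod1 x; apply: contrapT => hb; apply: h'.
  exists (x - k%:~R, a, b); split=> //=; first by rewrite k0 ltW.
  by rewrite /bad /= /E -(circle_pi_int (x - k%:~R) k) subrK.
have {}w := choice w; case: w => z zP.
have [U [UU FU]] := ultraFilterLemma (@eventually_filter).
have [x xl] : exists l : R, (fun n => (z n).1.1) @ U --> l.
  apply: (bounded_ultra_cvg (M := 1)); near=> n; have [/andP[h0 h1] _ _ _] := zP n.
  by rewrite ger0_norm.
have [a al] : exists l : R, (fun n => (z n).1.2) @ U --> l.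
  by apply: (bounded_ultra_cvg (M := B)); near=> n; have [] := zP n.
have [b bl] : exists l : R, (fun n => (z n).2) @ U --> l.
  by apply: (bounded_ultra_cvg (M := B)); near=> n; have [] := zP n.
have nK (K : R) : \forall n \near U, K < n.+1%:R :> R.
  apply: FU; near=> n; apply: (@lt_le_trans _ _ n%:R); last by rewrite ler_nat.
  by near: n; exact: nbhs_infty_gtr.
suff : \forall n \near U, ~ bad n (z n).
  by move=> hh; apply: (@filter_not_empty _ U); apply: filterS hh => n; have [_ _ _] := zP n.
have [ab|ab] := eqVneq a b.
  subst b; have [_ _ lb _] := fol; have [L [V Vp hV]] := lb (annulus_pi (x, a)).
  have v1 : \forall n \near U, V (annulus_pi ((z n).1.1, (z n).1.2)).
    exact: (cvg_comp _ _ (lim_pair xl al) (@annulus_pi_cont R (x, a))) Vp.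
  have v2 : \forall n \near U, V (annulus_pi ((z n).1.1, (z n).2)).
    exact: (cvg_comp _ _ (lim_pair xl bl) (@annulus_pi_cont R (x, a))) Vp.
  near=> n; case=> /=.
  have V1 : V (annulus_pi ((z n).1.1, (z n).1.2)) by near: n.
  have V2 : V (annulus_pi ((z n).1.1, (z n).2)) by near: n.
  have Ln : L < n.+1%:R by near: n; exact: nK.
  have := hV _ _ V2 V1; rewrite /annulus_dist /= circle_distE subrr.
  have -> : int_dist (0 : R) = 0 by rewrite int_dist_small ?normr0.
  rewrite /E !(max_idPr (normr_ge0 _)) => -[h1 h2].
  by split; [apply: le_trans h2 _|apply: le_trans h1 _]; rewrite ler_wpM2r// ltW.
have d1 : 0 < `|b - a| by rewrite normr_gt0 subr_eq0 eq_sym.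
have d2 : 0 < `|E b x - E a x|.
  by rewrite normr_gt0 subr_eq0; apply: contra ab => /eqP/fol_inj->.
pose proof (limn (limB bl al)) as l1.
pose proof (limn (limB (cont2_cvg fol_cont2 bl xl) (cont2_cvg fol_cont2 al xl))) as l2.
near=> n; case=> /=.
have A1 : `|b - a| / 2 < `|(z n).2 - (z n).1.2| by near: n; apply: lim_gt l1 _; lra.
have A2 : `|E b x - E a x| / 2 < `|E (z n).2 (z n).1.1 - E (z n).1.2 (z n).1.1|.
  by near: n; apply: lim_gt l2 _; lra.
have A3 : `|(z n).2 - (z n).1.2| < `|b - a| + 1.
  by near: n; apply: cvgr_lt l1 _ _; lra.
have A4 : `|E (z n).2 (z n).1.1 - E (z n).1.2 (z n).1.1| < `|E b x - E a x| + 1.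
  by near: n; apply: cvgr_lt l2 _ _; lra.
have N1 : (`|b - a| + 1) / (`|E b x - E a x| / 2) < n.+1%:R by near: n; exact: nK.
have N2 : (`|E b x - E a x| + 1) / (`|b - a| / 2) < n.+1%:R by near: n; exact: nK.
rewrite ltr_pdivrMr ?divr_gt0// in N1; rewrite ltr_pdivrMr ?divr_gt0// in N2.
split; [apply/ltW/(lt_trans A3)/(lt_trans N1)|apply/ltW/(lt_trans A4)/(lt_trans N2)];
  by rewrite ltr_pM2l// ltr0Sn.
Unshelve. all: by end_near. Qed.

Let WP := choice (fun a => let: ex_intro2 W W0 Wd := antiderivative (cont2_1 (x := a) fol_cont2) in
  ex_intro (fun W : R -> R => W 0 = 0 /\ forall x : R, is_derive x 1 W (E a x)) W (conj W0 Wd)).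
Let W := projT1 WP.
Let W0 a : W a 0 = 0. Proof. by have [] := projT2 WP a. Qed.
Let Wd a x : is_derive x 1 (W a) (E a x). Proof. by have [] := projT2 WP a. Qed.
Let C a := W a 1.

Let C_mean a b : exists x, C b - C a = E b x - E a x.
Proof.
have D (x : R) : is_derive x 1 (fun x => W b x - W a x) (E b x - E a x) by apply: is_deriveB.
have [x _ xE] := MVT_lt ltr01 D; exists x.
by move: xE; rewrite !W0 !subr0 mulr1 => <-.
Qed.

Let C_mean1 a : exists x, C a = E a x.
Proof.
have [x _ xE] := MVT_lt ltr01 (Wd a); exists x.
by move: xE; rewrite !W0 !subr0 mulr1 => <-.
Qed.

Let C_inj a b : C a = C b -> a = b.
Proof.
move=> ab; have [x xE] := C_mean a b; apply: (@fol_inj a b x).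
by apply/esym/subr0_eq; rewrite -xE ab subrr.
Qed.

(** Two leaves never cross, so they compare everywhere as at the point given
    by the mean. *)
Let C_lt a b : C a < C b -> forall x, E a x < E b x.
Proof.
move=> ab x; have [y yE] := C_mean a b; rewrite ltNge; apply/negP => ba.
have [||z zE] := @IVT_any (fun x => E b x - E a x) x y 0.
- by move=> z; apply: limB; exact: (cont2_1 fol_cont2).
- by rewrite subr_le0 ba -yE subr_ge0 ltW.
by move: ab; rewrite (fol_inj (subr0_eq zE)) ltxx.
Qed.

Let C_cont : continuous C.
Proof.
move=> a; have [L L0 hL] := fol_unif (`|a| + 1).
apply: (cvg_abs0 (g := fun b => L * `|b - a|)).
  near=> b; have [x ->] := C_mean a b.
  have ba : `|b - a| < 1 by near: b; apply/nbhs_ballP; exists 1 => //= b; rewrite /ball/= distrC.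
  have [||_ //] := hL x a b; first by rewrite lerDl.
  by have := ler_normD (b - a) a; rewrite subrK; lra.
have id_a : id @ a --> a by exact: cvg_id.
pose proof (limM (cvg_cst L) (limn (limB id_a (cvg_cst a)))) as A.
by rewrite subrr normr0 mulr0 in A.
Unshelve. all: by end_near. Qed.

(** By properness a leaf with large index avoids the band |r| <= K, and it
    lies above or below it according to its value at 0. *)
Lemma fol_big K : exists a b, (forall x, K < E a x) /\ (forall x, E b x < - K).
Proof.
have [B hB] := fol_proper `|K|; have [L L0 hL] := fol_unif `|B|.
pose r := `|K| + (`|E 0 0| + L * `|B|) + 1.
have r0 : 0 <= L * `|B| by rewrite mulr_ge0// ltW.
have big a x : `|E a 0| = r -> `|K| < `|E a x|.
  move=> ar; rewrite ltNge; apply/negP => /hB aB.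
  have aB' : `|a| <= `|B| := le_trans aB (ler_norm B).
  have [||_] := hL 0 0 a => //; first by rewrite normr0.
  rewrite subr0 => h.
  have := ler_normD (E a 0 - E 0 0) (E 0 0); rewrite subrK ar.
  have : L * `|a| <= L * `|B| by rewrite ler_pM2l.
  by have := normr_ge0 K; rewrite /r; lra.
have r1 : `|K| < r by rewrite /r; have := normr_ge0 (E 0 0); lra.
have rp : 0 < r by apply: le_lt_trans r1.
have [a aE] := fol_onto 0 r; have [b bE] := fol_onto 0 (- r).
have Kn := ler_norm K; have cE d : continuous (E d) by exact: (cont2_1 fol_cont2).
exists a, b; split=> x.
- have := big a x; rewrite aE gtr0_norm// => /(_ erefl).
  rewrite lter_normr => /orP[|h]; first lra.
  have [|y yE] := @IVT_any (E a) x 0 0 (cE a); first by rewrite aE; have := normr_ge0 K; lra.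
  by have := big a y; rewrite aE yE normr0 gtr0_norm// => /(_ erefl); have := normr_ge0 K; lra.
- have := big b x; rewrite bE normrN gtr0_norm// => /(_ erefl).
  rewrite lter_normr => /orP[h|]; last lra.
  have [|y yE] := @IVT_any (E b) 0 x 0 (cE b); first by rewrite bE; have := normr_ge0 K; lra.
  by have := big b y; rewrite bE yE normr0 normrN gtr0_norm// => /(_ erefl); have := normr_ge0 K; lra.
Qed.

Let C_onto c : exists a, C a = c.
Proof.
have [a [b [ha hb]]] := fol_big `|c|.
have [x xE] := C_mean1 a; have [y yE] := C_mean1 b.
apply: (IVT_any (x := b) (y := a) C_cont); rewrite xE yE.
have := ha x; have := hb y; have := ler_norm c; have := ler_norm (- c); rewrite normrN; lra.
Qed.

Let AP := choice C_onto.
Let A := projT1 AP.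
Let CA c : C (A c) = c. Proof. exact: (projT2 AP). Qed.

(** Reindex the leaves by their mean C a. Two means differ by the difference
    of the leaves at some point, so C is injective, locally bi-Lipschitz,
    and leaves are ordered as their means; it is onto since leaves escape to
    both ends of the annulus. *)
Lemma foliation_leaves : exists (l : leaves t) (a : R -> R),
  (forall c x, eta l c x = E0 (a c) (circle_pi x)) /\ (forall b, exists c, a c = b).
Proof.
have ep c x : E (A c) (x + 1) = E (A c) x by exact: fol_per.
have ec c : continuous (E (A c)) by exact: (cont2_1 fol_cont2).
have ei c x : gS2 t x (gF t x (E (A c) x)) = E (A c) (gF t x (E (A c) x)).
  have [_ _ _ inv] := fol.
  have : (f @` leaf (E0 (A c))) (annulus_pi (F (x, E (A c) x))).
    by rewrite Ff; exists (annulus_pi (x, E (A c) x)).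
  by rewrite inv FP.
have el M : exists2 L, 0 < L & forall c c' x, - M <= c -> c <= c' -> c' <= M ->
    (c' - c) / L <= E (A c') x - E (A c) x <= L * (c' - c).
  have [B hB] := fol_proper M; have [L L0 hL] := fol_unif B.
  exists (L * L); first by rewrite mulr_gt0.
  move=> c c' x Mc cc' c'M.
  have AB d : - M <= d -> d <= M -> `|A d| <= B.
    move=> d1 d2; have [y yE] := C_mean1 (A d); apply: (hB _ y).
    by rewrite -yE CA ler_norml d1.
  have A1 : `|A c| <= B by apply: AB => //; lra.
  have A2 : `|A c'| <= B by apply: AB => //; lra.
  have [y] := C_mean (A c) (A c'); rewrite !CA => yE.
  have [h1 h2] := hL y _ _ A1 A2; have [h3 h4] := hL x _ _ A1 A2.
  have cc0 : 0 <= c' - c by rewrite subr_ge0.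
  rewrite -yE (ger0_norm cc0) in h1 h2.
  have p : 0 <= E (A c') x - E (A c) x.
    rewrite subr_ge0; move: cc'; rewrite le_eqVlt => /predU1P[->//|cc'].
    by apply/ltW/C_lt; rewrite !CA.
  rewrite (ger0_norm p) in h3 h4.
  rewrite ler_pdivrMr ?mulr_gt0//; apply/andP; split.
    by apply: le_trans h2 _; rewrite [leRHS]mulrC -mulrA ler_pM2l.
  by apply: le_trans h4 _; rewrite -mulrA ler_pM2l.
have eo x r : exists c, E (A c) x = r.
  by have [a aE] := fol_onto x r; exists (C a); rewrite -aE; congr (E _ x); apply: C_inj; rewrite CA.
exists (@Leaves R t (fun c => E (A c)) (fun c => W (A c)) ep ec (fun c => Wd (A c))
  (fun c => W0 (A c)) CA ei el eo), A; split=> // b.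
by exists (C b); apply: C_inj; rewrite CA.
Qed.

End Foliation.

(** * Regularity of the weak K.A.M. solutions of a foliation *)

Section Regular.
Context {R : realType}.
Implicit Types (x y c r M : R).

Lemma partial1_is_derive (Phi : R * R -> R) x y (d : R) :
  is_derive x 1 (fun x => Phi (x, y)) d ->
  derivable Phi (x, y) ((1, 0) : R * R) /\ partial1 Phi (x, y) = d.
Proof.
move=> /is_deriveP H; rewrite /derivable /partial1 /derive.
set G := fun h => h^-1 *: _.
have GE : (fun h => (Phi (x + h, y) - Phi (x, y)) / h) = G.
  apply/funext => h; rewrite /G /= [RHS]mulrC; congr (_ / _); congr (Phi _ - _).
  by congr pair; rewrite /= ?[h *: 1]mulr1 ?[h *: 0]mulr0 ?add0r// addrC.
rewrite GE in H; split; first by apply/cvg_ex; exists d; exact: H.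
exact: (cvg_lim (@Rhausdorff R) H).
Qed.

Lemma weak_KAM_ineq (S : R * R -> R) (c : R) (u : circle R -> R) : weak_KAM_solution S c u ->
  let v x := u (circle_pi x) in
  [/\ continuous v, forall x, v (x + 1) = v x & exists a : R,
    (forall x y, v y <= v x + S (x, y) + c * (x - y) + a) /\
    (forall y eps, 0 < eps -> exists x, v x + S (x, y) + c * (x - y) + a < v y + eps)].
Proof.
move=> [uc [a ua]] v; split=> [x|x|].
- by apply: continuous_comp; [exact: circle_pi_cont|exact: uc].
- by rewrite /v circle_pi1.
exists a; split=> [x y|y eps e0].
  by rewrite -lee_fin /v ua; apply: ereal_inf_lbound; exists x.
have := ua y; set A := [set _ | _ in _] => uy.
have [|_ [x _ <-]] := @lb_ereal_inf_adherent R A eps e0; first by rewrite -uy.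
by rewrite -uy => h; exists x.
Qed.

Variables (t : twist R) (l : leaves t).

(** The derivative of eta c in x, from eta c x = - s1 x (g c x). *)
Definition eta_dx c x := - gS11 t x (dyn l c x) - gS12 t x (dyn l c x) * slope l c x.

Lemma eta_d c x : is_derive x 1 (eta l c) (eta_dx c x).
Proof.
have D : is_derive x 1 (fun x => gS1 t x (dyn l c x))
    (gS11 t x (dyn l c x) * 1 + gS12 t x (dyn l c x) * slope l c x).
  exact: (is_derive_chain2 (gS1_d t) (is_derive_id x 1) (slope_derive l c x)).
have -> : eta l c = (fun x => - gS1 t x (dyn l c x)) by apply/funext => y; exact: eta_dyn1.
by apply: is_derive_eq; rewrite mulr1 /eta_dx opprD.
Qed.

Lemma eta_dx_cont2 : cont2 eta_dx.
Proof.
have [_ _ c11 c12] := gS1_d t; have gc : cont2 (dyn l) := @dyn_cont2 R t l.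
have c2 (h : R -> R -> R) : cont2 h -> cont2 (fun c x => h x (dyn l c x)).
  by move=> hc; exact: (cont2_comp hc cont2_snd gc).
move=> p; apply: limB; first by apply: limN; exact: (c2 _ c11 p).
by apply: limM; [exact: (c2 _ c12 p)|exact: (@slope_cont2 R t l p)].
Qed.

Lemma prim_partials : has_partials (fun x c => prim l c x) (fun x c => eta l c x) (fun x c => hh l c x).
Proof.
split=> [x c|x c||]; [exact: prim_d|exact: prim_dc|..].
  exact: cont2_swap (@eta_cont2 R t l).
exact: cont2_swap (@hh_cont2 R t l).
Qed.

Lemma eta_loc_lip c0 x0 : exists L, exists2 d, 0 < d & forall c x c' x',
  `|c - c0| < d -> `|x - x0| < d -> `|c' - c0| < d -> `|x' - x0| < d ->
  `|eta l c x - eta l c' x'| <= L * Num.max `|x - x'| `|c - c'|.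
Proof.
pose M := `|c0| + 1; pose K := `|eta_dx c0 x0| + 1.
have K0 : 0 < K by rewrite ltr_wpDl.
have : \forall p \near (c0, x0), `|eta_dx p.1 p.2| < K.
  by apply: (cvgr_lt _ (limn (@eta_dx_cont2 (c0, x0)))); rewrite /K ltrDl.
move=> /nbhs_ballP[r /= r0 rK]; exists (K + lipC l M), (Num.min r 1); first by rewrite lt_min r0 ltr01.
move=> c x c' x'; rewrite !lt_min => /andP[cr c1] /andP[xr _] /andP[cr' c1'] /andP[xr' _].
have B d : `|d - c0| < 1 -> - M <= d <= M.
  by rewrite -ler_norml => h; have := ler_normD (d - c0) c0; rewrite subrK /M; lra.
have /andP[m1 m2] := B _ c1; have /andP[m3 m4] := B _ c1'.
have L0 := lipC_gt0 l M.
have -> : eta l c x - eta l c' x' = (eta l c x - eta l c x') + (eta l c x' - eta l c' x') by ring.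
apply: le_trans (ler_normD _ _) _; rewrite mulrDl; apply: lerD.
  have [z /andP[z1 z2] ->] := MVT_any x' x (eta_d c).
  rewrite normrM; apply: ler_pM => //; last by rewrite le_max lexx.
  apply/ltW/(rK (c, z)); split; rewrite /ball/= distrC//.
  rewrite ltr_norml in xr; rewrite ltr_norml in xr'; rewrite ltr_norml.
  move: xr xr' z1 z2 => /andP[? ?] /andP[? ?]; rewrite ge_min le_max => /orP[] ? /orP[] ?; lra.
rewrite (@le_trans _ _ (lipC l M * `|c - c'|))//; last by rewrite ler_pM2l// le_max lexx orbT.
wlog cc : c c' cr cr' c1 c1' m1 m2 m3 m4 / c <= c' => [h|].
  have [cc|/ltW cc] := leP c c'; first exact: h.
  by rewrite distrC [X in _ * X]distrC; apply: h.
have /andP[h1 h2] := eta_lipP l x' m1 cc m4.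
have h3 : 0 <= (c' - c) / lipC l M by rewrite divr_ge0 ?subr_ge0// ltW.
rewrite distrC ger0_norm; last exact: le_trans h1.
by rewrite [X in _ * X]distrC (ger0_norm (_ : 0 <= c' - c))// subr_ge0.
Qed.

(** The second derivative of u in c then x is dens - 1, and dens is at least
    the inverse Lipschitz constant of the conjugacy. *)
Lemma regular_of_leaves (u : annulus R -> R) :
  (forall x c, u (annulus_pi (x, c)) = prim l c x - c * x) -> regular_family u.
Proof.
move=> uE.
have HP : has_partials (fun x c => prim l c x - c * x) (fun x c => eta l c x - c)
    (fun x c => hh l c x - x).
  have [d1 d2 c1 c2] := prim_partials; split=> [x c|x c||].
  - have D : is_derive x 1 (fun x : R => c * x) (c * 1) by apply: is_deriveZ.
    by rewrite mulr1 in D; exact: is_deriveB (d1 x c) D.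
  - have D : is_derive c 1 (fun c : R => x * c) (x * 1) by apply: is_deriveZ.
    rewrite mulr1 in D; rewrite (_ : (fun c => _) = (fun c => prim l c x - x * c)).
      exact: is_deriveB (d2 x c) D.
    by apply/funext => z; rewrite [x * _]mulrC.
  - by move=> p; apply: limB; [exact: c1|exact: cvg_snd].
  - by move=> p; apply: limB; [exact: c2|exact: cvg_fst].
have UE : u \o @annulus_pi R = (fun p : R * R => prim l p.2 p.1 - p.2 * p.1).
  by apply/funext => -[x c]; exact: uE.
have P1 : partial1 (u \o @annulus_pi R) = (fun p : R * R => eta l p.2 p.1 - p.2).
  apply/funext => p; rewrite /partial1 UE.
  by rewrite (has_partials_D p ((1, 0) : R * R) HP) /= mul1r mul0r addr0.
have P2 : partial2 (u \o @annulus_pi R) = (fun p : R * R => hh l p.2 p.1 - p.1).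
  apply/funext => p; rewrite /partial2 UE.
  by rewrite (has_partials_D p ((0, 1) : R * R) HP) /= mul1r mul0r add0r.
split; rewrite ?P1 ?P2.
- by rewrite UE; exact: has_partials_C1 HP.
- move=> [x0 c0]; have [L [d d0 dL]] := eta_loc_lip c0 x0.
  exists (L + 1), (ball ((x0, c0) : R * R) d); first exact: nbhsx_ballx.
  move=> [[x c] [x' c']] /= [[/= b1 b2] [/= b3 b4]].
  rewrite /ball/= distrC in b1; rewrite /ball/= distrC in b2.
  rewrite /ball/= distrC in b3; rewrite /ball/= distrC in b4.
  have -> : `|((x, c) : R * R) - (x', c')| = Num.max `|x - x'| `|c - c'| by rewrite prod_normE.
  have -> : eta l c x - c - (eta l c' x' - c') = (eta l c x - eta l c' x') - (c - c') by ring.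
  apply: le_trans (ler_normB _ _) _; rewrite mulrDl mul1r; apply: lerD; first exact: dL.
  by rewrite le_max lexx orbT.
- move=> C cC; have [M [_ hM]] := compact_bounded cC.
  pose N := `|M| + 1; have MN : M < N by apply: le_lt_trans (ler_norm M) _; rewrite ltrDl.
  exists (lipC l (N + 1) + 1) => c Cc; have cN := hM _ MN _ Cc.
  have cN' : `|c| < N + 1 by apply: le_lt_trans cN _; rewrite ltrDl.
  have [_ _ hb _] := hh_conj l cN'.
  move=> [x y] _ /=; have -> : hh l c x - x - (hh l c y - y) = (hh l c x - hh l c y) - (x - y) by ring.
  apply: le_trans (ler_normB _ _) _; rewrite mulrDl mul1r lerD2r.
  exact: biLip_lip (lipC_gt0 _ _) hb.
- move=> K cK; have [M M0 hM] := annulus_compact_bound cK.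
  have L0 := lipC_gt0 l (M + 1); have Li : 0 < (lipC l (M + 1))^-1 by rewrite invr_gt0.
  exists ((lipC l (M + 1))^-1 / 2 - 1); first by lra.
  apply: aeW => -[x c] Kp; have := hM _ Kp => /= cM.
  have cM' : `|c| < M + 1 by apply: le_lt_trans cM _; rewrite ltrDl.
  have D : is_derive x 1 (fun x => hh l c x - x) (dens l c x - 1).
    have Dh := hh_d l c x; exact: is_deriveB.
  have [dd ->] := @partial1_is_derive (fun p => hh l p.2 p.1 - p.1) x c _ D.
  split=> //; rewrite ltrD2r.
  have [_ _ hb _] := hh_conj l cM'.
  suff : (lipC l (M + 1))^-1 <= dens l c x by lra.
  have Dh : is_derive x 1 (hh l c) (dens l c x) := hh_d l c x.
  move/is_deriveP: Dh => Dh; apply: (cvg_ge_cst Dh); near=> h.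
  have h0 : h != 0 by near: h; exact: nbhs_dnbhs_neq.
  have xh : x + h != x by rewrite -subr_eq0 addrAC subrr add0r.
  have /andP[+ _] := biLip_quot hb xh.
  by rewrite [X in _ / X]addrAC subrr add0r.
Unshelve. all: by end_near. Qed.

End Regular.

(** * Functions with a derivative bounded below almost everywhere *)

Section NullSections.
Local Open Scope ereal_scope.
Context d1 d2 (T1 : measurableType d1) (T2 : measurableType d2) (R : realType).
Variables (m1 : {sigma_finite_measure set T1 -> \bar R}) (m2 : {sigma_finite_measure set T2 -> \bar R}).

(** Fubini, integrating first over the first coordinate. *)
Lemma null_ysection A : measurable A -> (m1 \x m2) A = 0 ->
  {ae m2, forall y, m1 (ysection A y) = 0}.
Proof.
move=> mA A0.
have E : (m1 \x m2) A = (m1 \x^ m2) A.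
  by apply: product_measure_unique => //= *; rewrite product_measure2E.
rewrite A0 /product_measure2 in E.
have mf := measurable_fun_ysection m1 mA.
have [+ _] := ae_eq_integral_abs m2 measurableT mf.
have -> : \int[m2]_x `|(m1 \o ysection A) x| = 0.
  by rewrite [RHS]E; apply: eq_integral => c _; rewrite gee0_abs.
move=> /(_ erefl).
by apply: filterS => y /(_ I).
Qed.

End NullSections.

Section NullSets.
Context {R : realType}.
Implicit Types (a b c e k x y : R) (g v : R -> R).
Local Notation leb := (@lebesgue_measure R).

(** The supremum of the points x of [a, b] with g a <= g x has this property
    by continuity, and it must be b. *)
Lemma right_incr g a b : continuous g -> a <= b ->
  (forall x, a <= x -> x < b -> exists2 d, 0 < d & forall h, 0 < h -> h < d -> g x <= g (x + h)) ->
  g a <= g b.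
Proof.
move=> gc ab step; pose A : set R := [set x | a <= x <= b /\ g a <= g x].
have Aa : A a by split; rewrite ?lexx.
have hA : has_sup A by split; [exists a|exists b => x [/andP[]]].
have as_ : a <= sup A by apply: ub_le_sup => //; case: hA.
have sb : sup A <= b by apply: ge_sup => [|x [/andP[]]//]; exists a.
have gs : g a <= g (sup A).
  rewrite leNgt; apply/negP => lt.
  have : \forall x \near sup A, g x < g a by apply: cvgr_lt (gc _) _ lt.
  move=> /nbhs_ballP[d /= d0 dP].
  have [x Ax sx] := sup_adherent d0 hA.
  have xs : x <= sup A by apply: ub_le_sup => //; case: hA.
  have bx : ball (sup A) d x by rewrite /ball/= ger0_norm ?subr_ge0//; lra.
  by case: Ax => _ gx; have := dP x bx; rewrite ltNge gx.
have [sb'|bs] := ltP (sup A) b; last first.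
  by have -> : b = sup A by apply/eqP; rewrite eq_le bs.
have [d d0 dP] := step _ as_ sb'.
pose h := Num.min d (b - sup A) / 2.
have h0 : 0 < h by rewrite divr_gt0// lt_min d0 subr_gt0.
have h1 : h < d by rewrite /h; have := ge_min d d (b - sup A); rewrite lexx /= => ?; lra.
have h2 : h < b - sup A.
  by rewrite /h; have := ge_min (b - sup A) d (b - sup A); rewrite lexx orbT => ?; lra.
have : A (sup A + h) by split; [apply/andP; split; lra|apply: le_trans gs (dP _ h0 h1)].
by move=> /ub_le_sup -/(_ (proj2 hA)); lra.
Qed.

Lemma null_open_cover (N : set R) e : measurable N -> leb N = 0%E -> 0 < e ->
  exists G : set R, [/\ open G, N `<=` G & (leb G < e%:E)%E].
Proof.
move=> mN N0 e0.
have fN : (leb N < +oo)%E by rewrite N0 ltry.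
have [G [oO NO lO]] := lebesgue_regularity_outer mN fN e0.
exists G; split=> //; have mO := measurable_realfun.open_measurable oO.
have -> : G = (G `\` N) `|` N by rewrite setUC setDUK.
by rewrite measureU0//; exact: measurableD.
Qed.

Let leb_le (A B : set R) : measurable A -> measurable B -> A `<=` B -> (leb A <= leb B)%E.
Proof. by move=> mA mB AB; apply: le_measure => //; apply/mem_set. Qed.

Let lebU2 (A B : set R) : measurable A -> measurable B -> (leb (A `|` B) <= leb A + leb B)%E.
Proof. exact: (@measureU2 _ _ R leb A B). Qed.

Let lebU (A B : set R) : measurable A -> measurable B -> A `&` B = set0 ->
  (leb (A `|` B) = leb A + leb B)%E.
Proof. by move=> mA mB AB; rewrite measureU. Qed.

(** Cover the bad null set N by an open set G of small measure, and add to v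
    x - k x a large multiple of the measure of G between a and x. The sum
    increases to the right of every point: at points of G thanks to the
    added term, elsewhere thanks to the derivative. The added term is at
    most eps. *)
Lemma null_deriv_incr v (L k a b : R) (N : set R) : 0 <= L ->
  (forall x y, `|v x - v y| <= L * `|x - y|) -> measurable N -> leb N = 0%E ->
  (forall x, ~ N x -> exists2 d : R, is_derive x 1 v d & k < d) ->
  a <= b -> k * (b - a) <= v b - v a.
Proof.
move=> L0 vL mN N0 vd ab; apply/ler_addgt0Pl => eps eps0.
pose K := L + `|k|; have K0 : 0 <= K by rewrite addr_ge0.
pose e := eps / (K + 1); have e0 : 0 < e by rewrite divr_gt0// ltr_wpDl.
have [G [oO NO lO]] := null_open_cover mN N0 e0.
have mO : measurable G := measurable_realfun.open_measurable oO.
have mOi x : measurable (G `&` `[a, x]) by apply: measurableI.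
have fO x : leb (G `&` `[a, x]) \is a fin_num.
  rewrite ge0_fin_numE//; apply: le_lt_trans (ltry e); apply/ltW/(le_lt_trans _ lO).
  by apply: leb_le => //; exact: subIsetl.
pose m x := fine (leb (G `&` `[a, x])).
have mE x : (m x)%:E = leb (G `&` `[a, x]) by rewrite fineK.
have itvE x y : x <= y -> leb `]x, y] = (y - x)%:E.
  move=> xy; rewrite lebesgue_measure_itv/= lte_fin.
  by move: xy; rewrite le_eqVlt => /predU1P[->|->//]; rewrite ltxx subrr.
have m_le x y : x <= y -> m x <= m y.
  move=> xy; rewrite -lee_fin !mE; apply: leb_le => //.
  by apply: setIS => z /=; rewrite !in_itv/= => /andP[-> /le_trans->].
have m_lip x y : x <= y -> m y <= m x + (y - x).
  move=> xy; rewrite -lee_fin EFinD !mE -itvE//.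
  apply: (@le_trans _ _ (leb ((G `&` `[a, x]) `|` `]x, y]))); last by apply: lebU2 => //; exact: measurable_itv.
  apply: leb_le => //; first exact: measurableU.
  move=> z [Oz] /=; rewrite !in_itv/= => /andP[az zy].
  by have [zx|xz] := leP z x; [left; split=> //; rewrite az|right].
have m_O x y : a <= x -> x <= y -> (forall z, x < z -> z <= y -> G z) -> m x + (y - x) <= m y.
  move=> ax xy Oz; rewrite -lee_fin EFinD !mE -itvE// -lebU//.
    apply: leb_le => //; first exact: measurableU.
    move=> z [[Oz' /=]|/=]; rewrite !in_itv/=; first by move=> /andP[az zx]; split=> //=; rewrite az (le_trans zx).
    by move=> /andP[xz zy]; split; [exact: Oz|rewrite zy andbT (le_trans ax (ltW xz))].
  apply/seteqP; split=> // z [[_ /=]]; rewrite !in_itv/= => /andP[_ zx] /andP[xz _].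
  by move: (le_lt_trans zx xz); rewrite ltxx.
have ma : m a = 0.
  have m0 : 0 <= m a by rewrite -lee_fin mE.
  apply/eqP; rewrite eq_le m0 andbT -lee_fin mE.
  apply: le_trans (_ : (leb `[a, a] <= 0)%E); first by apply: leb_le => //; exact: subIsetr.
  by rewrite set_itv1 lebesgue_measure_set1.
have mb : m b <= e.
  rewrite -lee_fin mE; apply/ltW/(le_lt_trans _ lO).
  by apply: leb_le => //; exact: subIsetl.
have mc : continuous m.
  have ml x y : `|m x - m y| <= `|x - y|.
    wlog xy : x y / x <= y => [h|].
      by have [xy|/ltW yx] := leP x y; [exact: h|rewrite distrC (distrC x); exact: h].
    rewrite distrC ger0_norm ?subr_ge0 ?m_le// distrC ger0_norm ?subr_ge0//.
    by have := m_lip _ _ xy; lra.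
  move=> x; apply: (cvg_abs0 (g := fun y => `|y - x|)); first by near=> y.
  pose proof (limn (limB (@cvg_id _ (nbhs x)) (cvg_cst x))) as A.
  by rewrite subrr normr0 in A.
pose g x := v x - k * x + K * m x.
have vc : continuous v.
  move=> x; apply: (cvg_abs0 (g := fun y => L * `|y - x|)); first by near=> y.
  pose proof (limM (cvg_cst L) (limn (limB (@cvg_id _ (nbhs x)) (cvg_cst x)))) as A.
  by rewrite subrr normr0 mulr0 in A.
have gc : continuous g.
  move=> x; apply: limD; last by apply: limM; [exact: cvg_cst|exact: mc].
  by apply: limB; [exact: vc|apply: limM; [exact: cvg_cst|exact: cvg_id]].
have : g a <= g b.
  apply: right_incr => // x ax xb; have [Ox|nOx] := pselect (G x).
    have /nbhs_ballP[d /= d0 dP] : nbhs x G by apply: open_nbhs_nbhs.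
    exists d => // h h0 hd; rewrite /g.
    have := m_O x (x + h) ax (_ : x <= x + h); rewrite lerDl (ltW h0) => /(_ isT).
    have Oz z : x < z -> z <= x + h -> G z.
      by move=> xz zh; apply: dP; rewrite /ball/= ltr0_norm; lra.
    move=> /(_ Oz) mh; have := vL x (x + h).
    have -> : x - (x + h) = - h by ring.
    rewrite normrN (gtr0_norm h0) => vh; have := ler_norm (v x - v (x + h)).
    have : K * (m x + (x + h - x)) <= K * m (x + h) by rewrite ler_wpM2l.
    have : k * h <= `|k| * h by rewrite ler_wpM2r ?ler_norm// ltW.
    by rewrite /K; lra.
  have [d /is_deriveP D kd] := vd x (fun Nx => nOx (NO _ Nx)).
  have /nbhs_ballP[r /= r0 rP] : \forall h \near 0, h != 0 -> k < (v (x + h) - v x) / h.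
    exact: cvgr_gt D _ kd.
  exists r => // h h0 hr; have : k < (v (x + h) - v x) / h.
    by apply: rP; [rewrite /ball/= sub0r normrN gtr0_norm|rewrite gt_eqF].
  rewrite ltr_pdivlMr// /g => vh.
  have : K * m x <= K * m (x + h) by rewrite ler_wpM2l// m_le// lerDl ltW.
  by lra.
rewrite /g ma mulr0 addr0.
have : K * m b <= K * e by rewrite ler_wpM2l.
have : (K + 1) * e = eps by rewrite /e mulrC divfK// gt_eqF// ltr_wpDl.
by lra.
Unshelve. all: by end_near. Qed.

(** The bad sections form a null set, which contains no interval. *)
Lemma ae_section (P : R * R -> Prop) c0 e : 0 < e ->
  {ae (leb \x leb)%E, forall p, P p} ->
  exists2 c, `|c - c0| < e & exists N : set R,
    [/\ measurable N, leb N = 0%E & forall x, ~ N x -> P (x, c)].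
Proof.
move=> e0 [A [mA A0 PA]].
have [B [mB B0 hB]] := null_ysection mA A0.
suff [c ce nBc] : exists2 c, `|c - c0| < e & ~ B c.
  exists c => //; exists (ysection A c); split; first exact: measurable_ysection.
    by apply: contrapT => h; apply: nBc; apply: hB.
  move=> x nx; apply: contrapT => nP; apply: nx.
  by rewrite /ysection/= inE; exact: PA.
apply: contrapT => h.
have sub : `]c0, c0 + e[ `<=` B.
  move=> c /=; rewrite in_itv/= => /andP[c1 c2]; apply: contrapT => nB; apply: h.
  by exists c => //; rewrite gtr0_norm; lra.
have := leb_le (measurable_itv `]c0, c0 + e[) mB sub.
have -> : leb B = 0%E by exact: B0.
rewrite lebesgue_measure_itv/= lte_fin ltrDl e0 -EFinD lee_fin.
by lra.
Qed.

End NullSets.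

(** * From a regular family of solutions to a foliation *)

Section FromFamily.
Context {R : realType} (t : twist R) (S : R * R -> R) (F : R * R -> R * R)
  (f : annulus R -> annulus R) (u : annulus R -> R).
Implicit Types (a b c x y z r M : R).
Hypotheses (FP : forall x r, F (x, r) = (gF t x r, gS2 t x (gF t x r)))
  (Ff : forall p, annulus_pi (F p) = f (annulus_pi p))
  (SE : forall x y, gS t x y = S (x, y))
  (coer : forall M, exists N, forall x y, N < `|y - x| -> M < S (x, y) / `|y - x|)
  (uK : forall c : R, weak_KAM_solution S c (fun theta => u (theta, c)))
  (reg : regular_family u).

Let U := u \o @annulus_pi R.
Let D x c := partial1 U (x, c).
Let V x c := partial2 U (x, c).
Let e c x := c + D x c.

Let UP : has_partials (fun x c => U (x, c)) D V.
Proof. by have [CU _ _ _] := reg; exact: C1_has_partials. Qed.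

Let U_per x c : U (x + 1, c) = U (x, c).
Proof. by rewrite /U/= /annulus_pi/= circle_pi1. Qed.

(** For almost every c the bound on the derivative in x holds at almost
    every x, so [null_deriv_incr] applies; the other values of c follow by
    continuity. *)
Let V_slope M : exists2 k, -1 < k &
  forall c x y, `|c| < M -> x <= y -> k * (y - x) <= V y c - V x c.
Proof.
have [_ _ hL hk] := reg; have [_ _ _ Vc] := UP.
have cK : compact ([set: circle R] `*` `[- M, M]).
  by apply: compact_setX; [exact: circle_compact|exact: segment_compact].
have [k k1 kP] := hk _ cK; have [L LP] := hL _ (@segment_compact R (- M) M).
exists k => // c x y cM xy; rewrite leNgt; apply/negP => lt.
have vc : continuous (fun c => V y c - V x c).
  by move=> z; apply: limB; exact: (cont2_1 Vc).
have : \forall z \near c, V y z - V x z < k * (y - x) by apply: cvgr_lt (vc c) _ lt.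
move=> /nbhs_ballP[d /= d0 dP].
have d0' : 0 < Num.min d (M - `|c|) by rewrite lt_min d0 subr_gt0.
have [c' c'c [N [mN N0 NP]]] := ae_section c d0' kP.
have c'd : `|c' - c| < d by apply: lt_le_trans c'c _; rewrite ge_min lexx.
have c'M : `|c' - c| < M - `|c| by apply: lt_le_trans c'c _; rewrite ge_min lexx orbT.
have c'I : - M <= c' <= M by rewrite -ler_norml; have := ler_normD (c' - c) c; rewrite subrK; lra.
have := dP c'; rewrite /ball/= distrC => /(_ c'd); rewrite ltNge => /negP; apply.
apply: (@null_deriv_incr _ (V ^~ c') (Num.max L 0) k x y N) => //; first by rewrite le_max lexx orbT.
- move=> a b; have := LP c' c'I (a, b) (conj I I); rewrite /= => h.
  by apply: le_trans h _; rewrite ler_wpM2r// le_max lexx.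
- move=> z nz; have [|dd kd] := NP z nz; first by split.
  by have dd' := partial1_derive dd; eexists; [exact: dd'|exact: kd].
Qed.

(** Integrate the increments of V in c: they bound below the double
    difference of U over a rectangle, and dividing by the width in x gives
    D. *)
Let D_slope M : exists2 k, -1 < k & forall x c c', - M < c -> c <= c' -> c' < M ->
  k * (c' - c) <= D x c' - D x c.
Proof.
have [k k1 kP] := V_slope M; exists k => // x c c' Mc cc' c'M.
have [Ud1 Ud2 _ _] := UP.
have rect y z : y <= z ->
    k * (z - y) * (c' - c) <= (U (z, c') - U (z, c)) - (U (y, c') - U (y, c)).
  move=> yz; have dd (a : R) : is_derive a 1 (fun a => U (z, a) - U (y, a)) (V z a - V y a).
    exact: is_deriveB.
  have [b /andP[b1 b2] bE] := MVT_any c c' dd.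
  rewrite (min_idPl cc') in b1; rewrite (max_idPr cc') in b2.
  have bM : `|b| < M by rewrite ltr_norml; apply/andP; split; lra.
  have := kP b y z bM yz => /(ler_wpM2r (_ : 0 <= c' - c)); rewrite subr_ge0 => /(_ cc').
  by lra.
have : is_derive x 1 (fun x => U (x, c') - U (x, c)) (D x c' - D x c) by exact: is_deriveB.
move=> /is_deriveP dw; apply: (cvg_ge_cst dw); near=> h.
have h0 : h != 0 by near: h; exact: nbhs_dnbhs_neq.
case: (ltgtP h 0) h0 => // hh _.
- rewrite ler_ndivlMr//; have xh : x + h <= x by rewrite gerDl ltW.
  by have := rect _ _ xh; lra.
- rewrite ler_pdivlMr//; have xh : x <= x + h by rewrite lerDl ltW.
  by have := rect _ _ xh; lra.
Unshelve. all: by end_near. Qed.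

Let e_slope M : exists2 m, 0 < m & forall x c c', - M < c -> c <= c' -> c' < M ->
  m * (c' - c) <= e c' x - e c x.
Proof.
have [k k1 kP] := D_slope M; exists (1 + k); first lra.
by move=> x c c' h1 h2 h3; have := kP x c c' h1 h2 h3; rewrite /e; lra.
Qed.

Let e_incr x : {homo (e^~ x) : c c' / c < c'}.
Proof.
move=> c c' cc'; have [m m0 mP] := e_slope (`|c| + `|c'| + 1).
have := mP x c c'; have := ler_norm c'; have := ler_norm (- c); rewrite normrN => h1 h2.
have := normr_ge0 c; have := normr_ge0 c' => h3 h4.
have a1 : - (`|c| + `|c'| + 1) < c by lra.
have a2 : c' < `|c| + `|c'| + 1 by lra.
move=> /(_ a1 (ltW cc') a2) h; rewrite -subr_gt0; apply: lt_le_trans h.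
by rewrite mulr_gt0// subr_gt0.
Qed.

Let e_cont2 : cont2 e.
Proof.
have [_ _ Dc _] := UP; move=> p; apply: limD; first exact: cvg_fst.
have Ds : cont2 (fun c x => D x c) by exact: cont2_swap.
exact: (Ds p).
Qed.

Let e_cont2s : cont2 (fun x c => e c x).
Proof. exact: cont2_swap. Qed.

Let e_per c x : e c (x + 1) = e c x.
Proof.
congr (_ + _); have [Ud _ _ _] := UP.
have /is_deriveP d1 := Ud (x + 1) c; have /is_deriveP d2 := Ud x c.
apply: (cvg_uniq d1); apply: cvg_eq_near d2; near=> h.
by rewrite addrAC !U_per.
Unshelve. all: by end_near. Qed.

Let e_mean c x : exists2 z, x < z < x + 1 & e c z = c.
Proof.
have [Ud1 _ _ _] := UP.
have dd (z : R) : is_derive z 1 (fun z => c * z + U (z, c)) (c * 1 + D z c).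
  have d1 : is_derive z 1 (fun z : R => c * z) (c * 1) by apply: is_deriveZ.
  exact: is_deriveD.
have x1 : x < x + 1 by rewrite ltrDl.
have [z zx zE] := MVT_lt x1 dd; exists z => //.
by move: zE; rewrite U_per /e; lra.
Qed.

Let deriv_min0 (g dg : R -> R) x : (forall z : R, is_derive z 1 g (dg z)) ->
  (forall y, g x <= g y) -> dg x = 0.
Proof.
move=> gd gm; have x1 : x - 1 <= x + 1 by lra.
have xI : x \in `]x - 1, x + 1[ by rewrite in_itv/=; apply/andP; split; lra.
have gdv z : z \in `]x - 1, x + 1[ -> derivable g z 1 by move=> _; have [] := gd z.
have h0 := derive1_at_min x1 gdv xI (fun z _ => gm z).
have <- := @derive_val _ _ _ _ _ _ _ h0.
by have := @derive_val _ _ _ _ _ _ _ (gd x).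
Qed.

(** By coercivity the infimum defining u (y, c) is attained at some x. The
    first order condition in x places the starting point of the step on the
    graph, the one in y its endpoint. *)
Let calib c y : exists x, e c x = - gS1 t x y /\ e c y = gS2 t x y.
Proof.
have [vc v1 [a [ale aeps]]] := weak_KAM_ineq (uK c).
have [Ud1 _ _ _] := UP; have [Sd1 Sd2 _ _] := gS_d t.
have UE z : u (circle_pi z, c) = U (z, c) by [].
pose Q x := U (x, c) + gS t x y + c * (x - y) + a.
have Q_ge x : U (y, c) <= Q x by rewrite /Q SE; have := ale x y.
have Q_eps eps : 0 < eps -> exists x, Q x < U (y, c) + eps.
  by move=> e0; have [x hx] := aeps y eps e0; exists x; rewrite /Q SE.
have Qd x : is_derive x 1 Q (D x c + gS1 t x y + c).
  have d1 : is_derive x 1 (fun x : R => c * (x - y)) (c * (1 - 0)).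
    by apply: is_deriveZ.
  rewrite subr0 mulr1 in d1.
  have d2 : is_derive x 1 (fun x => U (x, c) + gS t x y) (D x c + gS1 t x y) by exact: is_deriveD.
  have d3 := is_deriveD d2 d1.
  have := is_deriveD d3 (is_derive_cst a x 1); rewrite addr0; exact.
have Qc : continuous Q by move=> x; exact: is_derive_cont (Qd x).
have [B B0 hB] := per_bounded vc v1.
have [N hN] := coer (`|c| + 1).
pose rho := `|N| + `|a| + 2 * B + 1.
have rho0 : 0 <= rho by rewrite /rho; have := normr_ge0 N; have := normr_ge0 a; lra.
have far x : rho < `|y - x| -> U (y, c) + 1 < Q x.
  move=> hr; have yx0 : 0 < `|y - x| := le_lt_trans rho0 hr.
  have := hN x y; rewrite ltr_pdivlMr// -SE => h.
  have {}h : (`|c| + 1) * `|y - x| < gS t x y.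
    apply: h; apply: le_lt_trans (ler_norm N) _; apply: le_lt_trans hr.
    by rewrite /rho; have := normr_ge0 a; lra.
  have := hB x; have := hB y; rewrite !ler_norml !UE => /andP[_ h1] /andP[h2 _].
  have : - (`|c| * `|y - x|) <= c * (x - y).
    by rewrite -normrM -(normrN (c * _)) -mulrN opprB; have := ler_norm (- (c * (x - y))); rewrite normrN; lra.
  have := ler_norm (- a); rewrite normrN /Q => h3 h4.
  by move: hr; rewrite /rho; have := normr_ge0 N; lra.
have [||x0 x0I x0m] := @EVT_min R Q (y - rho) (y + rho); first by lra.
  exact: continuous_subspaceT.
have x0E : Q x0 = U (y, c).
  apply/eqP; rewrite eq_le Q_ge andbT leNgt; apply/negP => lt.
  have [|x hx] := Q_eps (Num.min 1 (Q x0 - U (y, c))); first by rewrite lt_min ltr01 subr_gt0.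
  have [xr|/far] := leP `|y - x| rho.
    have := x0m x; rewrite in_itv/=; move: xr; rewrite ler_norml => /andP[r1 r2].
    have xI : y - rho <= x <= y + rho by apply/andP; split; lra.
    move=> /(_ xI); move: hx; rewrite -ltrBlDl lt_min => /andP[_]; lra.
  by move: hx; rewrite -ltrBlDl lt_min => /andP[+ _]; lra.
exists x0; split.
- have := deriv_min0 Qd (_ : forall z, Q x0 <= Q z); rewrite x0E => /(_ Q_ge).
  by rewrite /e; lra.
- pose P z := U (x0, c) + gS t x0 z + c * (x0 - z) + a - U (z, c).
  have Pd z : is_derive z 1 P (gS2 t x0 z - c - D z c).
    have d1 : is_derive z 1 (fun z : R => c * (x0 - z)) (c * (0 - 1)) by apply: is_deriveZ.
    have d2 := is_deriveD (is_derive_cst (U (x0, c)) z 1) (Sd2 x0 z).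
    have d3 := is_deriveD (is_deriveD d2 d1) (is_derive_cst a z 1).
    have := is_deriveB d3 (Ud1 z c).
    by rewrite add0r addr0 sub0r mulrN1; exact.
  have := deriv_min0 Pd (_ : forall z, P y <= P z) => h.
  have : gS2 t x0 y - c - D y c = 0.
    apply: h => z; have -> : P y = 0 by rewrite /P -/(Q x0) x0E subrr.
    by rewrite /P subr_ge0 SE; exact: ale.
  by rewrite /e; lra.
Qed.

Let g c x := gF t x (e c x).

(** Steps given by [calib] define a continuous degree one injection p with F
    (p y, e c (p y)) = (y, e c y). It is onto, so it inverts the action of F
    on the graph. *)
Let g_invariant c : [/\ forall x, gS2 t x (g c x) = e c (g c x),
  {homo g c : x y / x <= y}, forall x, g c (x + 1) = g c x + 1 & forall y, exists x, g c x = y].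
Proof.
have /choice[p pP] := calib c.
have s2_inj x x' y : gS2 t x y = gS2 t x' y -> x = x'.
  by case: (ltgtP x x') => // /(s2_decr t y) + E; rewrite E ltxx.
have gp y : g c (p y) = y by apply/gFP; have [] := pP y.
have p1 y : p (y + 1) = p y + 1.
  apply: (@s2_inj _ _ (y + 1)); rewrite s2_per.
  by have [_ <-] := pP (y + 1); have [_ <-] := pP y; rewrite e_per.
have pc : continuous p.
  move=> y; apply: (@implicit_lim R _ _ _ (fun y x => - gS2 t x y) (fun z => z) p y).
  - have [_ _ _ c2] := gS_d t; move=> q; apply: limN; have c2' : cont2 (fun y x => gS2 t x y) by [exact: cont2_swap]; exact: (c2' q).
  - by move=> z x x' xx; rewrite ltrN2; exact: s2_decr.
  - exact: cvg_id.
  - have ec : continuous (e c) by exact: (cont2_1 e_cont2).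
    rewrite (_ : (fun z => _) = (fun z => - e c z)); last by apply/funext => z; have [_ ->] := pP z.
    by have [_ <-] := pP y; apply: limN; exact: ec.
have p_inj : injective p by move=> y y' yy; rewrite -(gp y) yy gp.
have p_incr := deg1_inj_incr pc p1 p_inj.
have p_onto := deg1_onto pc p1.
have pg x : p (g c x) = x by have [y <-] := p_onto x; rewrite gp.
split=> [x|x y xy|x|y]; last by exists (p y).
- by have [y <-] := p_onto x; rewrite gp; have [] := pP y.
- rewrite leNgt; apply/negP => /p_incr; rewrite !pg; lra.
- by apply: p_inj; rewrite pg p1 pg.
Qed.

Let segment_bound (h : R -> R) x y : x <= y -> continuous h ->
  exists B, forall z, x <= z -> z <= y -> `|h z| <= B.
Proof.
move=> xy hc; have hc' : {within `[x, y], continuous (fun z => `|h z|)}.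
  by apply: continuous_subspaceT => z; apply: limn; exact: hc.
have [z0 _ zm] := EVT_max xy hc'; exists `|h z0| => z xz zy.
by apply: zm; rewrite in_itv/= xz.
Qed.

Let gF_incr x r r' : r <= r' -> gF t x r <= gF t x r'.
Proof.
move=> rr; have /gFP E := erefl (gF t x r); have /gFP E' := erefl (gF t x r').
by rewrite leNgt; apply/negP => /(s1_decr t x); lra.
Qed.

Let s1_le x y y' : y <= y' -> gS1 t x y' <= gS1 t x y.
Proof. by rewrite le_eqVlt => /predU1P[->//|/(s1_decr t x)/ltW]. Qed.

(** If the leaves stayed below r over x, then g c would be bounded on a
    period independently of c, since it is monotone of degree one; by the
    twist e c would be bounded there too, although its mean is c. *)
Let e_onto x r : exists c, e c x = r.
Proof.
have s1c y : continuous (fun z => - gS1 t z y).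
  by have [_ _ c1 _] := gS_d t; move=> z; apply: limN; exact: (cont2_2 (y := y) c1).
have up : exists c, r < e c x.
  apply: contrapT => h; have le c : e c x <= r by rewrite leNgt; apply/negP => h'; apply: h; exists c.
  have x1 : x <= x + 1 by rewrite lerDl.
  have [B hB] := segment_bound x1 (s1c (gF t x r + 1)).
  have [z /andP[z1 z2] zE] := e_mean (B + 1) x; have [_ gi g1 _] := g_invariant (B + 1).
  have /gFP zs := erefl (g (B + 1) z).
  have : - gS1 t z (gF t x r + 1) <= B.
    by apply: le_trans (ler_norm _) (hB _ (ltW z1) (ltW z2)); lra.
  have gz : g (B + 1) z <= gF t x r + 1.
    by have := gi _ _ (ltW z2); rewrite g1 /g; have := gF_incr x (le (B + 1)); lra.
  by have := s1_le z gz; lra.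
have dn : exists c, e c x < r.
  apply: contrapT => h; have le c : r <= e c x by rewrite leNgt; apply/negP => h'; apply: h; exists c.
  have x1 : x - 1 <= x by rewrite gerBl.
  have [B hB] := segment_bound x1 (s1c (gF t x r - 1)).
  have [z] := e_mean (- B - 1) (x - 1); rewrite subrK => /andP[z1 z2] zE.
  have [_ gi g1 _] := g_invariant (- B - 1).
  have /gFP zs := erefl (g (- B - 1) z).
  have : - B <= - gS1 t z (gF t x r - 1).
    have := hB z (ltW z1) (ltW z2); rewrite ler_norml => /andP[]; lra.
  have gz : gF t x r - 1 <= g (- B - 1) z.
    have := gi _ _ (ltW z1); have := g1 (x - 1); rewrite subrK /g.
    by have := gF_incr x (le (- B - 1)); lra.
  by have := s1_le z gz; lra.
have [c1 h1] := up; have [c2 h2] := dn.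
apply: (@IVT_any R (e^~ x) c2 c1); last by rewrite !ltW.
exact: (cont2_2 (y := x) e_cont2).
Qed.

(** The chart is (x, c) |-> (x, c + du/dx); it is injective and bi-Lipschitz
    by the lower bound on the slopes in c, and its inverse is continuous by
    monotonicity. *)
Lemma foliation_of_family : exists eta, lipschitz_foliation f eta.
Proof.
pose E0 c (b : circle R) := e c (repr b); exists E0.
have E0E c x : E0 c (circle_pi x) = e c x.
  have [k kE] := circle_pi_eq (circle_reprK (circle_pi x)).
  by rewrite /E0 kE (per_int (e_per c)).
pose G (p : R * R) : R * R := (p.1, e p.2 p.1).
have /choice[lev levP] : forall p : R * R, exists c, e c p.1 = p.2.
  by move=> p; exact: e_onto.
have levc : cont2 (fun x r => lev (x, r)).
  apply: (@implicit_cont2 R (fun x c => e c x)); first exact: e_cont2s.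
    by move=> x; exact: e_incr.
  by move=> x r; exact: levP.
have e_inj x c c' : e c x = e c' x -> c = c'.
  by case: (ltgtP c c') => // /(@e_incr x) + ee; rewrite ee ltxx.
pose H (p : R * R) : R * R := (p.1, lev p).
have G1 : deg1_lift G by move=> x c; rewrite /G/= e_per.
have H1 : deg1_lift H.
  by move=> x r; rewrite /H/=; congr pair; apply: (e_inj x); rewrite levP/= -e_per levP.
have Gc : continuous G.
  move=> p; apply: (lim_pair (f := fst) (g := fun q : R * R => e q.2 q.1) (a := p.1) (b := e p.2 p.1)).
    exact: cvg_fst.
  exact: (@e_cont2s p).
have Hc : continuous H.
  move=> [x r]; apply: (lim_pair (f := fst) (g := lev) (a := x) (b := lev (x, r))); first exact: cvg_fst.
  rewrite (_ : lev = (fun p => lev (p.1, p.2))); first exact: (levc (x, r)).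
  by apply/funext => -[].
have GH : cancel G H by move=> [x c]; rewrite /G/H/=; congr pair; apply: (e_inj x); rewrite levP.
have HG : cancel H G by move=> [x r]; rewrite /G/H/= levP.
have dG (p : annulus R) : (p.1, E0 p.2 p.1) = desc G p.
  by rewrite /desc /annulus_pi /= circle_reprK.
split.
- move=> c; apply: circle_cont => x.
  rewrite (_ : _ \o _ = e c); last by apply/funext => y; exact: E0E.
  exact: (cont2_1 (x := c) e_cont2).
- exists (desc H); rewrite (_ : (fun p => _) = desc G); last by apply/funext => p; rewrite dG.
  by split; [exact: desc_cont|exact: desc_cont|exact: deg1_lift_cancel..].
- move=> p; have [[x0 c0] <-] := annulus_pi_ex p.
  have [_ lip _ _] := reg; have [L0 [W Wn WL]] := lip (x0, c0).
  pose L := `|L0| + 1; have L1 : 1 <= L by rewrite lerDr.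
  have [m m0 mP] := e_slope (`|c0| + 1).
  have /nbhs_ballP[d /= d0 dW] := Wn.
  have d40 : 0 < Num.min d 4^-1 by rewrite lt_min d0/= invr_gt0.
  have eL (q q' : R * R) : ball ((x0, c0) : R * R) d q -> ball ((x0, c0) : R * R) d q' ->
      `|e q.2 q.1 - e q'.2 q'.1| <= L * Num.max `|q.1 - q'.1| `|q.2 - q'.2|.
    move=> qB q'B; have := WL (q, q') (conj (dW _ qB) (dW _ q'B)); rewrite /= prod_normE/=.
    move=> h; rewrite /e.
    have -> : q.2 + D q.1 q.2 - (q'.2 + D q'.1 q'.2) =
      (D q.1 q.2 - D q'.1 q'.2) + (q.2 - q'.2) by ring.
    apply: le_trans (ler_normD _ _) _; rewrite mulrDl mul1r; apply: lerD; last by rewrite le_max lexx orbT.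
    by rewrite /D -!surjective_pairing; apply: le_trans h _; rewrite ler_wpM2r ?ler_norm//.
  exists (L + (1 + m^-1 * (1 + L))), (@annulus_pi R @` ball ((x0, c0) : R * R) (Num.min d 4^-1)).
    exact: annulus_pi_open (nbhsx_ballx _ _ d40).
  move=> _ _ [[x c] [/= xb cb] <-] [[x' c'] [/= xb' cb'] <-].
  move: xb cb xb' cb'; rewrite /ball/= !lt_min => /andP[x1 x2] /andP[y1 y2] /andP[x3 x4] /andP[y3 y4].
  have i0 : 0 < m^-1 by rewrite invr_gt0.
  have xx : `|x - x'| < 2^-1.
    by move: x2 x4; rewrite !ltr_norml => /andP[? ?] /andP[? ?]; apply/andP; split; lra.
  rewrite /annulus_dist /= !circle_distE int_dist_small// !E0E.
  pose d1 := Num.max `|x - x'| `|c - c'|; pose d2 := Num.max `|x - x'| `|e c x - e c' x'|.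
  rewrite -/d1 -/d2.
  have d1x : `|x - x'| <= d1 by rewrite le_max lexx.
  have d1c : `|c - c'| <= d1 by rewrite le_max lexx orbT.
  have d2x : `|x - x'| <= d2 by rewrite le_max lexx.
  have d2e : `|e c x - e c' x'| <= d2 by rewrite le_max lexx orbT.
  have d10 : 0 <= d1 by apply: le_trans d1x.
  have d20 : 0 <= d2 by apply: le_trans d2x.
  have k0 : 0 <= m^-1 * (1 + L) by rewrite mulr_ge0//; lra.
  have h1 : d2 <= L * d1.
    rewrite ge_max; apply/andP; split; first by apply: le_trans d1x _; rewrite ler_peMl.
    exact: (@eL (x, c) (x', c')).
  have h2 : d1 <= (1 + m^-1 * (1 + L)) * d2.
    rewrite ge_max; apply/andP; split.
      by apply: le_trans d2x _; rewrite ler_peMl// lerDl.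
    have a1 : `|c - c'| <= m^-1 * `|e c x - e c' x|.
      have cI z : `|c0 - z| < 4^-1 -> - (`|c0| + 1) < z < `|c0| + 1.
        by rewrite -ltr_norml => h; have := ler_normB c0 (c0 - z); rewrite subKr; lra.
      have /andP[i1 i2] := cI _ y2; have /andP[i3 i4] := cI _ y4.
      rewrite ler_pdivlMl//.
      have [cc|/ltW cc] := leP c c'.
        rewrite distrC ger0_norm ?subr_ge0// distrC.
        exact: le_trans (mP x c c' i1 cc i4) (ler_norm _).
      by rewrite ger0_norm ?subr_ge0//; exact: le_trans (mP x c' c i3 cc i2) (ler_norm _).
    apply: le_trans a1 _; rewrite mulrDl mul1r.
    have : `|e c x - e c' x| <= (1 + L) * d2.
      have -> : e c x - e c' x = (e c x - e c' x') + (e c' x' - e c' x) by ring.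
      apply: le_trans (ler_normD _ _) _; rewrite mulrDl mul1r lerD//.
      apply: le_trans (@eL (x', c') (x, c') _ _) _; [by split|by split|].
      by rewrite /= subrr normr0 (max_idPl (normr_ge0 _)) distrC ler_wpM2l//; lra.
    rewrite -(ler_pM2l i0) mulrA; lra.
  have k2 : 0 <= L * d2 by rewrite mulr_ge0//; lra.
  have k3 : 0 <= (1 + m^-1 * (1 + L)) * d1 by rewrite mulr_ge0// addr_ge0.
  by split; rewrite mulrDl; [apply: le_trans h1 _; rewrite lerDl|apply: le_trans h2 _; rewrite lerDr].
- move=> c; have [gi _ _ go] := g_invariant c; apply/seteqP; split.
    move=> _ [p pl <-]; have [[x r] pE] := annulus_pi_ex p.
    move: pl; rewrite -pE -Ff FP /leaf /= E0E => ->.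
    by rewrite -/(g c x) gi E0E.
  move=> p; have [[y r] <-] := annulus_pi_ex p; rewrite /leaf/= E0E => ->.
  have [x <-] := go y; exists (annulus_pi (x, e c x)); first by rewrite /= E0E.
  by rewrite -Ff FP /annulus_pi/= -/(g c x) gi.
Qed.

End FromFamily.

(** * Primitives depending on a parameter *)

Section ParametricPrimitive.
Context {R : realType}.
Implicit Types (x c h e : R) (f I : R -> R -> R).

Definition primitive2 f I := forall x, I x 0 = 0 /\ forall c : R, is_derive c 1 (I x) (f x c).

Lemma primitive2_ex f : cont2 f -> exists I, primitive2 f I.
Proof.
move=> fc; have /choice[I IP] : forall x, exists J : R -> R,
    J 0 = 0 /\ forall c : R, is_derive c 1 J (f x c).
  by move=> x; have [J J0 Jd] := antiderivative (cont2_1 (x := x) fc); exists J.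
by exists I.
Qed.

(** The point b where the derivative is taken stays in a compact set, so
    that limits can be taken along ultrafilters. *)
Lemma mean_at0 (a J : R -> R) c : J 0 = 0 -> (forall c : R, is_derive c 1 J (a c)) ->
  exists2 b, `|b| <= `|c| & J c = a b * c.
Proof.
move=> J0 Jd; have [b /andP[b1 b2] bE] := MVT_any 0 c Jd.
rewrite !subr0 J0 ?subr0 in bE; exists b => //.
move: b1 b2; rewrite ge_min le_max; have := ler_norm c; have := ler_norm (- c).
by rewrite normrN ler_norml => h1 h2 /orP[] ? /orP[] ?; apply/andP; split; lra.
Qed.

Lemma primitive2_cont f I : cont2 f -> primitive2 f I -> cont2 I.
Proof.
move=> fc IP [x c]; apply: cvg_ultraP => U UU FU.
have xl : (fun p : R * R => p.1) @ U --> x by move=> A A0; apply: FU; exact: cvg_fst A0.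
have cl : (fun p : R * R => p.2) @ U --> c by move=> A A0; apply: FU; exact: cvg_snd A0.
have Ic : continuous (I x) by move=> z; exact: is_derive_cont ((IP x).2 z).
have /choice[b bP] : forall p : R * R, exists b, `|b| <= `|p.2| /\
    I p.1 p.2 - I x p.2 = (f p.1 b - f x b) * p.2.
  move=> p; have [|z|b b1 b2] := @mean_at0 (fun z => f p.1 z - f x z) (fun z => I p.1 z - I x z) p.2.
  - by rewrite (IP p.1).1 (IP x).1 subrr.
  - have d1 := (IP p.1).2 z; have d2 := (IP x).2 z; exact: is_deriveB.
  by exists b.
have [b0 bl] : exists b0 : R, b @ U --> b0.
  apply: (bounded_ultra_cvg (M := `|c| + 1)).
  have : \forall p \near U, `|p.2| < `|c| + 1 by apply: (cvgr_lt _ (limn cl)); rewrite ltrDl.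
  by apply: filterS => p pc; have [h _] := bP p; apply: le_trans h (ltW pc).
pose proof (limM (limB (cont2_cvg fc xl bl) (cont2_cvg fc (cvg_cst x) bl)) cl) as A.
rewrite subrr mul0r in A.
pose proof (limD A (lim_continuous cl (Ic c))) as B; rewrite add0r in B.
by apply: cvg_eq_near B; near=> p; have [_ <-] := bP p; rewrite subrK.
Unshelve. all: by end_near. Qed.

(** Differentiation under the integral sign: the error of the difference
    quotient is itself a primitive, so it equals c (f1 w b - f1 x b) with w
    between x and x + h. *)
Lemma primitive2_partials f f1 I I1 : cont2 f -> cont2 f1 ->
  (forall x c, is_derive x 1 (f^~ c) (f1 x c)) ->
  primitive2 f I -> primitive2 f1 I1 -> has_partials I I1 f.
Proof.
move=> fc f1c fd IP I1P; split => [x c|x c||//]; last exact: primitive2_cont I1P.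
  apply/is_deriveP; apply: cvg_ultraP => U UU FU.
  have hl : (fun h : R => h) @ U --> (0 : R) by move=> A A0; apply: FU; exact: nbhs_dnbhs.
  have hn : \forall h \near U, h != 0 :> R by apply: FU; apply/nbhs_ballP; exists 1 => //= h _.
  have /choice[z zP] : forall h : R, exists z : R * R, h != 0 ->
      [/\ `|z.1| <= `|c|, Num.min x (x + h) <= z.2 <= Num.max x (x + h) &
      (I (x + h) c - I x c) / h - I1 x c = (f1 z.2 z.1 - f1 x z.1) * c].
    move=> h; have [->|h0] := eqVneq h 0; first by exists (0, 0).
    have [|y|b b1 b2] := @mean_at0 (fun z => h^-1 * (f (x + h) z - f x z) - f1 x z)
        (fun z => h^-1 * (I (x + h) z - I x z) - I1 x z) c.
    - by rewrite (IP (x + h)).1 (IP x).1 (I1P x).1 subrr mulr0 subrr.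
    - have d1 := (IP (x + h)).2 y; have d2 := (IP x).2 y; have d3 := (I1P x).2 y.
      have d4 : is_derive y 1 (fun z => I (x + h) z - I x z) (f (x + h) y - f x y) by exact: is_deriveB.
      have d5 : is_derive y 1 (fun z => h^-1 * (I (x + h) z - I x z)) (h^-1 * (f (x + h) y - f x y)).
        exact: is_deriveZ.
      exact: is_deriveB.
    have [w wI wE] := MVT_any x (x + h) (fun u => fd u b).
    exists (b, w) => _; split => //=; rewrite mulrC b2 wE.
    have -> : x + h - x = h by ring.
    by rewrite [h^-1 * _]mulrC mulfK.
  have [b0 bl] : exists b0 : R, (fun h => (z h).1) @ U --> b0.
    apply: (bounded_ultra_cvg (M := `|c|)); apply: filterS hn => h /zP[]//.
  have xh : (fun h => x + h) @ U --> x.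
    by pose proof (limD (cvg_cst x) hl) as A; rewrite addr0 in A.
  have wl : (fun h => (z h).2) @ U --> x.
    apply: (cvg_abs0 (g := fun h => `|h|)).
      apply: filterS hn => h /zP[_ /andP[+ +] _]; rewrite ge_min le_max => h1 h2.
      have := ler_norm h; have := ler_norm (- h); rewrite normrN ler_norml => h3 h4.
      by move: h1 h2 => /orP[] ? /orP[] ?; apply/andP; split; lra.
    by pose proof (limn hl) as A; rewrite normr0 in A.
  pose proof (limM (limB (cont2_cvg f1c wl bl) (cont2_cvg f1c (cvg_cst x) bl)) (cvg_cst c)) as A.
  rewrite subrr mul0r in A.
  pose proof (limD A (cvg_cst (I1 x c))) as B; rewrite add0r in B.
  by apply: cvg_eq_near B; apply: filterS hn => h /zP[_ _ <-]; rewrite subrK.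
by have [_] := IP x; exact.
Qed.

(** The mean of df/dc over [c - e, c + e]. It commutes with partial
    derivatives. *)
Definition avg (e : R) f x c := (f x (c + e) - f x (c - e)) / (2 * e).

Lemma avg_partials e f f1 f2 : has_partials f f1 f2 ->
  has_partials (avg e f) (avg e f1) (avg e f2).
Proof.
move=> HP; have aE (g : R -> R -> R) x c : avg e g x c = (2 * e)^-1 * (g x (c + e) - g x (c - e)) by rewrite /avg [RHS]mulrC.
have sh s : has_partials (fun x c => f x (c + s)) (fun x c => f1 x (c + s)) (fun x c => f2 x (c + s)).
  have H2 : has_partials (fun _ c : R => c + s) (fun _ _ => 0) (fun _ _ => 1).
    split=> [x c|x c||]; first exact: is_derive_cst.
    - by have := is_deriveD (is_derive_id c 1) (is_derive_cst s c 1); rewrite addr0.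
    - by move=> p; exact: cvg_cst.
    - by move=> p; exact: cvg_cst.
  by apply: has_partials_ext (has_partials_comp HP has_partials_fst H2) => x c //=; ring.
have [d1 d2 c1 c2] := sh e; have [d1' d2' c1' c2'] := sh (- e).
split=> [x c|x c||].
- have d := is_deriveB (d1 x c) (d1' x c).
  have d3 : is_derive x 1 (fun x => (2 * e)^-1 * (f x (c + e) - f x (c - e)))
    ((2 * e)^-1 * (f1 x (c + e) - f1 x (c - e))) by exact: is_deriveZ.
  rewrite aE (_ : (avg e f)^~ c = (fun x => (2 * e)^-1 * (f x (c + e) - f x (c - e)))) //.
  by apply/funext => y; rewrite aE.
- have d := is_deriveB (d2 x c) (d2' x c).
  have d3 : is_derive c 1 (fun c => (2 * e)^-1 * (f x (c + e) - f x (c - e)))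
    ((2 * e)^-1 * (f2 x (c + e) - f2 x (c - e))) by exact: is_deriveZ.
  rewrite aE (_ : avg e f x = (fun c => (2 * e)^-1 * (f x (c + e) - f x (c - e)))) //.
  by apply/funext => y; rewrite aE.
- by move=> p; apply: limM; [apply: limB; [exact: (@c1 p)|exact: (@c1' p)]|exact: cvg_cst].
- by move=> p; apply: limM; [apply: limB; [exact: (@c2 p)|exact: (@c2' p)]|exact: cvg_cst].
Qed.

Lemma avg_mean e f f2 x c : 0 < e -> (forall c : R, is_derive c 1 (f x) (f2 x c)) ->
  exists2 z, `|z - c| < e & avg e f x c = f2 x z.
Proof.
move=> e0 fd; have ce : c - e < c + e by lra.
have [z /andP[z1 z2] zE] := MVT_lt ce fd; exists z; first by rewrite ltr_norml; apply/andP; split; lra.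
rewrite /avg zE; have -> : c + e - (c - e) = 2 * e by ring.
by rewrite mulfK// gt_eqF// mulr_gt0.
Qed.

Lemma C1_of_derive (g dg : R -> R) : (forall x : R, is_derive x 1 g (dg x)) -> continuous dg -> C1 g.
Proof.
move=> gd gc; have df x : differentiable g x by apply/derivable1_diffP; have [] := gd x.
split=> // v.
have -> : (fun x => 'D_v g x) = (fun x => v * dg x).
  apply/funext => x; have gx := @derive_val _ _ _ _ _ _ _ (gd x).
  rewrite deriveE// -gx deriveE// -[in LHS](mulr1 v) -[v * 1]/(v *: (1 : R)) linearZ.
  by [].
by move=> x; apply: limM; [exact: cvg_cst|exact: gc].
Qed.

End ParametricPrimitive.

(** * Straightening the foliation *)

Section PartialsArith.
Context {R : realType}.

Lemma has_partials_sub : has_partials (fun x y : R => x - y) (fun _ _ => 1) (fun _ _ => - 1).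
Proof.
split=> [x y|x y||].
- by have := is_deriveB (is_derive_id x 1) (is_derive_cst y x 1); rewrite subr0.
- by have := is_deriveB (is_derive_cst x y 1) (is_derive_id y 1); rewrite sub0r.
- by move=> p; exact: cvg_cst.
- by move=> p; exact: cvg_cst.
Qed.

Lemma has_partials_mul : has_partials (fun x y : R => x * y) (fun _ y => y) (fun x _ => x).
Proof.
split=> [x y|x y||].
- rewrite (_ : (fun x => _) = (fun x => y * x)); last by apply/funext => z; rewrite mulrC.
  have d : is_derive x 1 (fun x : R => y * x) (y * 1) by apply: is_deriveZ.
  by rewrite mulr1 in d.
- have d : is_derive y 1 (fun y : R => x * y) (x * 1) by apply: is_deriveZ.
  by rewrite mulr1 in d.
- exact: cont2_snd.
- exact: cont2_fst.
Qed.

Lemma dist_lt (z a e : R) : `|z - (a - e)| < e -> z < a.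
Proof. by rewrite ltr_norml => /andP[_ h]; lra. Qed.

Lemma dist_gt (z a e : R) : `|z - (a + e)| < e -> a < z.
Proof. by rewrite ltr_norml => /andP[h _]; lra. Qed.

End PartialsArith.

Section Straighten.
Context {R : realType} (t : twist R) (l : leaves t).
Implicit Types (x y c r e z : R).
Local Notation E := (eta l).
Local Notation H := (hh l).

Let H_deg1 c x : H c (x + 1) = H c x + 1.
Proof.
have cM : `|c| < `|c| + 1 by rewrite ltrDl.
by have [_ h _ _] := hh_conj l cM.
Qed.

Let H_incr c : {homo H c : x y / x < y}.
Proof.
have cM : `|c| < `|c| + 1 by rewrite ltrDl.
have [_ _ h _] := hh_conj l cM; exact: biLip_lt (lipC_gt0 _ _) h.
Qed.

Let H_dyn c x : H c (dyn l c x) = H c x + rot l c.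
Proof.
have cM : `|c| < `|c| + 1 by rewrite ltrDl.
by have [_ _ _ h] := hh_conj l cM.
Qed.

Let H_cont2 : cont2 H. Proof. exact: hh_cont2. Qed.
Let E_cont2 : cont2 E. Proof. exact: eta_cont2. Qed.
Let E_cont2s : cont2 (fun x c => E c x). Proof. exact: cont2_swap. Qed.

Lemma eta_inj c c' x : E c x = E c' x -> c = c'.
Proof. by case: (ltgtP c c') => // /(@eta_incr _ _ l _ _ x) + ee; rewrite ee ltxx. Qed.

Let levP := choice (fun p : R * R => eta_onto l p.1 p.2).
(** The mean of the leaf through (x, r). *)
Definition level x r := projT1 levP (x, r).

Lemma eta_level x r : E (level x r) x = r.
Proof. exact: (projT2 levP (x, r)). Qed.

Lemma level_eta x c : level x (E c x) = c.
Proof. by apply: (eta_inj (x := x)); rewrite eta_level. Qed.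

Lemma level_cont2 : cont2 level.
Proof.
apply: (@implicit_cont2 R (fun x c => E c x)) => //; last exact: eta_level.
by move=> x c c'; exact: eta_incr.
Qed.

Lemma level_per x r : level (x + 1) r = level x r.
Proof. by apply: (eta_inj (x := x)); rewrite eta_level -eta_per eta_level. Qed.

Let hinvP := choice (fun p : R * R => deg1_onto (cont2_1 (x := p.1) H_cont2) (H_deg1 p.1) p.2).
Let hinv c y := projT1 hinvP (c, y).
Let hinvK c y : H c (hinv c y) = y.
Proof. exact: (projT2 hinvP (c, y)). Qed.

Let H_inj c : injective (H c).
Proof. by move=> x y; case: (ltgtP x y) => // /(@H_incr c) + ee; rewrite ee ltxx. Qed.

Let hinv_cont2 : cont2 hinv.
Proof. by apply: (implicit_cont2 H_cont2 H_incr). Qed.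

(** A point of the leaf of mean c is sent to the circle of height c by the
    conjugacy [hh]. *)
Definition straighten (p : R * R) : R * R := (H (level p.1 p.2) p.1, level p.1 p.2).
Definition unstraighten (p : R * R) : R * R := (hinv p.2 p.1, E p.2 (hinv p.2 p.1)).

Lemma straighten_deg1 : deg1_lift straighten.
Proof. by move=> x r; rewrite /straighten/= level_per H_deg1. Qed.

Lemma unstraighten_deg1 : deg1_lift unstraighten.
Proof.
move=> y c; rewrite /unstraighten/=.
have -> : hinv c (y + 1) = hinv c y + 1 by apply: (@H_inj c); rewrite H_deg1 !hinvK.
by rewrite eta_per.
Qed.

Let pair_cont (f g : R -> R -> R) : cont2 f -> cont2 g ->
  continuous (fun p : R * R => (f p.1 p.2, g p.1 p.2)).
Proof.
move=> fc gc p.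
by apply: (lim_pair (f := fun q : R * R => f q.1 q.2) (g := fun q : R * R => g q.1 q.2)
  (a := f p.1 p.2) (b := g p.1 p.2)); [exact: (@fc p)|exact: (@gc p)].
Qed.

Lemma straighten_cont : continuous straighten.
Proof.
apply: (pair_cont (f := fun x r => H (level x r) x) (g := level)); last exact: level_cont2.
exact: cont2_comp H_cont2 level_cont2 cont2_fst.
Qed.

Lemma unstraighten_cont : continuous unstraighten.
Proof.
have hs : cont2 (fun y c => hinv c y) by exact: cont2_swap.
apply: (pair_cont (f := fun y c => hinv c y) (g := fun y c => E c (hinv c y))) => //.
exact: cont2_comp E_cont2 cont2_snd hs.
Qed.

Lemma straightenK : cancel straighten unstraighten.
Proof.
move=> [x r]; rewrite /straighten /unstraighten/=.
have -> : hinv (level x r) (H (level x r) x) = x by apply: (@H_inj (level x r)); rewrite hinvK.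
by rewrite eta_level.
Qed.

Lemma unstraightenK : cancel unstraighten straighten.
Proof. by move=> [y c]; rewrite /straighten /unstraighten/= level_eta hinvK. Qed.

Lemma straighten_homeos : inverse_homeos (desc straighten) (desc unstraighten).
Proof.
split; [exact: desc_cont straighten_deg1 straighten_cont|
  exact: desc_cont unstraighten_deg1 unstraighten_cont|..].
  exact: deg1_lift_cancel straighten_deg1 unstraighten_deg1 straightenK.
exact: deg1_lift_cancel unstraighten_deg1 straighten_deg1 unstraightenK.
Qed.

Lemma straighten_leaf c x : straighten (x, E c x) = (H c x, c).
Proof. by rewrite /straighten/= level_eta. Qed.

Lemma unstraighten_leaf y c : exists x, unstraighten (y, c) = (x, E c x) /\ H c x = y.
Proof. by exists (hinv c y); rewrite hinvK. Qed.

Lemma straighten_dyn c x : straighten (dyn l c x, E c (dyn l c x)) = (H c x + rot l c, c).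
Proof. by rewrite straighten_leaf H_dyn. Qed.

Let w x c := prim l c x.
Let ex x c := E c x.
Let hx x c := H c x.
Let dx x c := eta_dx l c x.
Let ws : has_partials w ex hx. Proof. exact: prim_partials. Qed.
Let exc : cont2 ex. Proof. exact: E_cont2s. Qed.
Let dxc : cont2 dx.
Proof. by apply: (@cont2_swap R (fun c x => eta_dx l c x)); exact: eta_dx_cont2. Qed.
Let wc : cont2 w. Proof. exact: has_partials_cont ws. Qed.

Let JP := cid (primitive2_ex wc).
Let J1P := cid (primitive2_ex exc).
Let J11P := cid (primitive2_ex dxc).
Let J := projT1 JP.
Let J1 := projT1 J1P.
Let J11 := projT1 J11P.
Let Js : has_partials J J1 w.
Proof.
apply: (@primitive2_partials R w ex) => //; [|exact: (projT2 JP)|exact: (projT2 J1P)].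
by move=> x c; exact: prim_d.
Qed.
Let J1s : has_partials J1 J11 ex.
Proof.
apply: (@primitive2_partials R ex dx) => //; [|exact: (projT2 J1P)|exact: (projT2 J11P)].
by move=> x c; exact: eta_d.
Qed.
Let J1_per x c : J1 (x + 1) c = J1 x c.
Proof.
have [_ d _ _] := J1s; have [j0 _] := projT2 J1P x; have [j0' _] := projT2 J1P (x + 1).
have d' z : is_derive z 1 (J1 (x + 1)) (ex x z) by rewrite /ex -eta_per; exact: d.
by have := eq_antiderivative d' (d x) c 0; rewrite -/J1 in j0 j0' *; rewrite j0 j0' !subr0.
Qed.
Let J_per x c : J (x + 1) c = J x c + c * c / 2.
Proof.
have [_ d _ _] := Js; have [j0 _] := projT2 JP x; have [j0' _] := projT2 JP (x + 1).
have d' z : is_derive z 1 (fun c => J x c + c * c / 2) (w (x + 1) z).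
  have d1 : is_derive z 1 (fun c : R => c * c) (z * 1 + z * 1).
    by have := is_deriveM (is_derive_id z 1) (is_derive_id z 1).
  have d2 : is_derive z 1 (fun c : R => 2^-1 * (c * c)) (2^-1 * (z * 1 + z * 1)) by exact: is_deriveZ.
  have d3 := is_deriveD (d x z) d2.
  rewrite /w prim_deg; have -> : prim l z x + z = prim l z x + 2^-1 * (z * 1 + z * 1) by field.
  by rewrite (_ : (fun c => _) = J x + (fun c => 2^-1 * (c * c)))//; apply/funext => b; rewrite [b * b / 2]mulrC.
have := eq_antiderivative (d (x + 1)) d' c 0; rewrite -/J in j0 j0' *.
by rewrite j0 j0' !mul0r addr0 !subr0.
Qed.

Section Approximant.
Variable e : R.
Hypothesis e0 : 0 < e.

Let A := avg e J.
Let P := avg e J1.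
Let X := avg e w.
Let Pc := avg e ex.
Let As : has_partials A P X. Proof. exact: avg_partials Js. Qed.
Let Ps : has_partials P (avg e J11) Pc. Proof. exact: avg_partials J1s. Qed.
Let Xs : has_partials X Pc (avg e hx). Proof. exact: avg_partials ws. Qed.

Let Pc_gt0 x c : 0 < Pc x c.
Proof. have ce : c - e < c + e by rewrite ltrD2l (lt_trans _ e0)// oppr_lt0.
by rewrite /Pc /avg divr_gt0 ?mulr_gt0// subr_gt0; exact: eta_incr. Qed.

Let A_per x c : A (x + 1) c = A x c + c.
Proof.
rewrite /A /avg !J_per.
have -> : J x (c + e) + (c + e) * (c + e) / 2 - (J x (c - e) + (c - e) * (c - e) / 2) =
  J x (c + e) - J x (c - e) + c * (2 * e) by field.
by rewrite mulrDl mulfK// gt_eqF// mulr_gt0.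
Qed.

Let P_per x c : P (x + 1) c = P x c.
Proof. by rewrite /P /avg !J1_per. Qed.

Let X_deg1 x c : X (x + 1) c = X x c + 1.
Proof.
rewrite /X /avg /w !prim_deg.
have -> : prim l (c + e) x + (c + e) - (prim l (c - e) x + (c - e)) =
  prim l (c + e) x - prim l (c - e) x + 1 * (2 * e) by ring.
by rewrite mulrDl mulfK// gt_eqF// mulr_gt0.
Qed.

Let P_mean x c : exists2 z, `|z - c| < e & P x c = E z x.
Proof. by have [_ d _ _] := J1s; exact: (avg_mean c e0 (d x)). Qed.

Let X_mean x c : exists2 z, `|z - c| < e & X x c = H z x.
Proof. by have [_ d _ _] := ws; exact: (avg_mean c e0 (d x)). Qed.

Let P_onto x r : exists c, P x c = r.
Proof.
have [z1 h1 E1] := P_mean x (level x r - e); have [z2 h2 E2] := P_mean x (level x r + e).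
apply: (@IVT_any R (P x) (level x r - e) (level x r + e)).
  exact: (cont2_1 (has_partials_cont Ps)).
rewrite E1 E2; have := eta_incr l x (dist_lt h1); have := eta_incr l x (dist_gt h2).
by rewrite eta_level => /ltW -> /ltW ->.
Qed.

Let kapP := choice (fun p : R * R => P_onto p.1 p.2).
Let ka x r := projT1 kapP (x, r).
Let kaK x r : P x (ka x r) = r. Proof. exact: (projT2 kapP (x, r)). Qed.
Let P_inj x c c' : P x c = P x c' -> c = c'.
Proof.
by case: (ltgtP c c') => // /(@pos_partial_incr _ _ _ _ Ps Pc_gt0 x) + ee; rewrite ee ltxx.
Qed.
Let ka_per x r : ka (x + 1) r = ka x r.
Proof. by apply: (@P_inj x); rewrite kaK -P_per kaK. Qed.
Let kas := implicit_partials Ps Pc_gt0 kaK.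

Let Xss := has_partials_swap Xs.
Let X_incr c : {homo (X^~ c) : x y / x < y}.
Proof. exact: (pos_partial_incr Xss (fun c x => Pc_gt0 x c)). Qed.
Let X_inj c x x' : X x c = X x' c -> x = x'.
Proof. by case: (ltgtP x x') => // /(@X_incr c) + ee; rewrite ee ltxx. Qed.
Let sigP := choice (fun p : R * R =>
  deg1_onto (cont2_2 (y := p.1) (has_partials_cont Xs)) (fun x => X_deg1 x p.1) p.2).
Let sig c y := projT1 sigP (c, y).
Let sigK c y : X (sig c y) c = y. Proof. exact: (projT2 sigP (c, y)). Qed.
Let sig_deg1 c y : sig c (y + 1) = sig c y + 1.
Proof. by apply: (@X_inj c); rewrite X_deg1 !sigK. Qed.
Let sigs := has_partials_swap (implicit_partials Xss (fun c x => Pc_gt0 x c) sigK).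

(** A generating function A in the variables (x, c) defines (x, dA/dx) |->
    (dA/dc, c). Here A is the average of the primitive of prim in c, whose
    mixed derivative is positive; without the average, A would only be C^1
    and define [straighten]. *)
Definition approx (p : R * R) : R * R := (X p.1 (ka p.1 p.2), ka p.1 p.2).
Let unapprox (p : R * R) : R * R := (sig p.2 p.1, P (sig p.2 p.1) p.2).

Lemma approx_deg1 : deg1_lift approx.
Proof. by move=> x r; rewrite /approx/= ka_per X_deg1. Qed.

Let unapprox_deg1 : deg1_lift unapprox.
Proof. by move=> y c; rewrite /unapprox/= sig_deg1 P_per. Qed.

Let Xka := has_partials_comp Xs has_partials_fst kas.

Lemma approx_C1 : C1 approx.
Proof. by apply: C1_pair; [exact: has_partials_C1 Xka|exact: has_partials_C1 kas]. Qed.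

Let unapprox_C1 : C1 unapprox.
Proof.
apply: C1_pair; first exact: has_partials_C1 sigs.
exact: has_partials_C1 (has_partials_comp Ps sigs has_partials_snd).
Qed.

Let C1_cont (G : R * R -> R * R) : C1 G -> continuous G.
Proof. by move=> [dG _] p; exact: differentiable_continuous. Qed.

Let approxK : cancel approx unapprox.
Proof.
move=> [x r]; rewrite /approx /unapprox/=.
have -> : sig (ka x r) (X x (ka x r)) = x by apply: (@X_inj (ka x r)); rewrite sigK.
by rewrite kaK.
Qed.

Let unapproxK : cancel unapprox approx.
Proof.
move=> [y c]; rewrite /approx /unapprox/=.
have -> : ka (sig c y) (P (sig c y) c) = c by apply: (@P_inj (sig c y)); rewrite kaK.
by rewrite sigK.
Qed.

(** The primitive of c d(A_c) - A_x dx is c A_c - A, where A_x is the height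
    r of the point; it is periodic since A gains c and A_c gains 1 over a
    period. *)
Lemma approx_exact : exact_symplectic_diffeo (desc approx).
Proof.
have lf := desc_lift approx_deg1 (C1_cont approx_C1).
have lf' := desc_lift unapprox_deg1 (C1_cont unapprox_C1).
have a1 : annulus_C1 (desc approx) := ex_intro _ approx (conj lf approx_C1).
have a2 : annulus_C1 (desc unapprox) := ex_intro _ unapprox (conj lf' unapprox_C1).
have c1 := deg1_lift_cancel approx_deg1 unapprox_deg1 approxK.
have c2 := deg1_lift_cancel unapprox_deg1 approx_deg1 unapproxK.
split; first exact: (ex_intro _ (desc unapprox) (And4 a1 a2 c1 c2)).
- exact: desc_homotopic approx_deg1 (C1_cont approx_C1).
pose Z x r := ka x r * X x (ka x r) - A x (ka x r).
pose h (p : annulus R) := Z (repr p.1) p.2.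
have Z_per x r : Z (x + 1) r = Z x r by rewrite /Z ka_per X_deg1 A_per; ring.
have hE : h \o @annulus_pi R = (fun p : R * R => Z p.1 p.2).
  apply/funext => -[x r]; rewrite /h/=.
  have [k ->] := circle_pi_eq (circle_reprK (circle_pi x)).
  exact: (per_int (f := fun x => Z x r)).
pose k1 x r := - avg e J11 x (ka x r) / Pc x (ka x r).
pose k2 x r := (Pc x (ka x r))^-1.
have Zs : has_partials Z
    (fun x r => ka x r * (Pc x (ka x r) * 1 + avg e hx x (ka x r) * k1 x r) - r)
    (fun x r => ka x r * (Pc x (ka x r) * 0 + avg e hx x (ka x r) * k2 x r)).
  apply: has_partials_ext (has_partials_comp has_partials_sub
    (has_partials_comp has_partials_mul kas Xka) (has_partials_comp As has_partials_fst kas)) => x r.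
  - by [].
  - by rewrite /= -/(k1 x r) kaK; ring.
  - by rewrite /= -/(k2 x r); ring.
exists approx, h; split; [exact: lf|exact: approx_C1|rewrite hE; exact: has_partials_C1 Zs|].
move=> p v; rewrite hE (has_partials_D p v Zs).
rewrite (_ : (fun q => (approx q).1) = (fun q : R * R => X q.1 (ka q.1 q.2)))//.
by rewrite (has_partials_D p v Xka) /approx /= -/(k1 p.1 p.2) -/(k2 p.1 p.2); ring.
Qed.
(** Both components are values at nearby leaves, by the mean value theorem. *)
Lemma approx_close x r : `|(approx (x, r)).2 - level x r| < e /\
  exists2 z, `|z - level x r| < 2 * e & (approx (x, r)).1 = H z x.
Proof.
have [z1 h1 E1] := P_mean x (ka x r); rewrite kaK -[LHS](eta_level x r) in E1.
have {}h1 : `|ka x r - level x r| < e by rewrite (eta_inj E1) distrC.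
split=> //; have [z2 h2 E2] := X_mean x (ka x r); exists z2 => //.
have -> : z2 - level x r = (z2 - ka x r) + (ka x r - level x r) by ring.
by apply: le_lt_trans (ler_normD _ _) _; rewrite mulr_natl mulr2n ltrD.
Qed.

End Approximant.

(** By [approx_close] the approximants of width e are uniformly close on
    compact sets, as hh is uniformly continuous there. *)
Lemma straighten_exact_homeo : exact_symplectic_homeo (desc straighten).
Proof.
split; first by exists (desc unstraighten); exact: straighten_homeos.
have ep n : 0 < n.+1%:R^-1 :> R by rewrite invr_gt0.
exists (fun n => desc (approx (ep n))); first by move=> n; exact: approx_exact.
move=> K cK; have [N0 N00 hN] : exists2 M, 0 < M & forall p, (desc straighten @` K) p -> `|p.2| <= M.
  apply: annulus_compact_bound; apply: continuous_compact => //.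
  apply: continuous_subspaceT => p.
  exact: desc_cont straighten_deg1 straighten_cont p.
move=> W /uniform_nbhs[V [entV VW]].
move: entV; rewrite -(@entourage_from_ballE R (circle R * R)%type) => -[e /= e0 eV].
pose M := Num.max N0 1; have M1 : 1 <= M by rewrite le_max lexx orbT.
have NM : N0 <= M by rewrite le_max lexx.
have Hs : cont2 (fun x c => H c x) by exact: cont2_swap.
have [d d0 dP] := cont2_unif M Hs e0.
have md : 0 < Num.min (d / 2) e by rewrite lt_min divr_gt0.
have hn : \forall n \near \oo, n.+1%:R^-1 < Num.min (d / 2) e.
  have := @cvg_harmonic R; move=> /cvgrPdist_lt/(_ _ md); apply: filterS => n.
  by rewrite sub0r normrN /harmonic/= gtr0_norm// invr_gt0.
apply: filterS hn => n; rewrite lt_min => /andP[nd ne]; apply: VW => p Kp; apply: eV => /=.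
have [[x0 r] pE] := annulus_pi_ex p; have [k k0 k1] := mod1 x0.
pose x := x0 - k%:~R; have {}pE : p = annulus_pi (x, r).
  by rewrite -pE /annulus_pi/= -(circle_pi_int x k) subrK.
have lN : `|level x r| <= M.
  apply: le_trans NM; have := hN (desc straighten p); rewrite pE descE//=; last exact: straighten_deg1.
  by apply; exists (annulus_pi (x, r)); [rewrite -pE|rewrite descE//; exact: straighten_deg1].
have xM : `|x| <= M by rewrite ger0_norm// (le_trans _ M1)// ltW.
have [c1 [z zc zE]] := approx_close (ep n) x r.
rewrite pE !descE; [|exact: approx_deg1|exact: straighten_deg1].
split; last by rewrite /ball/= distrC; exact: lt_trans c1 ne.
apply/circle_ballP; rewrite circle_distE; apply: le_lt_trans (int_dist_norm _) _.
rewrite zE distrC; apply: dP => //; apply: lt_trans zc _.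
by rewrite mulrC -ltr_pdivlMr.
Qed.

End Straighten.

(** * The theorem *)

Section Rotation.
Context {R : realType}.

Lemma rot_homeo (t : twist R) (l : leaves t) : homeomorphism (rot l).
Proof.
have [inv invK] := choice (rot_onto l).
have inc : {homo rot l : x y / x < y} by move=> x y; exact: rot_incr.
exists inv; split=> //; first exact: rot_cont.
- move=> y; apply: (@implicit_lim R _ _ _ (fun _ c => rot l c) (fun z => z) inv y) => //.
  + have rc : continuous (rot l) by exact: rot_cont.
    move=> p; apply: (lim_continuous (f := fun q : R * R => q.2) (h := rot l)); last exact: rc.
    exact: cvg_snd.
  + by rewrite invK (_ : (fun z => rot l (inv z)) = id); [exact: cvg_id|apply/funext => z; rewrite invK].
- move=> x; have := invK (rot l x).
  by case: (ltgtP (inv (rot l x)) x) => // /inc + ee; rewrite ee ltxx.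
Qed.

End Rotation.

Theorem theorem1p4 (R : realType) (f : annulus R -> annulus R)
    (F : R * R -> R * R) (S : R * R -> R) (u : annulus R -> R)
    (f_twist : symplectic_twist_map f)
    (F_lift : is_lift F f)
    (S_gen : generating_function F S)
    (u_cont : continuous u)
    (u_zero : forall c : R, u (0, c) = 0)
    (u_KAM : forall c : R, weak_KAM_solution S c (fun theta => u (theta, c))) :
  (lipschitz_integrable f <-> regular_family u) /\
  (forall eta : R -> circle R -> R, lipschitz_foliation f eta ->
   exists (Phi Psi : annulus R -> annulus R) (rho : R -> R),
     [/\ inverse_homeos Phi Psi /\ exact_symplectic_homeo Phi,
         forall a : R, circle_C1 (fun theta => Phi (theta, eta a theta)),
         [set Phi @` leaf (eta a) | a in [set: R]] =
           [set horizontal_circle c | c in [set: R]],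
         homeomorphism rho /\ {homo rho : x y / x < y} &
         forall (x : circle R) (c : R),
           Phi (f (Psi (x, c))) = (x + circle_pi (rho c), c)]).
Proof.
have [Fc Ff] := F_lift; have [t [SE _ _ FP]] := twist_ex Fc S_gen.
split; first split.
- move=> [E0 fol]; have [l _] := foliation_leaves FP Ff fol.
  apply: (@regular_of_leaves R t l) => x c.
  have [vc v1 [a [ale aeps]]] := weak_KAM_ineq (u_KAM c).
  apply: (@weak_KAM_unique R t l c a (fun x => u (circle_pi x, c))) => //.
  + have -> : circle_pi 0 = 0 :> circle R by apply: (addIr (circle_pi 0)); rewrite -circle_piD addr0 add0r.
    exact: u_zero.
  + by move=> y z; rewrite SE; exact: ale.
  + by move=> y e e0; have [z] := aeps y e e0; exists z; rewrite SE.
- by have [_ _ coer _ _] := S_gen; exact: (foliation_of_family FP Ff SE coer u_KAM).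
move=> E0 fol; have [l [a [aE aonto]]] := foliation_leaves FP Ff fol.
have PhiE c x : desc (straighten l) (circle_pi x, E0 (a c) (circle_pi x)) = annulus_pi (hh l c x, c).
  rewrite -aE -[(circle_pi x, _)]/(annulus_pi (x, eta l c x)).
  by rewrite descE ?straighten_leaf//; exact: straighten_deg1.
exists (desc (straighten l)), (desc (unstraighten l)), (rot l); split.
- by split; [exact: straighten_homeos|exact: straighten_exact_homeo].
- move=> b; have [c <-] := aonto b; exists (fun x => (hh l c x, c)); last by move=> x; rewrite PhiE.
  apply: C1_pair; first exact: (C1_of_derive (hh_d l c) (@dens_cont _ _ l c)).
  by apply: (C1_of_derive (dg := fun=> 0)) => x; exact: cvg_cst.
- have leafE c : desc (straighten l) @` leaf (E0 (a c)) = horizontal_circle c.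
    rewrite /leaf /horizontal_circle; apply/seteqP; split=> [_ [[b r] /= -> <-]|[y c'] /= ->].
      by rewrite -(circle_reprK b) PhiE.
    have [x [_ xE]] := unstraighten_leaf l (repr y) c.
    exists (circle_pi x, E0 (a c) (circle_pi x)) => //.
    by rewrite PhiE xE /annulus_pi/= circle_reprK.
  apply/seteqP; split=> _ [b _ <-]; last by exists (a b).
  by have [c <-] := aonto b; exists c.
- by split; [exact: rot_homeo|move=> x y; exact: rot_incr].
- move=> y c; have [x [xE hx]] := unstraighten_leaf l (repr y) c.
  rewrite -(circle_reprK y) -[(circle_pi (repr y), c)]/(annulus_pi (repr y, c)).
  rewrite descE; last exact: unstraighten_deg1.
  rewrite xE -Ff FP -/(dyn l c x) eta_inv descE; last exact: straighten_deg1.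
  by rewrite straighten_dyn hx /annulus_pi/= circle_piD.
Qed.
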